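(* Call $H\subseteq\mathcal F_{25}$ a legal fixed set for $(p,q)$, $0\le p\le q\le\infty$, if $(H,p,q)$ is a fixed point of $\operatorname{Can}$. In each of the following six disjoint threshold regions, the legal fixed sets are the same for all $(p,q)$ in the region, and their number is: - $p=q=0$: $8$ sets (contributing 8 fixed nodes); - $p=0$, $1\le q<\infty$: $7$ sets (contributing 7 one-parameter families); - $p=0$, $q=\infty$: $28$ sets (contributing 28 fixed nodes); - $1\le p\le q<\infty$: $9$ sets (contributing 9 two-parameter families); - $1\le p<\infty$, $q=\infty$: $36$ sets (contributing 36 one-parameter families); - $p=q=\infty$: $117$ sets (contributing 117 fixed nodes). Thus the full lattice $\operatorname{Sub}(\mathcal V)$ (whose elements correspond bijectively to the fixed points of $\operatorname{Can}$ via $(H,p,q)\mapsto\mathcal U(H,p,q)$) has $153$ fixed nodes, $43$ families indexed by a positive integer, and $9$ families indexed by pairs of integers $1\le p\le q<\infty$.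
   Context: Language: two binary operations $+,\cdot$, no constants. $u\preceq v$ abbreviates $u+v\approx v$. Modulo the commutative ai-semiring axioms (both operations associative and commutative, $x+x\approx x$, distributivity) a term is a finite nonempty set (sum) of commutative monomials. The semiring $R_{12}$: its universe is $\{0,c,p,q,a,b\}$ (letters used as elements only in this paragraph); multiplication is commutative with only nonzero products $pb=bp=ab=ba=aq=qa=c$; addition is the join of the partial order generated by $a<p<0$, $b<q<0$, $c<0$, $a<c$, $b<q<c$. $\mathcal V=\mathsf V(R_{12})$ is the variety generated by $R_{12}$; $\mathcal V[E]$ is the subvariety of $\mathcal V$ defined by adjoining the identities in $E$; $\operatorname{Sub}(\mathcal V)$ is the lattice of subvarieties. In $\mathcal V$ all squares are equal and additively greatest; $0$ denotes this common value. Abbreviations: $C(t,u)=t+tu$, $D(t,u)=t+u+tu$, $L(a,b,c,d)=ab+bc+cd$ (all letters in identities are variables). $\mathcal F_{25}$ consists of the 25 identities: $\rho: x\preceq xy$; $\eta: z\preceq x+xy+yz$; $\omega: y\preceq x+xy$; $\zeta: z\preceq C(x,y)+zt$; $\lambda: z\preceq D(x,y)+xz$; $\eta_D: z\preceq x+xy+yz+D(t,u)$; $\omega_D: y\preceq C(x,y)+D(t,u)$; $\zeta_D: z\preceq D(x,y)+zt$; $\mu: ad\preceq b+L(a,b,c,d)$; $\nu: ad\preceq C(t,u)+L(a,b,c,d)$; $\mu_2: ad\preceq b+c+L(a,b,c,d)$; $\mu_D: ad\preceq b+L(a,b,c,d)+D(t,u)$; $\nu_D: ad\preceq L(a,b,c,d)+D(t,u)$;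 $\delta: ad\preceq L(a,b,c,d)$; $\xi: x^2\approx D(x,y)$; $\beta: xz\preceq C(x,y)+C(t,z)$; $s: x^2\approx C(x,y)$; $\chi: x^2\approx xy$; $\tau: x\approx y$; $\alpha: ad\preceq a+L(a,b,c,d)$; $\alpha_D: ad\preceq a+L(a,b,c,d)+D(t,u)$; $\varepsilon: ad\preceq a+b+c+L(a,b,c,d)$; $\kappa: ad\preceq a+b+L(a,b,c,d)$; $\iota_2: x_0x_5\preceq x_1+\sum_{j=0}^4x_jx_{j+1}$; $\iota_2^D: x_0x_5\preceq x_1+\sum_{j=0}^4x_jx_{j+1}+D(t,u)$. Each $f$ is read as $q_f\preceq v_f$: the square identities $\xi,s,\chi$ are read as $0\preceq v_f$ with $v_f=D(x,y),C(x,y),xy$, and $\tau$ as $y\preceq x$ (its query $y$ is a fresh linear variable). For $n\ge1$: $$\gamma_n:\ x_0y\preceq x_0+x_{2n}+\sum_{j=0}^{2n-1}x_jx_{j+1}+x_{2n}y,\qquad \gamma_n^D:\ x_0y\preceq x_0+x_{2n}+\sum_{j=0}^{2n-1}x_jx_{j+1}+x_{2n}y+D(t,u).$$ $\mathcal U(H,p,q)=\mathcal V[H,\ \gamma_i:1\le i\le p,\ \gamma_j^D:1\le j\le q]$ (threshold $0$ gives an empty family, $\infty$ the whole family). Closure. For a term $v$: $M(v)$ is the set of variables occurring as linear summands; $G(v)$ has as edges the square-free quadratic summands, and as vertices only the variables incident with an edge; $W(v)=M(v)\cap V(G(v))$ is the set of marked vertices. A term is basic-zero if it contains a square, a monomial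 of degree at least three, or if $G(v)$ has an odd cycle; otherwise $G(v)$ is bipartite. A component is a D-component if both of its bipartition classes contain marked vertices. Environment rule: a basic-zero term becomes $0$; otherwise add all edges between marked vertices in opposite classes of the same component. If $\tau\in H$, all terms have the same normal form. If $\tau\notin H$, $C_{H,p,q}(v)$ is the least extension of the environment normal form of $v$ closed under: (1) for each $f\in H$ and each map of the variables of $v_f$ into the variables of the term (identifications allowed), include the image of $q_f$ whenever all image summands of $v_f$ are present; a square query is interpreted as $0$ and sends the result to $0$; (2) with $k=p$ if the current term has no D-component and $k=q$ otherwise, for any two marked vertices $x,x'$ in the same component and class at distance at most $2k$, join $x$ to every neighbour of $x'$ (for $k=\infty$ only the same component and class are required); (3) the environment rule. The operator $\operatorname{Can}(H,p,q)=(H^*,p^*,q^* )$: if $\tau\in H$ the result is $(\mathcal F_{25},\infty,\infty)$. Otherwise $$H^*=\{f\in\mathcal F_{25}:C_{H,p,q}(v_f)=0\text{ or }q_f\in C_{H,p,q}(v_f)\},$$ and, with $I_0=\{\rho,\omega,\zeta,\delta,\nu,\alpha,\beta,s,\chi,\tau,\iota_2\}$, $I_D=I_0\cup\{\omega_D,\zeta_D,\nu_D,\alpha_D,\xi,\iota_2^D\}$, $a=\max\{p,\mathbf 1_{\mu\in H}\}$, $b=\max\{q,\mathbf 1_{H\cap\{\mu,\mu_D\}\ne\varnothing}\}$: $p^*=\infty$ if $H\cap I_0\ne\varnothing$ or ($\eta\in H$ and $a\ge1$), and $p^*=a$ otherwise; $q^*=\infty$ if $H\cap I_D\ne\varnothing$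 or ($H\cap\{\eta,\eta_D\}\ne\varnothing$ and $b\ge1$), and $q^*=b$ otherwise. A ''fixed node'' is a subvariety whose signature $(H,p,q)$ has $p,q\in\{0,\infty\}$; a one-parameter family has exactly one free positive integer threshold, the other being $0$ or $\infty$. *)

(* Defs.v *)
From HB Require Import structures.
From mathcomp Require Import all_boot.
From mathcomp Require Import all_classical.

Set Implicit Arguments.
Unset Strict Implicit.
Unset Printing Implicit Defensive.

Local Open Scope classical_set_scope.

Record algebra : Type := Algebra {
  carrier :> Type;
  aadd : carrier -> carrier -> carrier;
  amul : carrier -> carrier -> carrier;
  algebra_inhabited : inhabited carrier }.

Inductive term := Var of nat | Add of term & term | Mul of term & term.

Declare Scope term_scope.
Delimit Scope term_scope with term.
Bind Scope term_scope with term.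
Infix "+" := Add : term_scope.
Infix "*" := Mul : term_scope.

Fixpoint eval (A : algebra) (e : nat -> A) (t : term) : A :=
  match t with
  | Var n => e n
  | Add t1 t2 => aadd (eval e t1) (eval e t2)
  | Mul t1 t2 => amul (eval e t1) (eval e t2)
  end.

Definition identity := (term * term)%type.

Definition satisfies (A : algebra) (i : identity) : Prop :=
  forall e : nat -> A, eval e i.1 = eval e i.2.

Definition preceq (u v : term) : identity := (u + v, v)%term.

(* Closure under H, S and P; the product of the empty family is allowed, so
   varieties are nonempty classes. *)

Definition is_hom (A B : algebra) (f : A -> B) : Prop :=
  (forall x y, f (aadd x y) = aadd (f x) (f y)) /\
  (forall x y, f (amul x y) = amul (f x) (f y)).

Lemma prod_inhabited (I : Type) (A : I -> algebra) :
  inhabited (forall i, A i).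
Proof.
have h i : {x : A i | True}.
  by apply: cid; case: (algebra_inhabited (A i)) => x; exists x.
exact: (inhabits (fun i => sval (h i))).
Qed.

Definition prod_algebra (I : Type) (A : I -> algebra) : algebra :=
  @Algebra (forall i, A i) (fun f g i => aadd (f i) (g i))
    (fun f g i => amul (f i) (g i)) (prod_inhabited A).

Definition variety (K : set algebra) : Prop :=
  [/\ forall (A B : algebra) (f : A -> B),
        is_hom f -> (forall b, exists a, f a = b) -> K A -> K B,
      forall (A B : algebra) (f : B -> A),
        is_hom f -> injective f -> K A -> K B
    & forall (I : Type) (A : I -> algebra),
        (forall i, K (A i)) -> K (prod_algebra A)].

Definition generated_variety (A : algebra) : set algebra :=
  [set B | forall K, variety K -> K A -> K B].

Definition subvarieties (V : set algebra) : set (set algebra) :=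
  [set K | variety K /\ K `<=` V].

Definition adjoin (V : set algebra) (E : set identity) : set algebra :=
  [set A | V A /\ forall i, E i -> satisfies A i].

Inductive r12 := R0 | Rc | Rp | Rq | Ra | Rb.

Definition r12_add (x y : r12) : r12 :=
  match x, y with
  | R0, R0 => R0 | Rc, Rc => Rc | Rp, Rp => Rp
  | Rq, Rq => Rq | Ra, Ra => Ra | Rb, Rb => Rb
  | Ra, Rp | Rp, Ra => Rp
  | Rb, Rq | Rq, Rb => Rq
  | Rc, (Ra | Rb | Rq) | (Ra | Rb | Rq), Rc => Rc
  | Ra, (Rb | Rq) | (Rb | Rq), Ra => Rc
  | _, _ => R0
  end.

Definition r12_mul (x y : r12) : r12 :=
  match x, y with
  | Rp, Rb | Rb, Rp | Ra, Rb | Rb, Ra | Ra, Rq | Rq, Ra => Rc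
  | _, _ => R0
  end.

Definition R12 : algebra := @Algebra r12 r12_add r12_mul (inhabits R0).

Inductive r12_le : r12 -> r12 -> Prop :=
  | r12_le_refl x : r12_le x x
  | r12_le_trans x y z : r12_le x y -> r12_le y z -> r12_le x z
  | r12_le_ap : r12_le Ra Rp
  | r12_le_p0 : r12_le Rp R0
  | r12_le_bq : r12_le Rb Rq
  | r12_le_q0 : r12_le Rq R0
  | r12_le_c0 : r12_le Rc R0
  | r12_le_ac : r12_le Ra Rc
  | r12_le_qc : r12_le Rq Rc.

(* The table [r12_add] is the join of the partial order [r12_le]. *)
Lemma r12_leP (x y : r12) : r12_le x y <-> r12_add x y = y.
Proof.
split.
  elim=> {x y}; try by [].
  - by case.
  - by case; case; case.
have ap := r12_le_ap; have p0 := r12_le_p0; have bq := r12_le_bq.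
have q0 := r12_le_q0; have c0 := r12_le_c0; have ac := r12_le_ac.
have qc := r12_le_qc.
have a0 := r12_le_trans ap p0; have b0 := r12_le_trans bq q0.
have bc := r12_le_trans bq qc.
by case: x; case: y => //= _; exact: r12_le_refl.
Qed.

Lemma r12_add_join (x y z : r12) :
  r12_le (r12_add x y) z <-> r12_le x z /\ r12_le y z.
Proof. by rewrite !r12_leP; case: x; case: y; case: z; split=> //; case. Qed.

Definition V12 : set algebra := generated_variety R12.

Inductive f25 :=
  | rho | eta | omega | zeta | lambda | eta_D | omega_D | zeta_D
  | mu | nu | mu2 | mu_D | nu_D | delta | xi | beta | sq | chi | tau
  | alpha | alpha_D | epsilon | kappa | iota2 | iota2_D.

Definition f25_enum : seq f25 :=
  [:: rho; eta; omega; zeta; lambda; eta_D; omega_D; zeta_D;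
      mu; nu; mu2; mu_D; nu_D; delta; xi; beta; sq; chi; tau;
      alpha; alpha_D; epsilon; kappa; iota2; iota2_D].

Definition f25_code (f : f25) : 'I_25 :=
  match f with
  | rho => inord 0 | eta => inord 1 | omega => inord 2 | zeta => inord 3
  | lambda => inord 4 | eta_D => inord 5 | omega_D => inord 6
  | zeta_D => inord 7 | mu => inord 8 | nu => inord 9 | mu2 => inord 10
  | mu_D => inord 11 | nu_D => inord 12 | delta => inord 13 | xi => inord 14
  | beta => inord 15 | sq => inord 16 | chi => inord 17 | tau => inord 18
  | alpha => inord 19 | alpha_D => inord 20 | epsilon => inord 21
  | kappa => inord 22 | iota2 => inord 23 | iota2_D => inord 24
  end.

Lemma f25_codeK : cancel f25_code (fun i => nth rho f25_enum i).
Proof. by case; rewrite /= inordK. Qed.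

HB.instance Definition _ := Finite.copy f25 (can_type f25_codeK).

Definition Ct (t u : term) : term := (t + t * u)%term.
Definition Dt (t u : term) : term := (t + u + t * u)%term.
Definition Lt (a b c d : term) : term := (a * b + b * c + c * d)%term.

(* Var 0-8 are the letters x, y, z, t, u, a, b, c, d; Var (9 + j) is x_j. *)
Definition xs (j : nat) : term := Var (9 + j).

(* x_0 x_1 + ... + x_k x_(k+1) *)
Fixpoint xpath (k : nat) : term :=
  match k with
  | 0 => (xs 0 * xs 1)%term
  | k'.+1 => (xpath k' + xs k * xs k.+1)%term
  end.

Inductive law :=
  | Below of term & term   (* Below q v : q + v = v *)
  | SquareEq of term       (* SquareEq v : x^2 = v *)
  | Trivial.               (* x = y *)

Definition law_of (f : f25) : law :=
  let x := Var 0 in let y := Var 1 in let z := Var 2 in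
  let t := Var 3 in let u := Var 4 in
  let a := Var 5 in let b := Var 6 in let c := Var 7 in let d := Var 8 in
  let L := Lt a b c d in
  (match f with
  | rho     => Below x       (x * y)
  | eta     => Below z       (x + x * y + y * z)
  | omega   => Below y       (x + x * y)
  | zeta    => Below z       (Ct x y + z * t)
  | lambda  => Below z       (Dt x y + x * z)
  | eta_D   => Below z       (x + x * y + y * z + Dt t u)
  | omega_D => Below y       (Ct x y + Dt t u)
  | zeta_D  => Below z       (Dt x y + z * t)
  | mu      => Below (a * d) (b + L)
  | nu      => Below (a * d) (Ct t u + L)
  | mu2     => Below (a * d) (b + c + L)
  | mu_D    => Below (a * d) (b + L + Dt t u)
  | nu_D    => Below (a * d) (L + Dt t u)
  | delta   => Below (a * d) L
  | xi      => SquareEq (Dt x y)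
  | beta    => Below (x * z) (Ct x y + Ct t z)
  | sq      => SquareEq (Ct x y)
  | chi     => SquareEq (x * y)
  | tau     => Trivial
  | alpha   => Below (a * d) (a + L)
  | alpha_D => Below (a * d) (a + L + Dt t u)
  | epsilon => Below (a * d) (a + b + c + L)
  | kappa   => Below (a * d) (a + b + L)
  | iota2   => Below (xs 0 * xs 5) (xs 1 + xpath 4)
  | iota2_D => Below (xs 0 * xs 5) (xs 1 + xpath 4 + Dt t u)
  end)%term.

Definition identity_of (f : f25) : identity :=
  match law_of f with
  | Below q v => preceq q v
  | SquareEq v => (Var 0 * Var 0, v)%term
  | Trivial => (Var 0, Var 1)
  end.

(* The reading [query f] below [body f]; the query [None] stands for 0. *)
Definition query (f : f25) : option term :=
  match law_of f with
  | Below q _ => Some q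
  | SquareEq _ => None
  | Trivial => Some (Var 1)
  end.

Definition body (f : f25) : term :=
  match law_of f with
  | Below _ v => v
  | SquareEq v => v
  | Trivial => Var 0
  end.

Definition gamma_body (n : nat) : term :=
  (xs 0 + xs (2 * n) + xpath (2 * n).-1 + xs (2 * n) * Var 1)%term.

Definition gamma (n : nat) : identity :=
  preceq (xs 0 * Var 1)%term (gamma_body n).

Definition gamma_D (n : nat) : identity :=
  preceq (xs 0 * Var 1)%term (gamma_body n + Dt (Var 3) (Var 4))%term.

(* [None] is the infinite threshold. *)

Definition threshold := option nat.

Definition nat_le_thr (n : nat) (p : threshold) : bool :=
  if p is Some k then n <= k else true.

Definition thr_le (p q : threshold) : bool :=
  match p, q with
  | _, None => true
  | None, Some _ => false
  | Some m, Some n => m <= n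
  end.

Definition thr_max (p : threshold) (n : nat) : threshold := omap (maxn n) p.

Definition signature := ({set f25} * threshold * threshold)%type.

Definition U (s : signature) : set algebra :=
  let: (H, p, q) := s in
  adjoin V12
    [set i | [\/ exists2 f, f \in H & i = identity_of f,
                exists n, [/\ 1 <= n, nat_le_thr n p & i = gamma n]
              | exists n, [/\ 1 <= n, nat_le_thr n q & i = gamma_D n]]].

(* Terms as sets of commutative monomials; a monomial is the sorted list of
   its variables *)

Definition mono := seq nat.

Definition mk_mono (s : seq nat) : mono := sort leq s.

Fixpoint monos (t : term) : seq mono :=
  match t with
  | Var n => [:: [:: n]]
  | Add t1 t2 => monos t1 ++ monos t2
  | Mul t1 t2 => [seq mk_mono (m1 ++ m2) | m1 <- monos t1, m2 <- monos t2]
  end.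

Definition summands (t : term) : set mono := [set m | m \in monos t].

Section Graph.
Variable v : set mono.

Definition marks : set nat := [set x | v [:: x]].

Definition adj : rel nat := [rel x y | (x != y) && (mk_mono [:: x; y] \in v)].

Definition vertices : set nat := [set x | exists y, adj x y].

Definition marked : set nat := marks `&` vertices.

Definition odd_cycle : Prop :=
  exists c : seq nat, [/\ 2 < size c, odd (size c), uniq c & cycle adj c].

Definition basic_zero : Prop :=
  [\/ exists x, v [:: x; x], exists2 m, v m & 3 <= size m | odd_cycle].

Definition walk (n : nat) (x y : nat) : Prop :=
  exists s : seq nat, [/\ path adj x s, last x s = y & size s = n].

(* When G(v) is bipartite, two vertices lie in the same component and the same
   (resp. opposite) bipartition class iff an even (resp. odd) walk joins them. *)
Definition same_class (x y : nat) : Prop := exists2 n, ~~ odd n & walk n x y.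
Definition opposite_class (x y : nat) : Prop := exists2 n, odd n & walk n x y.

Definition has_D_component : Prop :=
  exists x y, [/\ marked x, marked y & opposite_class x y].

Definition within_dist (k : threshold) (x y : nat) : Prop :=
  same_class x y /\
  (if k is Some n then exists2 d, d <= 2 * n & walk d x y else True).

End Graph.

(* Normal forms: [None] is the term 0. *)
Definition nform := option (set mono).

Definition nform_le (a b : nform) : Prop :=
  match a, b with
  | _, None => True
  | None, Some _ => False
  | Some v, Some w => v `<=` w
  end.

Definition environment (v : set mono) : nform :=
  if `[< basic_zero v >] then None
  else Some (v `|` [set m | exists x y,
    [/\ marked v x, marked v y, opposite_class v x y
      & m = mk_mono [:: x; y]]]).

Definition map_mono (r : nat -> nat) (m : mono) : mono := mk_mono (map r m).

(* The query 0 lies in no nonzero term, and neither does an image of a query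
   that is a square, as [nf_closed] below excludes the basic-zero terms. *)
Definition query_in (r : nat -> nat) (f : f25) (v : set mono) : Prop :=
  if query f is Some t then forall m, m \in monos t -> v (map_mono r m) else False.

(* The maps r are unrestricted, since the images of all variables of [body f]
   are variables of v as soon as the images of its summands belong to v. *)
Definition rule1_closed (H : {set f25}) (v : set mono) : Prop :=
  forall (f : f25) (r : nat -> nat), f \in H ->
    (forall m, m \in monos (body f) -> v (map_mono r m)) -> query_in r f v.

Definition rule2_closed (p q : threshold) (v : set mono) : Prop :=
  let k := if `[< has_D_component v >] then q else p in
  forall x x' y, marked v x -> marked v x' -> within_dist v k x x' ->
    adj v x' y -> adj v x y.

Definition nf_closed (H : {set f25}) (p q : threshold) (a : nform) : Prop :=
  if a is Some v then
    [/\ environment v = Some v, rule1_closed H v & rule2_closed p q v]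
  else True.

(* For p <= q the closed extensions are stable under meets, so this meet is
   the least closed extension. *)
Definition Cl (H : {set f25}) (p q : threshold) (t : term) : nform :=
  let extensions : set (set mono) :=
    [set w | nform_le (environment (summands t)) (Some w)
             /\ nf_closed H p q (Some w)] in
  if tau \in H then None
  else if `[< extensions = set0 >] then None
  else Some (\bigcap_(w in extensions) w).

Definition derives (H : {set f25}) (p q : threshold) (f : f25) : Prop :=
  if Cl H p q (body f) is Some w then query_in id f w else True.

Definition I_0 : {set f25} :=
  [set f in [:: rho; omega; zeta; delta; nu; alpha; beta; sq; chi; tau; iota2]].

Definition I_D : {set f25} :=
  I_0 :|: [set f in [:: omega_D; zeta_D; nu_D; alpha_D; xi; iota2_D]].

Definition Can (s : signature) : signature :=
  let: (H, p, q) := s in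
  if tau \in H then ([set: f25]%SET, None, None) else
  let H' : {set f25} := [set f | `[< derives H p q f >]]%SET in
  let a := thr_max p (mu \in H) in
  let b := thr_max q ((mu \in H) || (mu_D \in H)) in
  let p' := if (H :&: I_0 != finset.set0)
               || (eta \in H) && nat_le_thr 1 a then None else a in
  let q' := if (H :&: I_D != finset.set0)
               || ((eta \in H) || (eta_D \in H)) && nat_le_thr 1 b
            then None else b in
  (H', p', q').

(* Can acts on the triples with p <= q. *)
Definition fixed_points : set signature :=
  [set s | thr_le s.1.2 s.2 /\ Can s = s].

Definition legal_sets (p q : threshold) : {set {set f25}} :=
  [set H : {set f25} | `[< fixed_points (H, p, q) >]]%SET.

(* The legal fixed sets do not vary over the region, and there are n of them. *)
Definition census (region : threshold -> threshold -> Prop) (n : nat) : Prop :=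
  exists S : {set {set f25}},
    #|S| = n /\ forall p q, region p q -> legal_sets p q = S.

Definition zero_or_infinite (p : threshold) : Prop :=
  p = Some 0 \/ p = None.

Definition fixed_nodes : set (set algebra) :=
  [set K | exists s : signature,
    [/\ fixed_points s, zero_or_infinite s.1.2, zero_or_infinite s.2
      & K = U s]].

Definition posint := {n : nat | 1 <= n}.

Definition one_parameter_families : set (posint -> set algebra) :=
  [set F | exists (H : {set f25}) (c : threshold), zero_or_infinite c /\
    ((forall n : posint, fixed_points (H, Some (val n), c)
                         /\ F n = U (H, Some (val n), c)) \/
     (forall n : posint, fixed_points (H, c, Some (val n))
                         /\ F n = U (H, c, Some (val n))))].

Definition pospair := {pq : nat * nat | 1 <= pq.1 <= pq.2}.

Definition two_parameter_families : set (pospair -> set algebra) :=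
  [set F | exists H : {set f25}, forall n : pospair,
    let: (p, q) := val n in
    fixed_points (H, Some p, Some q) /\ F n = U (H, Some p, Some q)].

(* Main.v *)
(* For a subvariety K of V and a term t, let Th K t be the set of monomials below t
   in all algebras of K. Unless t is zero in K this set is closed under the
   environment rule, because R12 satisfies the identities that close odd cycles
   and odd paths with marked ends. Conversely, a set w closed under this rule is
   separated from every monomial outside it by evaluations in R12, which come from
   two-colourings of its graph. So the syntactic algebra of w lies in V, and it
   satisfies those identities under which w is closed.

   Let H, p, q be the identities of F25 and the thresholds that hold in K. If a
   closed set for (H, p, q) contained v but missed a monomial of Th K v, it could
   be folded onto the body of an identity, or of the first gamma beyond the
   threshold, that fails in K although the folding makes it hold. Hence
   K = U(H, p, q), and (H, p, q) is a fixed point of Can. Conversely a fixed point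
   is recovered from U(H, p, q): syntactic algebras of closures refute the
   identities outside H, and those of explicit paths refute the gammas beyond the
   thresholds.

   The legal sets are enumerated by computation: a list of implications between
   the identities cuts out finitely many candidates, and for each of them the
   closures of the bodies show that no further identity is derivable. *)

Require Import Defs.
From HB Require Import structures.
From mathcomp Require Import all_boot.
From mathcomp Require Import all_classical.
From Stdlib Require List.
From mathcomp Require Import zify.
Set Implicit Arguments.
Unset Strict Implicit.
Unset Printing Implicit Defensive.
Local Open Scope classical_set_scope.
Local Open Scope card_scope.

(** The element c of [R12] acts as a threshold. With a, p on one side and b, q on the other, a
    product is below c exactly when its factors lie on opposite sides and are not the pair p, q; of
    these four elements only p is not below c. So p exposes a missing mark, and the pair p, q a
    missing edge.

    Folding rests on the stability of [Th] under substitution. A map that sends the edges and marks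
    of [G] into [Th K T] also sends the missing consequence there. If [T] is the body of an identity
    and the missing monomial lands on its query, the identity is a law of [K], and closure of [G]
    under it contradicts the choice of the monomial.

    A positive finite threshold is a parameter that no computation can run through, so it is bounded
    from both sides. Derivations use rule 2 only at distance 2, which every positive threshold
    allows; the refuting sets are closed under rule 2 at all distances, hence for every threshold.
    The two bounds give the same sets, which makes the legal sets constant on each region. *)

(** * Birkhoff's theorem *)

(* Birkhoff's theorem needs a variable for every element of the algebra, whereas
   the variables of [term] are numbers. *)
Inductive gterm (X : Type) :=
  GVar of X | GAdd of gterm X & gterm X | GMul of gterm X & gterm X.

Fixpoint geval (X : Type) (A : algebra) (e : X -> A) (t : gterm X) : A :=
  match t with
  | GVar x => e x
  | GAdd t1 t2 => aadd (geval e t1) (geval e t2)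
  | GMul t1 t2 => amul (geval e t1) (geval e t2)
  end.

Fixpoint gvars (X : Type) (t : gterm X) : seq X :=
  match t with
  | GVar x => [:: x]
  | GAdd t1 t2 | GMul t1 t2 => gvars t1 ++ gvars t2
  end.

Fixpoint number (X : Type) (r : X -> nat) (t : gterm X) : term :=
  match t with
  | GVar x => Var (r x)
  | GAdd t1 t2 => Add (number r t1) (number r t2)
  | GMul t1 t2 => Mul (number r t1) (number r t2)
  end.

Lemma eval_number (X : Type) (A : algebra) (r : X -> nat) (e : nat -> A) t :
  eval e (number r t) = geval (e \o r) t.
Proof. by elim: t => //= t1 -> t2 ->. Qed.

Lemma eval_hom (A B : algebra) (f : A -> B) (e : nat -> A) t :
  is_hom f -> f (eval e t) = eval (f \o e) t.
Proof. by case=> hD hM; elim: t => //= t1 <- t2 <-; rewrite ?hD ?hM. Qed.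

Lemma eval_prod (I : Type) (A : I -> algebra) (e : nat -> prod_algebra A) t i :
  eval e t i = eval (fun n => e n i) t.
Proof. by elim: t => //= t1 -> t2 ->. Qed.

Lemma geval_prod (X I : Type) (A : I -> algebra) (e : X -> prod_algebra A) t i :
  geval e t i = geval (fun n => e n i) t.
Proof. by elim: t => //= t1 -> t2 ->. Qed.

Lemma variety_models (E : set identity) :
  variety [set A | forall i, E i -> satisfies A i].
Proof.
split.
- move=> A B f fh fs hA i Ei e /=.
  have /choice[g gK] := fs.
  have -> : e = f \o (g \o e) by apply: funext => n /=; rewrite gK.
  by rewrite -!(eval_hom _ _ fh); congr (f _); exact: hA Ei _.
- move=> A B f fh fi hA i Ei e; apply: fi.
  by rewrite !(eval_hom _ _ fh); exact: hA Ei _.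
- move=> I A hA i Ei e; apply: functional_extensionality_dep => j.
  by rewrite !eval_prod; exact: hA Ei _.
Qed.

Lemma variety_adjoin (V : set algebra) (E : set identity) :
  variety V -> variety (adjoin V E).
Proof.
have [eH eS eP] := variety_models E; move=> [vH vS vP]; split.
- by move=> A B f fh fs [VA EA]; split; [exact: (vH _ _ _ fh fs VA)|exact: (eH _ _ _ fh fs EA)].
- by move=> A B f fh fi [VA EA]; split; [exact: (vS _ _ _ fh fi VA)|exact: (eS _ _ _ fh fi EA)].
- by move=> I A hA; split; [apply: vP|apply: eP] => i; case: (hA i).
Qed.

Section Birkhoff.
Variables (K : set algebra) (A : algebra).
Hypothesis Kvar : variety K.
Hypothesis AK : forall i, (forall B, K B -> satisfies B i) -> satisfies A i.

Let kernel (X : Type) (B : algebra) (e : X -> B) (s t : gterm X) : Prop :=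
  geval e s = geval e t.

(* Indexing the product by kernels, not by algebras, keeps it in the universe
   of carriers. *)
Let index := {th : gterm A -> gterm A -> Prop |
  exists (B : algebra) (e : A -> B), K B /\ th = kernel e}.

Let pick (th : index) : {Be : {B : algebra & A -> B} |
  K (projT1 Be) /\ sval th = kernel (projT2 Be)}.
Proof.
apply: cid; case: th => th /= [B [e [KB ->]]].
by exists (existT _ B e).
Qed.

Let P := prod_algebra (fun th : index => projT1 (sval (pick th))).
Let gen : A -> P := fun a th => projT2 (sval (pick th)) a.

Let sub := {x : P | exists t, x = geval gen t}.

Let subD (x y : sub) : exists t, aadd (sval x) (sval y) = geval gen t.
Proof. by have [t xt] := svalP x; have [u yu] := svalP y; exists (GAdd t u); rewrite xt yu. Qed.
Let subM (x y : sub) : exists t, amul (sval x) (sval y) = geval gen t.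
Proof. by have [t xt] := svalP x; have [u yu] := svalP y; exists (GMul t u); rewrite xt yu. Qed.

Let sub_inhabited : inhabited sub.
Proof.
case: (algebra_inhabited A) => a.
by apply: inhabits; exists (gen a); exists (GVar a).
Qed.

Let B := @Algebra sub (fun x y => exist _ _ (subD x y))
  (fun x y => exist _ _ (subM x y)) sub_inhabited.

Let KB : K B.
Proof.
have [_ KS KP] := Kvar.
apply: (KS P B (fun x => sval x)) => //.
- by move=> [x hx] [y hy] /= xy; subst y; rewrite (Prop_irrelevance hx hy).
- by apply: KP => th; case: (pick th) => Be [].
Qed.

(** Only finitely many elements of [A] occur in the two terms. Numbering them turns the pair into an
    ordinary identity, which holds throughout [K] because the coordinates of [P] run through all
    kernels, and hence holds in [A]. *)
Let gen_eq (s t : gterm A) : geval gen s = geval gen t ->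
  geval (@id A) s = geval (@id A) t.
Proof.
move=> st.
have Kst (Q : algebra) (e : A -> Q) : K Q -> geval e s = geval e t.
  move=> KQ.
  have hi : exists (B : algebra) (e' : A -> B), K B /\ kernel e = kernel e'
    by exists Q, e.
  (* The coordinate of the kernel of [e] may carry another algebra and another map, but one with
     this same kernel. *)
  have := congr1 (fun x : P => x (exist _ (kernel e) hi)) st.
  rewrite /= !geval_prod /gen.
  case: (pick _) => -[Q' e'] /= [KQ' eqk] h.
  by have : kernel e' s t by []; rewrite -eqk.
pose vs := gvars s ++ gvars t.
have [r [l lr]] : exists (r : A -> nat) (l : nat -> A),
    forall x, List.In x vs -> l (r x) = x.
  case: (algebra_inhabited A) => a0.
  elim: vs => [|x vs [r [l lr]]]; first by exists (fun=> 0), (fun=> a0).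
  exists (fun y => if `[< y = x >] then 0 else (r y).+1).
  exists (fun n => if n is n'.+1 then l n' else x) => y /=.
  by case: asboolP => [->//|yx] [/esym//|/lr].
have sat : satisfies A (number r s, number r t).
  by apply: AK => Q KQ e /=; rewrite !eval_number; apply: Kst.
have := sat l; rewrite /= !eval_number.
have gv u : (forall x, List.In x (gvars u) -> l (r x) = x) ->
    geval (l \o r) u = geval (@id A) u.
  elim: u => [x|u IHu v IHv|u IHu v IHv] /= h; first by apply: h; left.
  - by rewrite IHu ?IHv // => x xi; apply: h; apply: List.in_or_app; auto.
  - by rewrite IHu ?IHv // => x xi; apply: h; apply: List.in_or_app; auto.
by rewrite !gv // => x xi; apply: lr; apply: List.in_or_app; auto.
Qed.

(** [A] is the image of the subalgebra [B] of a product: send the value of a term at the generators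
    to its value in [A], which is well defined by [gen_eq]. *)
Theorem birkhoff : K A.
Proof.
have [KH _ _] := Kvar.
have [f fE] : exists f : B -> A,
    forall t h, f (exist _ (geval gen t) h) = geval (@id A) t.
  have /choice[f fE] (x : B) : exists a : A,
      forall t, sval x = geval gen t -> a = geval (@id A) t.
    have [t xt] := svalP x; exists (geval (@id A) t) => u xu.
    by apply: gen_eq; rewrite -xt.
  by exists f => t h; apply: fE.
apply: (KH B A f) => //.
- split=> -[x [t xt]] [y [u yu]]; subst x y.
  + by rewrite !fE; apply: (fE (GAdd t u)).
  + by rewrite !fE; apply: (fE (GMul t u)).
- move=> a; have h : exists t, gen a = geval gen t by exists (GVar a).
  by exists (exist _ (gen a) h); apply: (fE (GVar a)).
Qed.

End Birkhoff.

Lemma V12_variety : variety V12.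
Proof.
split.
- by move=> A B f fh fs VA K Kv KR; have [KH _ _] := Kv; exact: (KH _ _ _ fh fs (VA K Kv KR)).
- by move=> A B f fh fi VA K Kv KR; have [_ KS _] := Kv; exact: (KS _ _ _ fh fi (VA K Kv KR)).
- by move=> I A VA K Kv KR; have [_ _ KP] := Kv; apply: KP => i; exact: VA.
Qed.

Lemma V12P (A : algebra) :
  V12 A <-> forall i, satisfies R12 i -> satisfies A i.
Proof.
split=> [VA i Ri|h K Kv KR].
  have := VA _ (variety_models [set i]); apply => //=.
  by move=> j ->.
by apply: birkhoff => // i hi; apply: h; apply: hi.
Qed.

(** * Graphs of sets of monomials *)

Lemma mk_mono2 x y : mk_mono [:: x; y] = if x <= y then [:: x; y] else [:: y; x].
Proof. by rewrite /mk_mono /sort /=; case: leqP. Qed.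

Lemma mk_mono_perm s t : perm_eq s t -> mk_mono s = mk_mono t.
Proof. by move=> h; apply/(perm_sortP leq_total leq_trans anti_leq). Qed.

Lemma mk_mono_catC s t : mk_mono (s ++ t) = mk_mono (t ++ s).
Proof. by apply: mk_mono_perm; rewrite perm_catC. Qed.

Lemma mk_mono_cat s t : mk_mono (mk_mono s ++ t) = mk_mono (s ++ t).
Proof. by apply: mk_mono_perm; rewrite perm_cat2r perm_sort. Qed.

Lemma mk_monoC x y : mk_mono [:: x; y] = mk_mono [:: y; x].
Proof. exact: (mk_mono_catC [:: x] [:: y]). Qed.

Lemma mk_mono_sorted s : sorted leq (mk_mono s).
Proof. exact: (sort_sorted leq_total). Qed.

Lemma mk_mono_id s : sorted leq s -> mk_mono s = s.
Proof. exact: (sorted_sort leq_trans). Qed.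

Lemma size_mk_mono s : size (mk_mono s) = size s.
Proof. exact: size_sort. Qed.

Lemma map_mono1 r x : map_mono r [:: x] = [:: r x]. Proof. by []. Qed.

Lemma map_mono2 r x y : map_mono r (mk_mono [:: x; y]) = mk_mono [:: r x; r y].
Proof. by rewrite mk_mono2 /map_mono; case: ifP => // _; exact: mk_monoC. Qed.

Lemma cycle_cut (T : Type) (e : rel T) a u v :
  cycle e (a :: u ++ a :: v) -> cycle e (a :: u) /\ cycle e (a :: v).
Proof.
rewrite /= rcons_cat cat_path /= => /and3P[pu lu pv].
by rewrite [path e a (rcons u a)]rcons_path pu lu.
Qed.

Section GraphTheory.
Variable G : set mono.
Local Notation adj := (adj G).
Local Notation walk := (walk G).
Local Notation marked := (marked G).

Lemma adjE x y : adj x y = (x != y) && (mk_mono [:: x; y] \in G).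
Proof. by []. Qed.

Lemma adjP x y : reflect (x <> y /\ G (mk_mono [:: x; y])) (adj x y).
Proof.
apply: (iffP andP) => -[h1 h2]; split=> //.
- exact/eqP.
- by rewrite inE in h2.
- exact/eqP.
- by rewrite inE.
Qed.

Lemma adj_sym x y : adj x y = adj y x.
Proof. by rewrite !adjE eq_sym mk_monoC. Qed.

Lemma adj_mono x y : adj x y -> G (mk_mono [:: x; y]).
Proof. by case/adjP. Qed.

Lemma walk0 x y : walk 0 x y <-> x = y.
Proof.
split=> [[s [_ <- /eqP]]|->]; first by rewrite size_eq0 => /eqP->.
by exists [::].
Qed.

Lemma walkS n x y : walk n.+1 x y <-> exists2 z, adj x z & walk n z y.
Proof.
split=> [[[|z s] [//= /andP[xz ps] l [sn]]]|[z xz [s [ps l sn]]]].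
  by exists z => //; exists s.
by exists (z :: s) => /=; rewrite xz sn.
Qed.

Lemma walk1 x y : walk 1 x y <-> adj x y.
Proof.
split=> [/walkS[z xz /walk0<-//]|xy]; apply/walkS; exists y => //.
exact/walk0.
Qed.

Lemma walk_cat m n x y z : walk m x y -> walk n y z -> walk (m + n) x z.
Proof.
elim: m x => [|m IH] x; first by move/walk0->.
by move=> /walkS[t xt /IH h] /h tz; rewrite addSn; apply/walkS; exists t.
Qed.

Lemma walk_rcons n x y z : walk n x y -> adj y z -> walk n.+1 x z.
Proof. by move=> h /walk1 h'; rewrite -addn1; apply: walk_cat h h'. Qed.

Lemma walk_sym n x y : walk n x y -> walk n y x.
Proof.
elim: n x => [|n IH] x; first by move/walk0->; apply/walk0.
by move=> /walkS[t xt /IH h]; apply: walk_rcons h _; rewrite adj_sym.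
Qed.

Lemma walkSr n x y : walk n.+1 x y <-> exists2 z, walk n x z & adj z y.
Proof.
split=> [/walk_sym/walkS[z yz /walk_sym h]|[z h /(walk_rcons h)//]].
by exists z; rewrite // adj_sym.
Qed.

Definition conn x y := exists n, walk n x y.

Lemma conn_refl x : conn x x. Proof. by exists 0; apply/walk0. Qed.
Lemma conn_sym x y : conn x y -> conn y x.
Proof. by case=> n h; exists n; apply: walk_sym. Qed.
Lemma conn_trans x y z : conn x y -> conn y z -> conn x z.
Proof. by move=> [n h] [m k]; exists (n + m); apply: walk_cat h k. Qed.
Lemma adj_conn x y : adj x y -> conn x y.
Proof. by move/walk1=> h; exists 1. Qed.
Lemma conn_adj x y z : adj y z -> conn x y <-> conn x z.
Proof.
move=> yz; split=> h; apply: (conn_trans h); first exact: adj_conn.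
by apply/conn_sym/adj_conn.
Qed.
Lemma marked_mono x : marked x -> G [:: x]. Proof. by case. Qed.
Lemma marked_adj x y : G [:: x] -> adj x y -> marked x.
Proof. by move=> h xy; split=> //; exists y. Qed.

(* A shortest odd closed walk is a cycle: a repeated vertex would cut it into
   two shorter closed walks, one of which is odd. *)
Lemma odd_closed_walk x n : odd n -> walk n x x -> odd_cycle G.
Proof.
move=> on [s [ps ls sn]].
have: cycle adj s.
  case: s ps ls sn on => [|y s] //= /andP[xy ps] ls _ _.
  by rewrite rcons_path ps -ls /= in xy *; rewrite ls in xy *.
have: odd (size s) by rewrite sn.
move: {2}(size s) (leqnn (size s)) => k; clear.
elim: k s => [|k IH] s; first by rewrite leqn0 size_eq0 => /eqP->.
move=> sk os cs; case: (boolP (uniq s)) => us.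
  exists s; split=> //; case: s os cs {sk us} => [|a [|b [|c s]]] //= _.
  by rewrite andbT adjE eqxx.
case/(uniqPn 0): us => i [j [ij js nij]].
pose s' := rot i s.
have ck : cycle adj s' by rewrite rot_cycle.
have sz : size s' = size s by rewrite size_rot.
have sE : s' = drop i s ++ take i s by [].
have is_ : i < size s by apply: ltn_trans js.
have dE : drop i s = nth 0 s i :: drop i.+1 s by rewrite -drop_nth.
set a := nth 0 s i in dE nij.
have d2 : drop i.+1 s = take (j - i.+1) (drop i.+1 s) ++ a :: drop j.+1 s.
  rewrite -{1}[drop i.+1 s](cat_take_drop (j - i.+1)); congr (_ ++ _).
  by rewrite drop_drop subnK // (drop_nth 0) // nij.
set u := take _ _ in d2.
set v := drop j.+1 s ++ take i s.
have s'E : s' = a :: u ++ a :: v by rewrite sE dE d2 /v /= -catA.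
have c1 : cycle adj (a :: u) /\ cycle adj (a :: v).
  by rewrite s'E in ck; exact: cycle_cut ck.
have szE : size s = (size u).+1 + (size v).+1.
  by rewrite -sz s'E /= size_cat /= addSn.
case: c1 => cu cv.
case ou : (odd (size u).+1).
  apply: (IH (a :: u)) => //=; rewrite szE in sk.
  by lia.
apply: (IH (a :: v)) => //=; rewrite szE in sk os.
  by lia.
by move: os; rewrite oddD ou.
Qed.

Definition good := environment G = Some G.

Lemma goodP : good <-> ~ basic_zero G /\
  (forall x y, marked x -> marked y -> opposite_class G x y ->
     G (mk_mono [:: x; y])).
Proof.
rewrite /good /environment; case: asboolP => [bz|nbz]; first by split=> [|[]].
split=> [[GE]|[_ h]].
  split=> // x y mx my o; rewrite -GE; right.
  by exists x, y.
congr Some; apply/seteqP; split=> [m [//|[x [y [mx my o ->]]]]|m Gm].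
  exact: h.
by left.
Qed.

Hypothesis Ggood : good.

Lemma good_nsquare x : ~ G [:: x; x].
Proof. by case/goodP: Ggood => nz _ h; apply: nz; constructor 1; exists x. Qed.

Lemma good_size m : G m -> size m <= 2.
Proof.
case/goodP: Ggood => nz _ h; rewrite leqNgt; apply/negP => sm; apply: nz.
by constructor 2; exists m.
Qed.

Lemma good_odd n x : walk n x x -> ~~ odd n.
Proof.
move=> h; apply/negP => on; case/goodP: Ggood => nz _; apply: nz.
by constructor 3; apply: odd_closed_walk on h.
Qed.

Lemma good_edge x y : G (mk_mono [:: x; y]) -> adj x y.
Proof.
move=> h; apply/adjP; split=> // xy; rewrite xy mk_mono2 leqnn in h.
exact: good_nsquare h.
Qed.

Lemma good_env x y : marked x -> marked y -> opposite_class G x y -> adj x y.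
Proof.
by move=> mx my o; apply: good_edge; case/goodP: Ggood => _; apply.
Qed.

Definition coloring (s : nat -> bool) := forall x y, adj x y -> s y = ~~ s x.

Lemma coloring_walk s n x y : coloring s -> walk n x y -> s y = odd n (+) s x.
Proof.
move=> ps; elim: n x => [|n IH] x; first by move/walk0->.
by move=> /walkS[z /ps xz /IH ->]; rewrite xz /=; case: (odd n); case: (s x).
Qed.

Lemma cycle_walk c : cycle adj c -> walk (size c) (head 0 c) (head 0 c).
Proof.
case: c => [|x c] cc; first exact/walk0.
by exists (rcons c x); split; [exact: cc|exact: last_rcons|exact: size_rcons].
Qed.

Lemma coloring_no_odd s : coloring s -> ~ odd_cycle G.
Proof.
move=> ps [c [_ oc _ /cycle_walk]].
by move/(coloring_walk ps); rewrite oc; case: (s _).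
Qed.

Lemma coloring_opp s x y : coloring s -> conn x y ->
  opposite_class G x y <-> s x <> s y.
Proof.
move=> ps [n h]; split=> [[m om /(coloring_walk ps)->]|].
  by rewrite om; case: (s x).
rewrite (coloring_walk ps h) => nxy; exists n => //.
by move: nxy; case: odd => //; case: (s x).
Qed.

Lemma good_env_coloring s x y : coloring s -> conn x y -> marked x -> marked y ->
  s x <> s y -> adj x y.
Proof. by move=> ps xy mx my h; apply: good_env => //; apply/(coloring_opp ps xy). Qed.

Lemma coloring_same s x y : coloring s -> conn x y ->
  same_class G x y <-> s x = s y.
Proof.
move=> ps [n h]; split=> [[m om /(coloring_walk ps)->]|].
  by rewrite (negPf om).
rewrite (coloring_walk ps h) => nxy; exists n => //.
by move: nxy; case: odd => //; case: (s x).
Qed.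

Lemma asbool_conn x a b : adj a b -> `[< conn x b >] = `[< conn x a >].
Proof. by move=> ab; apply/asbool_equiv_eq; split=> /(conn_adj x ab). Qed.

Lemma coloring_flip s x : coloring s ->
  coloring (fun y => if `[< conn x y >] then ~~ s y else s y).
Proof.
by move=> ps a b ab; rewrite (ps _ _ ab) (asbool_conn x ab); case: ifP.
Qed.

Lemma distance_to (S : nat -> Prop) : exists d : nat -> nat, forall x,
  (exists2 a, S a & conn a x) ->
  (exists2 a, S a & walk (d x) a x) /\ forall n a, S a -> walk n a x -> d x <= n.
Proof.
suff /choice[d hd] : forall x, exists d, (exists2 a, S a & conn a x) ->
    (exists2 a, S a & walk d a x) /\ forall n a, S a -> walk n a x -> d <= n.
  by exists d.
move=> x; have [h|h] := pselect (exists2 a, S a & conn a x); last by exists 0.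
have hn : exists n, `[< exists2 a, S a & walk n a x >].
  by case: h => a Sa [n hn]; exists n; apply/asboolP; exists a.
exists (ex_minn hn) => _; case: ex_minnP => d /asboolP hd dmin.
by split=> // n a Sa w; apply: dmin; apply/asboolP; exists a.
Qed.

Definition Dcomp x := exists a b,
  [/\ conn x a, marked a, marked b & opposite_class G a b].

Definition hasD := has_D_component G.

Lemma Dcomp_hasD x : Dcomp x -> hasD.
Proof. by move=> [a [b [_ ma mb o]]]; exists a, b. Qed.

Lemma Dcomp_conn x y : conn x y -> Dcomp x -> Dcomp y.
Proof.
move=> xy [a [b [xa ma mb o]]]; exists a, b; split=> //.
exact: conn_trans (conn_sym xy) xa.
Qed.

Lemma hasD_adj : hasD -> exists a b, [/\ marked a, marked b & adj a b].
Proof. by case=> a [b [ma mb o]]; exists a, b; split=> //; apply: good_env. Qed.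

(** With [dd] false the two vertices are dummies, so that one proof can name them in both cases. *)
Lemma hasD_pair (dd : bool) : (dd -> hasD) ->
  exists a b, dd -> [/\ marked a, marked b & adj a b].
Proof.
case: dd => [/(_ isT)/hasD_adj[a [b ab]]|_]; first by exists a, b.
by exists 0, 0.
Qed.

Lemma Dcomp_adj s x : coloring s -> Dcomp x ->
  exists a b, [/\ conn x a, marked a, marked b, adj a b & s a /\ ~~ s b].
Proof.
move=> ps [a [b [xa ma mb o]]]; have ab := good_env ma mb o.
have [sa|sa] := boolP (s a); first by exists a, b; rewrite (ps _ _ ab) sa.
exists b, a; rewrite (ps _ _ ab) sa adj_sym; split=> //.
exact: conn_trans (adj_conn ab).
Qed.

(* In a component that is not a D-component all marks lie in one class, which
   is coloured [true]. *)
Lemma good_coloring : exists s, coloring s /\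
  forall x, marked x -> ~ Dcomp x -> s x.
Proof.
(* Connected vertices have the same set [Q], so [xget] yields one representative per component, a
   marked one whenever the component has a mark. The colour records whether a vertex is in the class
   of its representative. *)
pose Q x := [set y | conn x y /\ (marked y \/ forall z, conn x z -> ~ marked z)].
pose rep x := xget 0 (Q x).
have repQ x : Q x (rep x).
  rewrite /rep; apply: (@xgetPex _ 0 (Q x)).
  have [[z [xz mz]]|h] := pselect (exists z, conn x z /\ marked z).
    by exists z; split=> //; left.
  exists x; split; first exact: conn_refl.
  by right=> z xz mz; apply: h; exists z.
have repE x y : conn x y -> rep x = rep y.
  move=> xy; rewrite /rep; congr xget; apply/seteqP.
  have h x' y' : conn x' y' -> Q x' `<=` Q y'.
    move=> c z [cz hz]; split; first exact: conn_trans (conn_sym c) cz.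
    case: hz => [|hz]; first by left.
    by right=> t ct; apply: hz; apply: conn_trans c ct.
  by split; apply: h => //; apply: conn_sym.
pose s x := `[< same_class G (rep x) x >].
exists s; split=> [x y xy|x mx nD].
  have c := adj_conn xy; rewrite /s -(repE _ _ c).
  have [m hm] : conn (rep x) x by apply: conn_sym; case: (repQ x).
  have E z k : walk k (rep x) z -> `[< same_class G (rep x) z >] = ~~ odd k.
    move=> hk; apply/asboolP/idP => [[l ol hl]|ok]; last by exists k.
    have := good_odd (walk_cat hk (walk_sym hl)).
    by rewrite oddD (negPf ol) addbF.
  by rewrite (E _ _ (walk_rcons hm xy)) (E _ _ hm).
apply/asboolP; have [cx [mr|h]] := repQ x; last by case: (h x); [exact: conn_refl|].
have [n hn] := conn_sym cx.
have [on|on] := boolP (odd n); last by exists n.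
by case: nD; exists (rep x), x; split=> //; exists n.
Qed.

End GraphTheory.

(** * Monomials below a term *)

Definition le (A : algebra) (x y : A) : Prop := aadd x y = y.

Section Laws.
Variable A : algebra.
Hypothesis VA : V12 A.

Let e3 (x y z : A) (n : nat) : A :=
  match n with 0 => x | 1 => y | _ => z end.

(** The laws below need at most three variables, so each is checked in [R12] by running through all
    values. *)
Let r12_law (i : identity) (x y z : A) : satisfies R12 i ->
  eval (e3 x y z) i.1 = eval (e3 x y z) i.2.
Proof. by move=> /(proj1 (V12P A) VA i); apply. Qed.

Ltac r12_check :=
  let e := fresh in intro e; simpl; destruct (e 0), (e 1), (e 2); reflexivity.

Lemma aaddA (x y z : A) : aadd x (aadd y z) = aadd (aadd x y) z.
Proof.
apply: (@r12_law (Var 0 + (Var 1 + Var 2), Var 0 + Var 1 + Var 2)%term x y z); r12_check.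
Qed.

Lemma aaddC (x y : A) : aadd x y = aadd y x.
Proof. apply: (@r12_law (Var 0 + Var 1, Var 1 + Var 0)%term x y y); r12_check. Qed.

Lemma aaddxx (x : A) : aadd x x = x.
Proof. apply: (@r12_law (Var 0 + Var 0, Var 0)%term x x x); r12_check. Qed.

Lemma amulA : associative (@amul A).
Proof.
move=> x y z; apply: (@r12_law (Var 0 * (Var 1 * Var 2), Var 0 * Var 1 * Var 2)%term x y z); r12_check.
Qed.

Lemma amulC : commutative (@amul A).
Proof. move=> x y; apply: (@r12_law (Var 0 * Var 1, Var 1 * Var 0)%term x y y); r12_check. Qed.

Lemma amulDl (x y z : A) : amul (aadd x y) z = aadd (amul x z) (amul y z).
Proof.
apply: (@r12_law ((Var 0 + Var 1) * Var 2, Var 0 * Var 2 + Var 1 * Var 2)%term x y z); r12_check.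
Qed.

Lemma asquare (x y : A) : amul x x = amul y y.
Proof. apply: (@r12_law (Var 0 * Var 0, Var 1 * Var 1)%term x y y); r12_check. Qed.

Lemma amul3 (x y z t : A) : amul x (amul y z) = amul t t.
Proof.
rewrite -(asquare x t); apply: (@r12_law (Var 0 * (Var 1 * Var 2), Var 0 * Var 0)%term x y z); r12_check.
Qed.

Lemma asquare_max (x y : A) : le x (amul y y).
Proof. apply: (@r12_law (Var 0 + Var 1 * Var 1, Var 1 * Var 1)%term x y y); r12_check. Qed.

Lemma le_refl (x : A) : le x x. Proof. exact: aaddxx. Qed.

Lemma le_trans (x y z : A) : le x y -> le y z -> le x z.
Proof. by rewrite /le => xy <-; rewrite aaddA xy. Qed.

Lemma le_anti (x y : A) : le x y -> le y x -> x = y.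
Proof. by rewrite /le => xy yx; rewrite -[LHS]yx aaddC. Qed.

Lemma le_add (x y z : A) : le (aadd x y) z <-> le x z /\ le y z.
Proof.
rewrite /le; split=> [h|[h1 h2]]; last by rewrite -aaddA h2.
by split; rewrite -h !aaddA ?aaddxx // (aaddC y) -!aaddA (aaddA y) aaddxx.
Qed.

(** No term has the empty list among its monomials; its image is a dummy. *)
Fixpoint mterm (m : mono) : term :=
  match m with
  | [::] => Var 0
  | [:: x] => Var x
  | x :: m' => Mul (Var x) (mterm m')
  end.

Definition value (e : nat -> A) (m : mono) : A := eval e (mterm m).

Lemma value_cons e x m : m <> [::] -> value e (x :: m) = amul (e x) (value e m).
Proof. by case: m. Qed.

(** Multiplication has no unit, so the product is taken over options, with [None] as the unit.
    Invariance under permutation follows from [perm_big]. *)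
Lemma value_big e x m :
  Some (value e (x :: m)) =
  \big[oAC amulA amulC/None]_(y <- x :: m) Some (e y).
Proof.
elim: m x => [|y m IH] x; first by rewrite big_cons big_nil.
by rewrite big_cons -IH value_cons.
Qed.

Lemma value_perm e m n : perm_eq m n -> value e m = value e n.
Proof.
case: m => [|x m]; case: n => [|y n] // h; try by have := perm_size h.
have : Some (value e (x :: m)) = Some (value e (y :: n)) by
  rewrite !value_big; apply: perm_big.
by case.
Qed.

Lemma value_mk e m : value e (mk_mono m) = value e m.
Proof. by apply: value_perm; rewrite perm_sort. Qed.

Lemma value_cat e m n : m <> [::] -> n <> [::] ->
  value e (m ++ n) = amul (value e m) (value e n).
Proof.
elim: m => [//|x m IH] _ n0; case: m IH => [|y m] IH; first exact: value_cons.
rewrite cat_cons (@value_cons e x (y :: m)) // (@value_cons e x (_ ++ n)) //.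
by rewrite IH // amulA.
Qed.

Lemma value_big3 e m x : 2 < size m -> value e m = amul x x.
Proof.
case: m => [|a [|b [|c m]]] // _.
by rewrite value_cons // value_cons // (amul3 _ _ _ x).
Qed.

End Laws.

Lemma mono_neq0 t m : m \in monos t -> m <> [::].
Proof.
elim: t m => [n|t1 IH1 t2 IH2|t1 IH1 t2 IH2] m /=.
- by rewrite inE => /eqP->.
- by rewrite mem_cat => /orP[/IH1|/IH2].
- move=> /allpairsP[[m1 m2] /= [/IH1 h1 _ ->]] /(congr1 size).
  by rewrite size_mk_mono size_cat; case: m1 h1.
Qed.

Lemma monos_sorted t m : m \in monos t -> sorted leq m.
Proof.
elim: t m => [n|t1 IH1 t2 IH2|t1 IH1 t2 IH2] m /=.
- by rewrite inE => /eqP->.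
- by rewrite mem_cat => /orP[/IH1|/IH2].
- by move=> /allpairsP[[m1 m2] /= [_ _ ->]]; exact: mk_mono_sorted.
Qed.

Lemma map_mono_id t m : m \in monos t -> map_mono id m = m.
Proof. by move=> mi; rewrite /map_mono map_id mk_mono_id // (monos_sorted mi). Qed.

Lemma le_monos (A : algebra) (VA : V12 A) (e : nat -> A) t z :
  le (eval e t) z <-> forall m, m \in monos t -> le (value e m) z.
Proof.
(* The induction runs inside an optional factor [k]: in a product, one factor is moved into the
   context of the other. *)
pose act (x : A) (k : option A) := if k is Some y then amul x y else x.
have actD x y k : act (aadd x y) k = aadd (act x k) (act y k).
  by case: k => //= k; rewrite amulDl.
suff h k : le (act (eval e t) k) z <->
    forall m, m \in monos t -> le (act (value e m) k) z by have := h None.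
elim: t k => [n|t1 IH1 t2 IH2|t1 IH1 t2 IH2] k /=.
- split=> [h m|h]; first by rewrite inE => /eqP->.
  by apply: (h [:: n]); rewrite inE.
- rewrite actD le_add // IH1 IH2; split=> [[h1 h2] m|h].
    by rewrite mem_cat => /orP[/h1|/h2].
  by split=> m mi; apply: h; rewrite mem_cat mi ?orbT.
- pose k1 x := Some (act x k).
  have E x y : act (amul x y) k = act x (k1 y).
    by rewrite /k1; case: (k) => //= u; rewrite -amulA.
  have E' x y : act x (k1 y) = act y (k1 x).
    by rewrite -E amulC // E.
  rewrite E IH1; split=> [h m /allpairsP[[m1 m2] /= [i1 i2 ->]]|h m1 i1].
    rewrite value_mk // value_cat //; try exact: mono_neq0 i1;
      try exact: mono_neq0 i2.
    have := h _ i1; rewrite E' => /IH2/(_ _ i2).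
    by rewrite E'; rewrite E.
  rewrite E'; apply/IH2 => m2 i2; rewrite E' -E.
  have := h (mk_mono (m1 ++ m2)); rewrite value_mk // value_cat //; try exact: mono_neq0 i1;
      try exact: mono_neq0 i2.
  by apply; apply/allpairsP; exists (m1, m2).
Qed.

Definition bsub (f : nat -> mono) (m : mono) : mono :=
  mk_mono (flatten (map f m)).

Lemma map_monoE r m : map_mono r m = bsub (fun x => [:: r x]) m.
Proof. by rewrite /map_mono /bsub flatten_map1. Qed.

Lemma flatten_neq0 f (m : mono) : (forall x, f x <> [::]) -> m <> [::] ->
  flatten (map f m) <> [::] :> mono.
Proof. by case: m => [//|x m] h _ /=; case: (f x) (h x). Qed.

Lemma bsub_neq0 f m : (forall x, f x <> [::]) -> m <> [::] -> bsub f m <> [::].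
Proof.
move=> h /(flatten_neq0 h) h' /(congr1 size); rewrite size_mk_mono.
by case: flatten h'.
Qed.

Lemma value_bsub (A : algebra) (VA : V12 A) (e : nat -> A) f m :
  (forall x, f x <> [::]) -> m <> [::] ->
  value e (bsub f m) = value (fun x => value e (f x)) m.
Proof.
move=> f0 m0; rewrite /bsub value_mk //.
elim: m m0 => [//|x m IH] _; case: m IH => [|y m] IH.
  by rewrite /= cats0.
rewrite value_cons // -IH // -value_cat //.
exact: flatten_neq0.
Qed.

(** * Consequences of a term in a class of algebras *)

Section Theory.
Variable K : set algebra.
Hypothesis KV : K `<=` V12.

(** Nonempty sorted lists represent each commutative monomial exactly once. *)
Definition Th (t : term) : set mono := [set m | [/\ m <> [::], sorted leq m &
  forall A : algebra, K A -> forall e : nat -> A, le (value e m) (eval e t)]].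

Definition zer (t : term) : Prop := forall A : algebra, K A ->
  forall (e : nat -> A) x, eval e t = amul x x.

Lemma Th_monos t m : m \in monos t -> Th t m.
Proof.
move=> mi; split; [exact: mono_neq0 mi|exact: monos_sorted mi|].
move=> A KA e; move: m mi; apply/le_monos; first exact: KV.
exact: (le_refl (KV KA)).
Qed.

Lemma Th_preceq q t : (forall A, K A -> satisfies A (preceq q t)) <->
  forall m, m \in monos q -> Th t m.
Proof.
split=> [h m mi|h A KA e].
  split; [exact: mono_neq0 mi|exact: monos_sorted mi|] => A KA e.
  by move: m mi; apply/le_monos; [exact: KV|exact: h KA e].
by apply/(le_monos (KV KA)) => m /h[_ _]; apply.
Qed.

Lemma zer_Th t m : zer t -> m <> [::] -> sorted leq m -> Th t m.
Proof.
move=> z m0 sm; split=> // A KA e; rewrite (z A KA e (value e m)).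
exact: (asquare_max (KV KA)).
Qed.

Lemma zerP t : (forall A : algebra, K A -> forall e : nat -> A,
   exists x : A, le (amul x x) (eval e t)) -> zer t.
Proof.
move=> h A KA e x; have [y hy] := h A KA e; rewrite (asquare (KV KA) x y).
by apply: le_anti hy; [exact: KV|exact: (asquare_max (KV KA))].
Qed.

Lemma zer_square t : zer t <-> forall A, K A -> satisfies A (Var 0 * Var 0, t)%term.
Proof.
split=> [z A KA e|h A KA e x]; first by rewrite /= (z A KA e (e 0)).
by rewrite -(h A KA e) /=; exact: (asquare (KV KA)).
Qed.

Lemma Th_square t x : Th t [:: x; x] -> zer t.
Proof. by case=> _ _ h; apply: zerP => A KA e; exists (e x); exact: h KA e. Qed.

Lemma Th_size t m : Th t m -> 2 < size m -> zer t.
Proof.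
case=> _ _ h sm; apply: zerP => A KA e; exists (e 0).
by rewrite -(value_big3 (KV KA) e (e 0) sm); exact: h.
Qed.

(** Stability under substitution of monomials, and not only of variables: the foldings below send
    isolated vertices to monomials of degree two. *)
Lemma Th_bsub v t f m : (forall x, f x <> [::]) ->
  (forall n, n \in monos v -> Th t (bsub f n)) -> Th v m -> Th t (bsub f m).
Proof.
move=> f0 h [m0 sm hm]; split; [exact: bsub_neq0|exact: mk_mono_sorted|].
move=> A KA e; have VA := KV KA; rewrite value_bsub //.
apply: le_trans (hm A KA _) _ => //; apply/le_monos => // n ni.
rewrite -value_bsub //; last exact: mono_neq0 ni.
by case: (h n ni) => _ _; apply.
Qed.

Lemma zer_bsub v t f : (forall x, f x <> [::]) ->
  (forall n, n \in monos v -> Th t (bsub f n)) -> zer v -> zer t.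
Proof.
move=> f0 h z; apply: zerP => A KA e; exists (e 0); have VA := KV KA.
rewrite -(z A KA (fun x => value e (f x)) (e 0)).
apply/le_monos => // n ni; rewrite -value_bsub //; last exact: mono_neq0 ni.
by case: (h n ni) => _ _; apply.
Qed.

Lemma Th_map v t r m : (forall n, n \in monos v -> Th t (map_mono r n)) ->
  Th v m -> Th t (map_mono r m).
Proof.
by move=> h hm; rewrite map_monoE; apply: (Th_bsub (v := v)) => // n ni; rewrite -map_monoE; exact: h.
Qed.

Lemma zer_map v t r : (forall n, n \in monos v -> Th t (map_mono r n)) ->
  zer v -> zer t.
Proof.
by move=> h; apply: (@zer_bsub _ _ (fun x => [:: r x])) => // n ni; rewrite -map_monoE; exact: h.
Qed.

End Theory.

(** * Evaluations in [R12] below the element c *)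

Lemma V12_R12 : V12 R12. Proof. by move=> K. Qed.

(** The colour of a factor of a product below c. The value at 0 and c is arbitrary, since they have
    no such product. *)
Definition sideA (x : r12) : bool := match x with Ra | Rp => true | _ => false end.

Lemma r12_edge (x y : R12) : le (amul x y) (Rc : R12) -> sideA y = ~~ sideA x.
Proof. by case: x; case: y. Qed.

Lemma r12_mark (x y : R12) : le (amul x y) (Rc : R12) -> le x (Rc : R12) ->
  x <> Rp /\ x <> Rc /\ x <> R0.
Proof. by case: x; case: y. Qed.

(** Among elements of opposite sides only p and q have product 0, and here p is excluded. *)
Lemma r12_mark_edge (x y : R12) : x <> Rp /\ x <> Rc /\ x <> R0 ->
  y <> Rp /\ y <> Rc /\ y <> R0 -> sideA y = ~~ sideA x ->
  le (amul x y) (Rc : R12).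
Proof. by move=> [p1 [p2 p3]] [q1 [q2 q3]]; case: x p1 p2 p3; case: y q1 q2 q3. Qed.

Lemma r12_top (x : R12) : le x (R0 : R12). Proof. by case: x. Qed.

(** A monomial of degree at least two takes only the values c and 0 in [R12], so the value of [v] is
    c or 0. Since 0 is the greatest element, only the value c needs testing. *)
Lemma R12_below q v : (exists2 m, m \in monos v & 1 < size m) ->
  (forall e : nat -> R12,
     (forall m, m \in monos v -> le (value e m) (Rc : R12)) ->
     forall n, n \in monos q -> le (value e n) (Rc : R12)) ->
  satisfies R12 (preceq q v).
Proof.
move=> [m mi sm] h e; rewrite -/(le (eval e q) (eval e v)).
have : le (value e m) (eval e v).
  by move: mi; apply: (proj1 (le_monos V12_R12 _ _ _)); exact: le_refl V12_R12 _.
have : value e m = Rc \/ value e m = R0.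
  case: m mi sm => [|x [|y m]] //= _ _; rewrite value_cons //=.
  by case: (e x); case: (value e (y :: m)); auto.
case E : (eval e v) => -[] -> // _; try exact: r12_top.
apply/(le_monos V12_R12) => n ni; apply: h ni.
by apply/(le_monos V12_R12); rewrite E; exact: le_refl V12_R12 _.
Qed.

Lemma xpath_monos k m :
  (m \in monos (xpath k)) <-> exists2 j, j <= k & m = mk_mono [:: 9 + j; 9 + j.+1].
Proof.
elim: k m => [|k IH] m /=.
  rewrite inE; split=> [/eqP->|[j]]; first by exists 0.
  by rewrite leqn0 => /eqP-> ->.
rewrite mem_cat inE; split=> [/orP[/IH[j jk ->]|/eqP->]|[j]].
- by exists j => //; exact: leqW.
- by exists k.+1.
- rewrite leq_eqVlt => /orP[/eqP->->|jk ->]; first by rewrite eqxx orbT.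
  by apply/orP; left; apply/IH; exists j.
Qed.

Lemma xpath_side (e : nat -> R12) k :
  (forall m, m \in monos (xpath k) -> le (value e m) (Rc : R12)) ->
  forall j, j <= k.+1 -> sideA (e (9 + j)) = odd j (+) sideA (e 9).
Proof.
move=> h; elim=> [|j IH] jk; first by rewrite addn0.
have hj : le (amul (e (9 + j)) (e (9 + j.+1))) (Rc : R12).
  rewrite -[amul _ _]/(value e [:: 9 + j; 9 + j.+1]) -(value_mk V12_R12).
  by apply: h; apply/xpath_monos; exists j.
by rewrite (r12_edge hj) (IH (ltnW jk)) /=; case: (odd j); case: (sideA _).
Qed.

Lemma walk_fun G n x y : walk G n x y -> exists f : nat -> nat,
  [/\ f 0 = x, f n = y & forall i, i < n -> adj G (f i) (f i.+1)].
Proof.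
elim: n x => [|n IH] x; first by move/walk0->; exists (fun=> y).
move=> /walkS[z xz /IH[f [f0 fn fa]]].
exists (fun i => if i is j.+1 then f j else x); split=> // -[_|i]; first by rewrite f0.
by rewrite ltnS; apply: fa.
Qed.

Lemma gamma_monos n m : 0 < n -> (m \in monos (gamma_body n)) <->
  [\/ m = [:: 9], m = [:: 9 + 2 * n],
      exists2 j, j < 2 * n & m = mk_mono [:: 9 + j; 9 + j.+1]
    | m = mk_mono [:: 9 + 2 * n; 1]].
Proof.
move=> n0.
rewrite -[monos _]/((([:: [:: 9]] ++ [:: [:: 9 + 2 * n]]) ++
  monos (xpath (2 * n).-1)) ++ [:: mk_mono [:: 9 + 2 * n; 1]]).
rewrite !(mem_cat, mem_seq1) -!orbA.
have E : (m \in monos (xpath (2 * n).-1)) <->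
    exists2 j, j < 2 * n & m = mk_mono [:: 9 + j; 9 + j.+1].
  rewrite xpath_monos; split=> -[j h ->]; exists j => //; lia.
split=> [/or4P[/eqP->|/eqP->|/E|/eqP->]|]; try by [constructor 1|constructor 2|constructor 4|constructor 3].
by case=> [->|->|/E->|->]; rewrite ?eqxx ?orbT.
Qed.

Definition gamma_dd (dd : bool) (n : nat) : identity :=
  if dd then gamma_D n else gamma n.

Definition gamma_dbody (dd : bool) n : term :=
  if dd then (gamma_body n + Dt (Var 3) (Var 4))%term else gamma_body n.

Lemma gamma_ddE dd n : gamma_dd dd n = preceq (xs 0 * Var 1)%term (gamma_dbody dd n).
Proof. by case: dd. Qed.

Lemma gamma_dbody_monos dd n m : (m \in monos (gamma_dbody dd n)) <->
  m \in monos (gamma_body n) \/ dd /\ m \in [:: [:: 3]; [:: 4]; [:: 3; 4]].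
Proof.
rewrite /gamma_dbody; case: dd; last by split=> [|[//|[]//]]; left.
rewrite mem_cat; split=> [/orP[]|[|[_]] ->]; rewrite ?orbT; auto.
Qed.

Lemma map_gamma_path G dd r n : good G -> 0 < n ->
  (forall m, m \in monos (gamma_dbody dd n) -> G (map_mono r m)) ->
  [/\ marked G (r 9), marked G (r (9 + 2 * n)),
      forall j, j <= 2 * n -> walk G j (r 9) (r (9 + j))
    & adj G (r (9 + 2 * n)) (r 1)] /\
  (dd -> [/\ marked G (r 3), marked G (r 4) & adj G (r 3) (r 4)]).
Proof.
move=> Gg n0 h; have hg m : m \in monos (gamma_body n) -> G (map_mono r m).
  by move=> mi; apply: h; apply/gamma_dbody_monos; left.
have e j : j < 2 * n -> adj G (r (9 + j)) (r (9 + j.+1)).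
  move=> jn; apply: good_edge => //; rewrite -map_mono2; apply: hg.
  by apply/gamma_monos => //; constructor 3; exists j.
have y : adj G (r (9 + 2 * n)) (r 1).
  apply: good_edge => //; rewrite -map_mono2; apply: hg.
  by apply/gamma_monos => //; constructor 4.
split; first split=> //.
- apply: (@marked_adj _ _ (r (9 + 1))); last by apply: (e 0); lia.
  by rewrite -map_mono1; apply: hg; apply/gamma_monos => //; constructor 1.
- apply: marked_adj y; rewrite -map_mono1; apply: hg.
  by apply/gamma_monos => //; constructor 2.
- elim=> [|k IH] kn; first by apply/walk0; rewrite addn0.
  by apply: walk_rcons (IH (ltnW kn)) _; apply: e.
- move=> d; have D m : m \in [:: [:: 3]; [:: 4]; [:: 3; 4]] -> G (map_mono r m).
    by move=> mi; apply: h; apply/gamma_dbody_monos; right.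
  have a : adj G (r 3) (r 4) by apply: good_edge => //; exact: (D [:: 3; 4]).
  split=> //; first by apply: marked_adj a; exact: (D [:: 3]).
  by apply: (@marked_adj _ _ (r 3)); [exact: (D [:: 4])|rewrite adj_sym].
Qed.

(** * Soundness of the closure rules *)

Section Soundness.
Variables (K : set algebra) (t : term).
Hypothesis KV : K `<=` V12.
Local Notation Tt := (Th K t).

Lemma R12_Th v q m : satisfies R12 (preceq q v) -> m \in monos q -> Th K v m.
Proof.
move=> h; move: m; apply/(Th_preceq KV) => A KA.
exact: (proj1 (V12P A) (KV KA)).
Qed.

(** An odd closed walk has no two-colouring, so no evaluation in [R12] keeps all its edges below
    c. *)
Lemma Th_odd_closed f k : ~~ odd k -> f k.+1 = f 0 ->
  (forall i, i <= k -> Tt (mk_mono [:: f i; f i.+1])) -> zer K t.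
Proof.
move=> ok fk hf.
(* The last product closes the walk x_1, ..., x_(k+1), x_1 of odd length k+1; it is sent to the edge
   from f 0 to f 1, because f (k+1) = f 0. *)
pose v := (xpath k + xs k.+1 * xs 1)%term.
apply: (@zer_map K KV v t (fun j => f (j - 9))).
  move=> m; rewrite mem_cat inE => /orP[/xpath_monos[j jk ->]|/eqP->].
    by rewrite map_mono2 !addKn; exact: hf.
  by rewrite map_mono2 !addKn fk; exact: hf.
have : Th K v [:: 0; 0].
  apply: (@R12_Th v (Var 0 * Var 0)%term) => //; apply: R12_below.
    exists (mk_mono [:: 9 + k.+1; 9 + 1]); last by rewrite size_mk_mono.
    by rewrite mem_cat inE eqxx orbT.
  move=> e h; have hs : forall j, j <= k.+1 -> sideA (e (9 + j)) = odd j (+) sideA (e 9).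
    by apply: xpath_side => m mi; apply: h; rewrite mem_cat mi.
  have : le (amul (e (9 + k.+1)) (e (9 + 1))) (Rc : R12).
    rewrite -[amul _ _]/(value e [:: 9 + k.+1; 9 + 1]) -(value_mk V12_R12).
    by apply: h; rewrite mem_cat inE eqxx orbT.
  by move/r12_edge; rewrite (hs k.+1 (leqnn _)) (hs 1 isT) /= ok; case: sideA.
exact: (Th_square KV).
Qed.

(** In [R12] the marks keep both ends of the path away from p, and the odd length puts them on
    opposite sides, so their product is below c. *)
Lemma Th_odd_path f k : ~~ odd k -> Tt [:: f 0] -> Tt [:: f k.+1] ->
  (forall i, i <= k -> Tt (mk_mono [:: f i; f i.+1])) ->
  Tt (mk_mono [:: f 0; f k.+1]).
Proof.
move=> ok h0 hk hf.
pose v := (xs 0 + xs k.+1 + xpath k)%term.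
have -> : mk_mono [:: f 0; f k.+1] =
    map_mono (fun j => f (j - 9)) [:: 9 + 0; 9 + k.+1].
  by [].
apply: (@Th_map K KV v t) => [m|].
  rewrite !mem_cat !inE -orbA => /or3P[/eqP->|/eqP->|/xpath_monos[j jk ->]].
  - exact: h0.
  - exact: hk.
  - by rewrite map_mono2 !addKn; exact: hf.
apply: (@R12_Th v (xs 0 * xs k.+1)%term); last by rewrite inE mk_mono2 leq_add2l.
apply: R12_below.
  exists (mk_mono [:: 9 + 0; 9 + 1]); last by rewrite size_mk_mono.
  by rewrite mem_cat; apply/orP; right; apply/xpath_monos; exists 0.
move=> e h n; rewrite inE => /eqP->; rewrite (value_mk V12_R12) /value /=.
have hs : forall j, j <= k.+1 -> sideA (e (9 + j)) = odd j (+) sideA (e 9).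
  by apply: xpath_side => m mi; apply: h; rewrite mem_cat mi orbT.
have g j : j <= k -> le (amul (e (9 + j)) (e (9 + j.+1))) (Rc : R12).
  move=> jk; rewrite -[amul _ _]/(value e [:: 9 + j; 9 + j.+1]) -(value_mk V12_R12).
  by apply: h; rewrite mem_cat; apply/orP; right; apply/xpath_monos; exists j.
have l0 : le (e (9 + 0)) (Rc : R12).
  by apply: (h [:: 9 + 0]); rewrite !mem_cat inE eqxx.
have lk : le (e (9 + k.+1)) (Rc : R12).
  by apply: (h [:: 9 + k.+1]); rewrite !mem_cat !inE eqxx orbT.
have gk := g k (leqnn _); rewrite (amulC V12_R12) in gk.
apply: r12_mark_edge (r12_mark (g 0 _) l0) (r12_mark gk lk) _ => //.
by rewrite (hs k.+1 (leqnn _)) /= ok addn0.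
Qed.

Lemma Th_good : ~ zer K t -> good Tt.
Proof.
move=> nz; have adjT x y : adj Tt x y -> Tt (mk_mono [:: x; y]) by apply: adj_mono.
apply/goodP; split=> [[[x hx]|[m hm sm]|[c [sc oc _ /cycle_walk]]]|x y mx my [n on hn]].
- by apply: nz; apply: Th_square hx.
- by apply: nz; apply: Th_size hm sm.
- case: c sc oc => [//|x c] _ oc /walk_fun[f [f0 fn fa]]; apply: nz.
  apply: (@Th_odd_closed f (size c)) => //; first by rewrite fn f0.
  by move=> i ic; apply: adjT; apply: fa.
- case: n on hn => // n on /walk_fun[f [f0 fn fa]].
  rewrite -f0 -fn; apply: Th_odd_path => //.
  + by rewrite f0; exact: marked_mono mx.
  + by rewrite fn; exact: marked_mono my.
  + by move=> i ik; apply: adjT; apply: fa.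
Qed.

Definition has_law (i : identity) := forall A, K A -> satisfies A i.

Lemma Th_rule1 f r : has_law (identity_of f) -> ~ zer K t ->
  (forall m, m \in monos (body f) -> Tt (map_mono r m)) -> query_in r f Tt.
Proof.
move=> hf nz hb; rewrite /query_in /query /body /identity_of in hf hb *.
case E : (law_of f) hf hb => [q v|v|] hf hb.
- move=> m mi; apply: (Th_map KV hb); move: m mi.
  exact: (proj1 (Th_preceq KV _ _)).
- by apply: nz; apply: (zer_map KV hb); apply/(zer_square KV).
- case: nz => A KA e x.
  exact: (hf A KA (fun n => if n is 0 then eval e t else amul x x)).
Qed.

End Soundness.

Lemma law_gamma_dd (K : set algebra) dd n : K `<=` V12 ->
  has_law K (gamma_dd dd n) <-> Th K (gamma_dbody dd n) [:: 1; 9].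
Proof.
move=> KV; rewrite gamma_ddE; split=> [h|h].
  by apply: (proj1 (Th_preceq KV _ _) h); exact: mem_head.
by apply/(Th_preceq KV) => k; rewrite inE => /eqP->.
Qed.

Lemma Th_gamma_dd (K : set algebra) dd t n x x' y (G := Th K t) : K `<=` V12 ->
  0 < n -> has_law K (gamma_dd dd n) -> good G -> (dd -> hasD G) ->
  marked G x -> marked G x' -> walk G (2 * n) x x' -> adj G x' y -> adj G x y.
Proof.
move=> KV n0 /(law_gamma_dd _ _ KV) h Gg hD mx mx' /walk_fun[f [f0 fn fa]] x'y.
have [a [b ab]] := hasD_pair Gg hD.
(* Variable 1 is the letter y of gamma, 3 and 4 are the letters of D(t,u), and 9 + j is x_j. *)
pose r j := match j with 1 => y | 3 => a | 4 => b | _ => f (j - 9) end.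
have rE j : r (9 + j) = f j by rewrite /r /= -[_.+4 - 9]/(9 + j - 9) addKn.
apply: (good_edge Gg); have -> : mk_mono [:: x; y] = map_mono r (mk_mono [:: 9 + 0; 1]).
  by rewrite map_mono2 rE f0.
apply: (Th_map KV _ h) => m /gamma_dbody_monos[/(gamma_monos _ n0)|[/ab[ma mb mab]]].
  case=> [->|->|[j jn ->]|->].
  - by rewrite map_mono1 (rE 0) f0; exact: marked_mono mx.
  - by rewrite map_mono1 rE fn; exact: marked_mono mx'.
  - by rewrite map_mono2 !rE; apply: adj_mono; apply: fa.
  - by rewrite map_mono2 rE fn; exact: adj_mono x'y.
rewrite !inE => /or3P[] /eqP->.
- exact: (marked_mono ma).
- exact: (marked_mono mb).
- exact: (adj_mono mab).
Qed.

(** * Syntactic algebras *)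

Fixpoint tsubst (f : nat -> term) (t : term) : term :=
  match t with
  | Var n => f n
  | Add t1 t2 => Add (tsubst f t1) (tsubst f t2)
  | Mul t1 t2 => Mul (tsubst f t1) (tsubst f t2)
  end.

Lemma eval_tsubst (A : algebra) (e : nat -> A) f t :
  eval e (tsubst f t) = eval (fun n => eval e (f n)) t.
Proof. by elim: t => //= t1 -> t2 ->. Qed.

Lemma tsubst_id t : tsubst Var t = t.
Proof. by elim: t => //= t1 -> t2 ->. Qed.

Lemma bsub_mk f m : bsub f (mk_mono m) = bsub f m.
Proof.
apply: mk_mono_perm; apply: perm_flatten.
by apply: perm_map; rewrite perm_sort.
Qed.

Lemma bsub_cat f m n : bsub f (m ++ n) = mk_mono (bsub f m ++ bsub f n).
Proof.
apply: mk_mono_perm; rewrite map_cat flatten_cat.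
by apply: perm_cat; rewrite perm_sym perm_sort.
Qed.

Lemma bsub_monos f c t m : (forall x, c x \in monos (f x)) ->
  m \in monos t -> bsub c m \in monos (tsubst f t).
Proof.
move=> hc; elim: t m => [n|t1 IH1 t2 IH2|t1 IH1 t2 IH2] m /=.
- rewrite inE => /eqP->; rewrite /bsub /= cats0 mk_mono_id //.
  exact: monos_sorted (hc n).
- by rewrite !mem_cat => /orP[/IH1->//|/IH2->]; rewrite orbT.
- move=> /allpairsP[[m1 m2] /= [i1 i2 ->]]; rewrite bsub_mk bsub_cat.
  by apply/allpairsP; exists (bsub c m1, bsub c m2); split; [exact: IH1|exact: IH2|].
Qed.

Lemma monos_inh t : exists m, m \in monos t.
Proof.
elim: t => [x|t1 [m hm] t2 _|t1 [m hm] t2 [n hn]] /=.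
- by exists [:: x]; rewrite inE.
- by exists m; rewrite mem_cat hm.
- by exists (mk_mono (m ++ n)); apply/allpairsP; exists (m, n).
Qed.

Lemma size_flatten_ge (c : nat -> mono) (m : seq nat) : (forall x, c x <> [::]) ->
  size m <= size (flatten (map c m)).
Proof.
move=> hc; elim: m => //= x m IH; rewrite size_cat.
have : 0 < size (c x) by case: (c x) (hc x).
by lia.
Qed.

Lemma size_flatten_mem (c : nat -> mono) (m : seq nat) x :
  (forall x, c x <> [::]) -> x \in m ->
  size m + size (c x) <= (size (flatten (map c m))).+1.
Proof.
move=> hc; elim: m => //= y m IH; rewrite inE size_cat => /orP[/eqP->|/IH].
  by have := size_flatten_ge m hc; lia.
have : 0 < size (c y) by case: (c y) (hc y).
by lia.
Qed.

(** * Separation of a good set from a missing monomial *)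

Section Separation.
Variable w : set mono.
Hypothesis wgood : good w.

Definition isolated x := ~ exists y, adj w x y.

(** The colouring [s] distributes a and b, and [P], [Q] select the vertices raised to p, q. An
    isolated vertex has no edge to respect, so c or 0 records whether it is marked. *)
Definition valuation (s P Q : pred nat) (x : nat) : R12 :=
  if `[< isolated x >] then (if `[< w [:: x] >] then Rc else R0)
  else if s x then (if P x then Rp else Ra) else (if Q x then Rq else Rb).

Lemma valuation_le (s P Q : pred nat) : coloring w s ->
  (forall x, P x -> s x -> ~ w [:: x]) ->
  (forall x y, P x -> Q y -> s x -> ~~ s y -> ~ adj w x y) ->
  forall m, w m -> m <> [::] -> sorted leq m ->
  le (value (valuation s P Q) m) (Rc : R12).
Proof.
move=> ps hP hPQ m wm m0 sm; have := good_size wgood wm.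
case: m m0 sm wm => [//|x [|y [|? ?]]] //= _ sm wm _; rewrite /value /=.
  rewrite /valuation (asboolT wm); case: asboolP => // _.
  case: ifP => sx; last by case: ifP.
  by case: ifP => // Px; case: (hP x).
have xy : adj w x y by apply: (good_edge wgood); rewrite mk_mono_id.
have nx : ~ isolated x by apply; exists y.
have ny : ~ isolated y by apply; exists x; rewrite adj_sym.
rewrite /valuation !asboolF // (ps _ _ xy); case: (boolP (s x)) => sx /=.
  case: (boolP (P x)) => Px; case: (boolP (Q y)) => Qy //.
  by case: (hPQ x y) => //; rewrite (ps _ _ xy) sx.
case: (boolP (P y)) => Py; case: (boolP (Q x)) => Qx //.
case: (hPQ y x) => //; [by rewrite (ps _ _ xy)|by rewrite adj_sym].
Qed.

(** For a missing mark, the vertex is raised to p. For a missing edge, either a colouring gives both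
    ends the same colour, after a flip if they lie in different components, or they lie in opposite
    classes of one component. By goodness one of them is then unmarked: it is raised to p and the
    other to q. All other missing monomials already have value 0. *)
Lemma separation n : n <> [::] -> sorted leq n -> ~ w n ->
  exists e : nat -> R12,
    (forall m, w m -> m <> [::] -> sorted leq m -> le (value e m) (Rc : R12)) /\
    ~ le (value e n) (Rc : R12).
Proof.
move=> n0 sn nw; have [s [ps _]] := good_coloring wgood.
pose flip (x : nat) := fun y => if `[< conn w x y >] then ~~ s y else s y.
have pflip x : coloring w (flip x) by apply: coloring_flip.
have plain t : coloring w t -> forall m, w m -> m <> [::] -> sorted leq m ->
    le (value (valuation t pred0 pred0) m) (Rc : R12).
  by move=> pt; apply: valuation_le.
case: n n0 sn nw => [//|x [|y [|z n]]] _ sn nw.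
- exists (valuation (if s x then s else fun y => ~~ s y) (pred1 x) pred0); split.
    apply: valuation_le => // [|y /eqP->//].
    by case: (s x) => // a b ab; rewrite (ps _ _ ab).
  rewrite /value /= /valuation (asboolF nw); case: asboolP => // _ /=.
  have -> : (if s x then s else fun y => ~~ s y) x by case E : (s x); rewrite ?E.
  by rewrite eqxx.
- have [exy|nxy] := eqVneq x y.
    exists (valuation s pred0 pred0); split; first exact: plain.
    by rewrite /value /= exy; case: valuation.
  have nadj : ~ adj w x y by move/adj_mono; rewrite mk_mono_id.
  have [ix|ix] := pselect (isolated x).
    exists (valuation s pred0 pred0); split; first exact: plain.
    rewrite /value /= {1}/valuation (asboolT ix).
    by case: ifP => _; case: valuation.
  have [iy|iy] := pselect (isolated y).
    exists (valuation s pred0 pred0); split; first exact: plain.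
    rewrite /value /= {2}/valuation (asboolT iy).
    by case: ifP => _; case: valuation.
  have same t : coloring w t -> t x = t y -> exists e : nat -> R12,
      (forall m, w m -> m <> [::] -> sorted leq m -> le (value e m) (Rc : R12)) /\
      ~ le (value e [:: x; y]) (Rc : R12).
    move=> pt txy; exists (valuation t pred0 pred0); split; first exact: plain.
    by rewrite /value /= /valuation !asboolF // txy; case: ifP.
  have [sxy|sxy] := eqVneq (s x) (s y); first exact: same sxy.
  have [cxy|cxy] := pselect (conn w x y); last first.
    apply: (same _ (pflip x)); rewrite /flip (asboolT (conn_refl _ _)) (asboolF cxy).
    by move: sxy; case: (s x); case: (s y).
  have oxy : opposite_class w x y by apply/(coloring_opp ps cxy)/eqP.
  have : ~ (w [:: x] /\ w [:: y]).
    move=> [wx wy]; apply: nadj; apply: good_env => //; split=> //.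
      by apply: contrapT.
    by apply: contrapT.
  pose t c := if s c then s else fun y => ~~ s y.
  have pt c : coloring w (t c).
    by rewrite /t; case: (s c) => // a b ab; rewrite (ps _ _ ab).
  have tt c : t c c by rewrite /t; case: ifP => // ->.
  have tf : ~~ t x y /\ ~~ t y x.
    by rewrite /t; move: sxy; case sx : (s x); case sy : (s y); rewrite ?sx ?sy.
  have [wx|wx] := pselect (w [:: x]) => h.
    have wy : ~ w [:: y] by move=> wy; apply: h.
    exists (valuation (t y) (pred1 y) (pred1 x)); split.
      apply: valuation_le => // [a /eqP->//|a b /eqP-> /eqP-> _ _].
      by rewrite adj_sym.
    by rewrite /value /= /valuation !asboolF //= !eqxx tt (negPf tf.2).
  exists (valuation (t x) (pred1 x) (pred1 y)); split.
    by apply: valuation_le => // [a /eqP->//|a b /eqP-> /eqP-> _ _].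
  by rewrite /value /= /valuation !asboolF //= !eqxx tt (negPf tf.1).
- exists (valuation s pred0 pred0); split; first exact: plain.
  by rewrite (value_big3 V12_R12 _ R0).
Qed.

End Separation.

(* The quotient of the term algebra by the syntactic congruence of the set of
   terms all of whose summands lie in [w]. *)
Section SyntacticAlgebra.
Variable w : set mono.

Definition below (t : term) : Prop := forall m, m \in monos t -> w m.

(** Multiplicative contexts suffice: a sum is below [w] as soon as its summands are, so additive
    contexts distinguish nothing more. *)
Definition contexts (t : term) (k : option term) : Prop :=
  if k is Some k' then below (t * k') else below t.

Lemma belowM s t : below (s * t) <-> forall m n, m \in monos s ->
  n \in monos t -> w (mk_mono (m ++ n)).
Proof.
split=> [h m n mi ni|h k /allpairsP[[m n] /= [mi ni ->]]]; last exact: h.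
by apply: h; apply/allpairsP; exists (m, n).
Qed.

Lemma belowMC s t : below (s * t) <-> below (t * s).
Proof.
by rewrite !belowM; split=> h m n mi ni;
  rewrite (mk_mono_catC m n); apply: h.
Qed.

Lemma belowMA s t u : below (s * t * u) <-> below (s * (t * u)).
Proof.
rewrite !belowM; split=> h m n.
- move=> mi /allpairsP[[n1 n2] /= [i1 i2 ->]].
  rewrite (mk_mono_catC m _) mk_mono_cat.
  rewrite (mk_mono_catC _ m) catA -mk_mono_cat.
  by apply: h => //; apply/allpairsP; exists (m, n1).
- move=> /allpairsP[[m1 m2] /= [i1 i2 ->]] ni; rewrite mk_mono_cat -catA.
  rewrite (mk_mono_catC m1 _) -mk_mono_cat (mk_mono_catC _ m1).
  by apply: h => //; apply/allpairsP; exists (m2, n).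
Qed.

Lemma contextsD s t k : contexts (s + t) k <-> contexts s k /\ contexts t k.
Proof.
have h u v : below (u + v) <-> below u /\ below v.
  split=> [h|[h1 h2] m]; last by rewrite mem_cat => /orP[/h1|/h2].
  by split=> m mi; apply: h; rewrite mem_cat mi ?orbT.
case: k => [k|] /=; last exact: h.
rewrite !belowM; split=> [g|[g1 g2] m n]; last first.
  by rewrite mem_cat => /orP[]; [exact: g1|exact: g2].
by split=> m n mi ni; apply: g => //; rewrite mem_cat mi ?orbT.
Qed.

Lemma contextsD_eq s s' t t' : contexts s = contexts s' ->
  contexts t = contexts t' -> contexts (s + t) = contexts (s' + t').
Proof.
by move=> hs ht; apply/funext => k; apply/propext; rewrite !contextsD hs ht.
Qed.

Lemma contextsM_eq s s' t t' : contexts s = contexts s' ->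
  contexts t = contexts t' -> contexts (s * t) = contexts (s' * t').
Proof.
have h u u' v : contexts u = contexts u' -> contexts (u * v) = contexts (u' * v).
  move=> hu; apply/funext => -[k|]; apply/propext.
    have := congr1 (fun f => f (Some (v * k)%term)) hu.
    by rewrite /contexts /= !belowMA => ->.
  by have := congr1 (fun f => f (Some v)) hu; rewrite /contexts /= => ->.
have hC u v : contexts (u * v) = contexts (v * u).
  apply/funext => -[k|]; apply/propext; last exact: belowMC.
  rewrite /contexts; split=> /belowM g; apply/belowM => m n mi ni;
  move: mi => /allpairsP[[m1 m2] /= [i1 i2 ->]];
  by rewrite (mk_mono_catC m1); apply: g => //; apply/allpairsP; exists (m2, m1).
by move=> hs ht; rewrite (h _ _ _ hs) hC (h _ _ _ ht) hC.
Qed.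

Let carr := {P : option term -> Prop | exists t, P = contexts t}.

Let cls (t : term) : carr := exist _ (contexts t) (ex_intro _ t erefl).

Let repr (x : carr) : {t | sval x = contexts t} := cid (svalP x).

Definition syntactic : algebra :=
  @Algebra carr (fun x y => cls (sval (repr x) + sval (repr y)))
    (fun x y => cls (sval (repr x) * sval (repr y))) (inhabits (cls (Var 0))).

Lemma eval_syntactic (e : nat -> syntactic) f t :
  (forall n, sval (e n : carr) = contexts (f n)) ->
  sval (eval e t : carr) = contexts (tsubst f t).
Proof.
move=> h; elim: t => [n|t1 IH1 t2 IH2|t1 IH1 t2 IH2] //=.
- by apply: contextsD_eq; rewrite -(svalP (repr _)).
- by apply: contextsM_eq; rewrite -(svalP (repr _)).
Qed.

Lemma satisfies_syntactic l r : satisfies syntactic (l, r) <->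
  forall f, contexts (tsubst f l) = contexts (tsubst f r).
Proof.
split=> [h f|h e].
  have := congr1 (fun x : carr => sval x) (h (fun n => cls (f n))).
  by rewrite !(@eval_syntactic _ f).
have E : forall n, sval (e n : carr) = contexts (sval (repr (e n))).
  by move=> n; apply: (svalP (repr _)).
have /= := h (fun n => sval (repr (e n))); rewrite -!(eval_syntactic _ E).
by case: (eval e l) (eval e r) => [x hx] [y hy] /= xy; subst y; congr exist; exact: Prop_irrelevance.
Qed.

Hypothesis wgood : good w.

Lemma V12_syntactic : V12 syntactic.
Proof.
apply/V12P => -[l r] R; apply/satisfies_syntactic => f.
suff h s t : (forall e : nat -> R12, eval e s = eval e t) -> below s -> below t.
  have E e : eval (e : nat -> R12) (tsubst f l) = eval e (tsubst f r).
    by rewrite !eval_tsubst; exact: R.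
  by apply/funext => -[k|]; apply/propext; split; apply: h => e /=; rewrite E.
move=> E bs n ni; apply: contrapT => nw.
have [e [he nle]] := separation wgood (mono_neq0 ni) (monos_sorted ni) nw.
apply: nle; suff H : le (eval e t) (Rc : R12).
  exact: (proj1 (le_monos V12_R12 e t _) H n ni).
rewrite -E; apply/(le_monos V12_R12) => m mi.
by apply: he; [exact: bs|exact: mono_neq0 mi|exact: monos_sorted mi].
Qed.

(** A further factor raises the degree to at least three, which a good set does not contain. For
    such terms only the empty context matters. *)
Lemma contexts_long v f k : (exists2 m, m \in monos v & 1 < size m) ->
  ~ contexts (tsubst f v) (Some k).
Proof.
move=> [m mi sm] /belowM h.
have /choice[c hc] : forall x, exists n, n \in monos (f x).
  by move=> x; apply: monos_inh.
have [n hn] := monos_inh k.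
have := good_size wgood (h _ _ (bsub_monos hc mi) hn).
have n0 : 0 < size n by case: n hn (mono_neq0 hn).
have := size_flatten_ge m (fun x => mono_neq0 (hc x)).
rewrite -(size_mk_mono (flatten _)) -/(bsub c m).
rewrite size_mk_mono size_cat; move: sm n0.
by move: (size n) (size m) (size (bsub c m)) => a b d; lia.
Qed.

(** A converse of [bsub_monos]. It can fail for a monomial with a repeated variable, whose
    occurrences may be replaced by different summands. *)
Definition linear (q : term) : Prop := forall f n, n \in monos (tsubst f q) ->
  exists c m, [/\ forall x, c x \in monos (f x), m \in monos q & n = bsub c m].

Lemma linear_var x : linear (Var x).
Proof.
move=> f n ni.
have /choice[c hc] : forall y, exists m, m \in monos (f y) /\ (y = x -> m = n).
  move=> y; have [->|yx] := eqVneq y x; first by exists n.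
  have [m hm] := monos_inh (f y); exists m; split=> // /eqP.
  by rewrite (negPf yx).
exists c, [:: x]; split=> [y||]; first by case: (hc y).
  by rewrite inE.
by rewrite /bsub /= cats0 (proj2 (hc x)) // mk_mono_id // (monos_sorted ni).
Qed.

Lemma linear_edge x y : x != y -> linear (Var x * Var y).
Proof.
move=> xy f n /allpairsP[[n1 n2] /= [i1 i2 ->]].
have /choice[c hc] : forall z, exists m,
    [/\ m \in monos (f z), z = x -> m = n1 & z = y -> m = n2].
  move=> z; have [->|zx] := eqVneq z x.
    by exists n1; split=> // /eqP; rewrite (negPf xy).
  have [->|zy] := eqVneq z y; first by exists n2; split=> // /eqP; rewrite eq_sym (negPf xy).
  by have [m hm] := monos_inh (f z); exists m; split=> // /eqP; rewrite ?(negPf zx) ?(negPf zy).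
exists c, (mk_mono [:: x; y]); split=> [z||]; first by case: (hc z).
  by rewrite inE.
have [_ cx _] := hc x; have [_ _ cy] := hc y.
by rewrite bsub_mk /bsub /= cats0 cx // cy.
Qed.

Definition covered (v : term) (s : mono) : Prop :=
  forall x, x \in s -> exists2 m, m \in monos v & (x \in m) && (1 < size m).

(** A good set has degree at most two, so a letter that occurs in a quadratic summand can only be
    replaced by a variable. Substitutions thus become the renamings that rule 1 speaks of. *)
Lemma bsub_single v f c : (forall x, c x \in monos (f x)) -> below (tsubst f v) ->
  forall m, covered v m -> bsub c m = map_mono (fun x => head 0 (c x)) m.
Proof.
move=> hc bv m cm; rewrite /bsub /map_mono; congr mk_mono.
have c1 x : x \in m -> c x = [:: head 0 (c x)].
  move=> /cm[m' m'i /andP[xm' sm']].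
  have h1 := good_size wgood (bv _ (bsub_monos hc m'i)).
  have h2 : size m' + size (c x) <= (size (bsub c m')).+1.
    by rewrite size_mk_mono; apply: size_flatten_mem => // y; exact: mono_neq0 (hc y).
  have : size (c x) <= 1.
    move: h1 h2 sm'; move: (size m') (size (c x)) (size (bsub c m')) => i j k; lia.
  by have := mono_neq0 (hc x); case: (c x) => [|a []].
elim: m {cm} c1 => //= x m IH c1; rewrite c1 ?mem_head // IH // => y ym.
by apply: c1; rewrite inE ym orbT.
Qed.

Lemma covered_long v : (forall m, m \in monos v -> covered v m) ->
  exists2 m, m \in monos v & 1 < size m.
Proof.
move=> cv; have [m mi] := monos_inh v.
have : head 0 m \in m by have := mono_neq0 mi; case: (m) => //= x ? _; exact: mem_head.
by case/(cv m mi) => m' m'i /andP[_ ?]; exists m'.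
Qed.

Lemma syntactic_below q v : linear q ->
  (forall m, m \in monos q -> covered v m) ->
  (forall m, m \in monos v -> covered v m) ->
  (forall r, (forall m, m \in monos v -> w (map_mono r m)) ->
     forall m, m \in monos q -> w (map_mono r m)) ->
  satisfies syntactic (preceq q v).
Proof.
move=> lq cq cv h; apply/satisfies_syntactic => f.
apply/funext => -[k|]; apply/propext; rewrite contextsD; split=> [[]//|hv]; split=> //.
  by case: (contexts_long (covered_long cv) hv).
move=> n /lq[c [m [hc mi ->]]]; rewrite (bsub_single hc hv (cq _ mi)).
apply: h mi => m' m'i; rewrite -(bsub_single hc hv (cv _ m'i)).
exact/hv/bsub_monos.
Qed.

Lemma syntactic_square v : (forall m, m \in monos v -> covered v m) ->
  (forall r, ~ (forall m, m \in monos v -> w (map_mono r m))) ->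
  satisfies syntactic (Var 0 * Var 0, v)%term.
Proof.
move=> cv h; apply/satisfies_syntactic => f.
have nsq k : ~ contexts (tsubst f (Var 0 * Var 0)) k.
  have [m mi] := monos_inh (f 0).
  case: k => [k|].
    by apply: contexts_long; exists [:: 0; 0] => //; rewrite inE.
  move=> /belowM/(_ m m mi mi) wm; have := good_size wgood wm.
  have := mono_neq0 mi; rewrite size_mk_mono size_cat.
  case: m mi wm => [|x [|y m]] //= _ wm _ sz; last by lia.
  by move: wm; rewrite mk_mono2 leqnn; exact: (good_nsquare wgood).
have nv k : ~ contexts (tsubst f v) k.
  case: k => [k|] hv; first by case: (contexts_long (covered_long cv) hv).
  have /choice[c hc] : forall x, exists n, n \in monos (f x).
    by move=> x; apply: monos_inh.
  apply: (h (fun x => head 0 (c x))) => m' m'i.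
  by rewrite -(bsub_single hc hv (cv _ m'i)); exact/hv/bsub_monos.
by apply/funext => k; apply/propext; split=> [/nsq|/nv].
Qed.

Lemma syntactic_preceq q v : satisfies syntactic (preceq q v) ->
  below v -> below q.
Proof.
move=> /satisfies_syntactic/(_ Var); rewrite !tsubst_id => h bv.
have /contextsD[] // : contexts (q + v) None.
by move: h; rewrite /preceq => ->.
Qed.

Lemma syntactic_square_eq v : satisfies syntactic (Var 0 * Var 0, v)%term ->
  ~ below v.
Proof.
move=> /satisfies_syntactic/(_ Var); rewrite !tsubst_id => h bv.
have : contexts (Var 0 * Var 0) None by rewrite h.
move=> /(_ [:: 0; 0] (mem_head _ _)); exact: (good_nsquare wgood).
Qed.

(** Apart from [tau], every letter of a body or query occurs in a quadratic summand of the body, so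
    [bsub_single] applies. *)
Lemma syntactic_law f : f <> tau ->
  (forall r, (forall m, m \in monos (body f) -> w (map_mono r m)) -> query_in r f w) ->
  satisfies syntactic (identity_of f).
Proof.
have cov (v : term) (s : seq nat) : all (fun x => has (fun m => (x \in m) && (1 < size m)) (monos v)) s ->
    covered v s.
  by move=> /allP h x /h/hasP[m]; exists m.
have covs q v : all (fun m : seq nat => all (fun x => has (fun m : seq nat => (x \in m) && (1 < size m))
    (monos v)) m) (monos q) -> forall m, m \in monos q -> covered v m.
  by move=> /allP h m /h; apply: cov.
case: f => // _ h; rewrite /identity_of /=;
  solve [apply: syntactic_below; [by [apply: linear_var|apply: linear_edge]
    |exact: covs|exact: covs|exact: h]
   |apply: syntactic_square; [exact: covs|exact: h]].
Qed.

Lemma syntactic_not_law f : below (body f) -> ~ query_in id f w ->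
  ~ satisfies syntactic (identity_of f).
Proof.
rewrite /query_in /identity_of /query /body; case: (law_of f) => [q v|v|] bv nq hs.
- by apply: nq => m mi; rewrite (map_mono_id mi); exact: (syntactic_preceq hs bv).
- exact: syntactic_square_eq hs bv.
- apply: nq => m /[dup] mi; rewrite (map_mono_id mi) => mi'.
  have E : contexts (Var 0) = contexts (Var 1).
    exact: (proj1 (satisfies_syntactic _ _) hs Var).
  have h : contexts (Var 1) None by rewrite -E.
  exact: h.
Qed.

Lemma gamma_covered n m : 0 < n -> m \in monos (gamma_body n) ->
  covered (gamma_body n) m.
Proof.
move=> n0 mi x xm.
have path j : j <= 2 * n -> exists2 m, m \in monos (gamma_body n) & (9 + j \in m) && (1 < size m).
  move=> jn; case: j jn => [|j] jn.
    exists (mk_mono [:: 9 + 0; 9 + 1]); last by rewrite size_mk_mono mem_sort mem_head.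
    by apply/gamma_monos => //; constructor 3; exists 0 => //; lia.
  exists (mk_mono [:: 9 + j; 9 + j.+1]); last by rewrite size_mk_mono mem_sort !inE eqxx orbT.
  by apply/gamma_monos => //; constructor 3; exists j.
case/(gamma_monos _ n0): mi xm => [->|->|[j jn ->]|->].
- by rewrite inE => /eqP->; exact: (path 0).
- by rewrite inE => /eqP->; exact: path.
- rewrite mem_sort !inE => /orP[/eqP->|/eqP->]; [exact: (path j (ltnW jn))|exact: path].
- rewrite mem_sort !inE => /orP[/eqP->|/eqP->]; first exact: path.
  exists (mk_mono [:: 9 + 2 * n; 1]); last by rewrite size_mk_mono mem_sort !inE eqxx orbT.
  by apply/gamma_monos => //; constructor 4.
Qed.

Lemma gamma_query_covered n m : 0 < n -> m \in monos (xs 0 * Var 1) ->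
  covered (gamma_body n) m.
Proof.
move=> n0; rewrite inE => /eqP-> x; rewrite mem_sort => xm.
have [x9|/eqP x9] := boolP (x == 9).
  apply: (@gamma_covered n [:: 9]); [by []|by apply/gamma_monos => //; constructor 1|].
  by rewrite inE.
apply: (@gamma_covered n (mk_mono [:: 9 + 2 * n; 1])) => //.
  by apply/gamma_monos => //; constructor 4.
by rewrite mem_sort; move: xm; rewrite !inE => /orP[/eqP//|->]; rewrite orbT.
Qed.

Lemma syntactic_gamma (dd : bool) n : 0 < n ->
  ((dd -> hasD w) -> forall x x' y, marked w x -> marked w x' ->
     walk w (2 * n) x x' -> adj w x' y -> adj w x y) ->
  satisfies syntactic (gamma_dd dd n).
Proof.
move=> n0 h; rewrite gamma_ddE.
have cov s : covered (gamma_body n) s -> covered (gamma_dbody dd n) s.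
  by move=> cs x /cs[m mi xm]; exists m => //; apply/gamma_dbody_monos; left.
apply: syntactic_below; first exact: linear_edge.
- by move=> m /(gamma_query_covered n0)/cov.
- move=> m /gamma_dbody_monos[/(gamma_covered n0)/cov//|[d mi]] x xm.
  exists [:: 3; 4]; first by apply/gamma_dbody_monos; right; rewrite d !inE orbT.
  by move: mi xm; rewrite !inE => /or3P[] /eqP->; rewrite !inE => //= ->; rewrite ?orbT.
- move=> r /(map_gamma_path wgood n0)[[m1 m2 wk a] hd] m; rewrite inE => /eqP->.
  rewrite map_mono2; apply: adj_mono; apply: h m1 m2 (wk _ (leqnn _)) a.
  by move=> /hd[m3 m4 a34]; exists (r 3), (r 4); split=> //; exists 1 => //; apply/walk1.
Qed.

Lemma syntactic_not_gamma dd n : below (gamma_dbody dd n) ->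
  ~ w (mk_mono [:: 9; 1]) -> ~ satisfies syntactic (gamma_dd dd n).
Proof.
by rewrite gamma_ddE => bv nw /syntactic_preceq/(_ bv _ (mem_head _ _)).
Qed.

End SyntacticAlgebra.

(** * Closed graphs *)

Definition dlaw (f fD : f25) (dd : bool) : f25 := if dd then fD else f.

Section Closures.
Variable G : set mono.
Hypothesis Ggood : good G.
Local Notation adj := (adj G).
Local Notation walk := (walk G).
Local Notation marked := (marked G).

Definition closed1 (f : f25) : Prop := forall r,
  (forall m, m \in monos (body f) -> G (map_mono r m)) -> query_in r f G.

Lemma closed1_id f : closed1 f -> (forall m, m \in monos (body f) -> G m) ->
  query_in id f G.
Proof. by move=> h hb; apply: h => m mi; rewrite (map_mono_id mi); exact: hb. Qed.

(** Entry i of [s] is the value of variable i; in the instances below a 0 fills the place of a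
    letter absent from the body. *)
Lemma closed1_seq f s : closed1 f ->
  foldr (fun m Q => G (map_mono (nth 0 s) m) /\ Q) True (monos (body f)) ->
  query_in (nth 0 s) f G.
Proof.
move=> h hm; apply: h; elim: monos hm => //= m l IH [h1 /IH h2] n.
by rewrite inE => /orP[/eqP->|/h2].
Qed.

Variable dd : bool.
Hypothesis hD : dd -> hasD G.

Ltac close_by s h :=
  first [apply: (closed1_seq (s := s) h) (mem_head _ _)|apply: (closed1_seq (s := s) h)];
  do !split=> //; first [exact: adj_mono|exact: marked_mono].

(* [t] and [u] are variables 3 and 4 of every body that contains D(t,u). *)
Ltac close_dlaw s h :=
  let t := fresh in let u := fresh in let tu := fresh in
  have [t [u tu]] := hasD_pair Ggood hD; move: h tu; case: (dd) => h tu;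
  [have [//|? ? ?] := tu|]; let l := eval cbv beta in (s t u) in close_by l h.

Lemma close_rho x y : closed1 rho -> adj x y -> G [:: x].
Proof. move=> h xy; close_by [:: x; y] h. Qed.

Lemma close_omega x y : closed1 (dlaw omega omega_D dd) ->
  G [:: x] -> adj x y -> G [:: y].
Proof. move=> h mx xy; close_dlaw (fun t u => [:: x; y; 0; t; u]) h. Qed.

Lemma close_eta x y z : closed1 (dlaw Defs.eta eta_D dd) ->
  G [:: x] -> adj x y -> adj y z -> G [:: z].
Proof. move=> h mx xy yz; close_dlaw (fun t u => [:: x; y; z; t; u]) h. Qed.

Lemma close_zeta x y z t : closed1 zeta ->
  G [:: x] -> adj x y -> adj z t -> G [:: z].
Proof. move=> h mx xy zt; close_by [:: x; y; z; t] h. Qed.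

Lemma close_zeta_D z t : hasD G -> closed1 zeta_D -> adj z t -> G [:: z].
Proof.
move=> /(hasD_adj Ggood)[x [y [mx my xy]]] h zt; close_by [:: x; y; z; t] h.
Qed.

Lemma close_lambda x y z : closed1 lambda ->
  G [:: x] -> G [:: y] -> adj x y -> adj x z -> G [:: z].
Proof. move=> h mx my xy xz; close_by [:: x; y; z] h. Qed.

Lemma close_mu a b c d : closed1 (dlaw mu mu_D dd) ->
  G [:: b] -> adj a b -> adj b c -> adj c d -> adj a d.
Proof.
move=> h mb ab bc cd; apply: (good_edge Ggood);
  close_dlaw (fun t u => [:: 0; 0; 0; t; u; a; b; c; d]) h.
Qed.

Lemma close_alpha a b c d : closed1 (dlaw alpha alpha_D dd) ->
  G [:: a] -> adj a b -> adj b c -> adj c d -> adj a d.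
Proof.
move=> h ma ab bc cd; apply: (good_edge Ggood);
  close_dlaw (fun t u => [:: 0; 0; 0; t; u; a; b; c; d]) h.
Qed.

Lemma close_delta a b c d : closed1 delta ->
  adj a b -> adj b c -> adj c d -> adj a d.
Proof.
move=> h ab bc cd; apply: (good_edge Ggood); close_by [:: 0; 0; 0; 0; 0; a; b; c; d] h.
Qed.

Lemma close_nu t u a b c d : closed1 nu -> G [:: t] -> adj t u ->
  adj a b -> adj b c -> adj c d -> adj a d.
Proof.
move=> h mt tu ab bc cd; apply: (good_edge Ggood);
  close_by [:: 0; 0; 0; t; u; a; b; c; d] h.
Qed.

Lemma close_nu_D a b c d : hasD G -> closed1 nu_D ->
  adj a b -> adj b c -> adj c d -> adj a d.
Proof.
move=> /(hasD_adj Ggood)[t [u [mt mu tu]]] h ab bc cd; apply: (good_edge Ggood);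
  close_by [:: 0; 0; 0; t; u; a; b; c; d] h.
Qed.

Lemma close_iota x0 x1 x2 x3 x4 x5 : closed1 (dlaw iota2 iota2_D dd) ->
  G [:: x1] -> adj x0 x1 -> adj x1 x2 -> adj x2 x3 -> adj x3 x4 -> adj x4 x5 ->
  adj x0 x5.
Proof.
move=> h m1 a0 a1 a2 a3 a4; apply: (good_edge Ggood);
  close_dlaw (fun t u => [:: 0; 0; 0; t; u; 0; 0; 0; 0; x0; x1; x2; x3; x4; x5]) h.
Qed.

Lemma close_beta x y z t : closed1 beta -> G [:: x] -> G [:: t] ->
  adj x y -> adj t z -> adj x z.
Proof.
move=> h mx mt xy; rewrite adj_sym => zt; apply: (good_edge Ggood);
  close_by [:: x; y; z; t] h.
Qed.

Lemma close_mu2 a b c d : closed1 mu2 -> G [:: b] -> G [:: c] ->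
  adj a b -> adj b c -> adj c d -> adj a d.
Proof.
move=> h mb mc ab bc cd; apply: (good_edge Ggood);
  close_by [:: 0; 0; 0; 0; 0; a; b; c; d] h.
Qed.

Lemma close_kappa a b c d : closed1 kappa -> G [:: a] -> G [:: b] ->
  adj a b -> adj b c -> adj c d -> adj a d.
Proof.
move=> h ma mb ab bc cd; apply: (good_edge Ggood);
  close_by [:: 0; 0; 0; 0; 0; a; b; c; d] h.
Qed.

Lemma close_epsilon a b c d : closed1 epsilon -> G [:: a] -> G [:: b] ->
  G [:: c] -> adj a b -> adj b c -> adj c d -> adj a d.
Proof.
move=> h ma mb mc ab bc cd; apply: (good_edge Ggood);
  close_by [:: 0; 0; 0; 0; 0; a; b; c; d] h.
Qed.

Lemma close_xi : hasD G -> ~ closed1 xi.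
Proof. move=> /(hasD_adj Ggood)[x [y [mx my xy]]] h; close_by [:: x; y] h. Qed.

Lemma close_sq x : marked x -> ~ closed1 sq.
Proof. move=> [mx [y xy]] h; close_by [:: x; y] h. Qed.

Lemma close_chi x y : adj x y -> ~ closed1 chi.
Proof. move=> xy h; close_by [:: x; y] h. Qed.

(** The first three steps of an odd walk are replaced by one. *)
Lemma shorten a : (forall b c d, adj a b -> adj b c -> adj c d -> adj a d) ->
  forall n z, odd n -> walk n a z -> adj a z.
Proof.
move=> h n; elim/ltn_ind: n => -[|[|[|n]]] IH z //=.
  by move=> _ /walk1.
rewrite negbK => on /walkS[b ab /walkS[c bc /walkS[d cd dz]]].
apply: (IH n.+1) => //=; apply/walkS; exists d => //; exact: h ab bc cd.
Qed.

Lemma shorten_all : (forall a b c d, adj a b -> adj b c -> adj c d -> adj a d) ->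
  forall a z, opposite_class G a z -> adj a z.
Proof. by move=> h a z [n on]; apply: shorten => // b c d; apply: h. Qed.

Lemma alpha_full a z : closed1 (dlaw alpha alpha_D dd) -> G [:: a] ->
  opposite_class G a z -> adj a z.
Proof.
by move=> h ma [n on]; apply: shorten => // b c d; apply: close_alpha.
Qed.

Lemma omega_full x y : closed1 (dlaw omega omega_D dd) -> G [:: x] ->
  conn G x y -> G [:: y].
Proof.
move=> h mx [n]; elim: n y => [|n IH] y; first by move/walk0<-.
by move=> /walkSr[z /IH mz zy]; apply: close_omega mz zy.
Qed.

Lemma eta_full x y : closed1 (dlaw Defs.eta eta_D dd) -> G [:: x] ->
  same_class G x y -> G [:: y].
Proof.
move=> h mx [n]; elim/ltn_ind: n y => -[|[|n]] IH y //=.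
  by move=> _ /walk0<-.
rewrite negbK => en /walkSr[z /walkSr[t xt tz] zy].
by apply: close_eta tz zy => //; apply: IH xt.
Qed.

Lemma iota_full y m v : closed1 (dlaw iota2 iota2_D dd) -> G [:: m] ->
  adj m y -> same_class G m v -> adj y v.
Proof.
move=> h mm my [n]; elim/ltn_ind: n v => -[|[|n]] IH v //=.
  by move=> _ /walk0<-; rewrite adj_sym.
rewrite negbK => en /walkSr[z /walkSr[t mt tz] zv].
have yt : adj y t by apply: IH mt.
(* The path is y, m, y, t, z, v, with x_0 and x_2 identified. *)
by apply: (close_iota h mm _ my yt tz zv); rewrite adj_sym.
Qed.

Lemma lambda_full x : closed1 lambda -> Dcomp G x -> G [:: x].
Proof.
move=> h [a [b [xa ma mb o]]]; have ab := good_env Ggood ma mb o.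
(* The marked neighbour carried along supplies the marked edge for the next application of
   [lambda]. *)
suff : forall n y, walk n a y -> G [:: y] /\ exists2 z, G [:: z] & adj y z.
  by case: (conn_sym xa) => n hn /(_ n x hn)[].
elim=> [|n IH] y.
  by move/walk0<-; split; [exact: marked_mono|exists b => //; exact: marked_mono].
move=> /walkSr[t /IH[mt [z mz tz]] ty]; split; first exact: close_lambda tz ty.
by exists t; rewrite // adj_sym.
Qed.

(** Along a walk from [a], each new vertex v ends a path a, b, t, v or b, a, t, v whose first two
    vertices are marked, and [kappa] joins its ends. *)
Lemma kappa_full s a b v : closed1 kappa -> coloring G s ->
  G [:: a] -> G [:: b] -> adj a b -> conn G a v ->
  if s v == s a then adj b v else adj a v.
Proof.
move=> h ps ma mb ab [n]; elim: n v => [|n IH] v.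
  by move/walk0<-; rewrite eqxx adj_sym.
move=> /walkSr[t /IH ht tv]; rewrite (ps _ _ tv); move: ht.
have ba : adj b a by rewrite adj_sym.
have [->|nst] := eqVneq (s t) (s a).
  move=> bt; have -> : ~~ s a == s a = false by case: (s a).
  exact: close_kappa h ma mb ab bt tv.
have -> : ~~ s t == s a by move: nst; case: (s a); case: (s t).
by move=> at_; exact: close_kappa h mb ma ba at_ tv.
Qed.

End Closures.

(** * Folding closed graphs onto bodies *)

(* Folds the distances 0, 1, 2, ... onto the path 2n, ..., 1, 0 of [gamma n]. *)
Definition level n i : nat := if i <= 2 * n then 2 * n - i else odd i.

(** Distances of adjacent vertices from a set of one class differ by one, so they fold to adjacent
    vertices of the path; beyond 2n the fold alternates between x_0 and x_1. *)
Lemma level_step n i j : 0 < n -> ~~ odd i -> odd j -> j <= i.+1 -> i <= j.+1 ->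
  level n i < 2 * n /\ level n j = (level n i).+1 \/
  level n j < 2 * n /\ level n i = (level n j).+1.
Proof.
move=> n0 oi oj h1 h2.
have iE := odd_double_half i; have jE := odd_double_half j.
rewrite (negPf oi) oj -!muln2 in iE jE.
rewrite /level (negPf oi) oj; case: (leqP i) => u; case: (leqP j) => w /=; lia.
Qed.

Lemma level_even n i : 0 < n -> 4 <= i -> ~~ odd i ->
  exists2 k, level n i = 2 * k & k + 2 <= n \/ k = 0.
Proof.
move=> n0 h oi; have iE := odd_double_half i; rewrite (negPf oi) -muln2 in iE.
exists (if i <= 2 * n then n - i./2 else 0); rewrite /level ?(negPf oi); case: (leqP i) => u /=; lia.
Qed.

Lemma gamma_dbody_Th (K : set algebra) dd n (T := gamma_dbody dd n) :
  K `<=` V12 -> 0 < n ->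
  [/\ Th K T [:: 9], Th K T [:: 9 + 2 * n],
      forall j, j < 2 * n -> Th K T (mk_mono [:: 9 + j; 9 + j.+1]),
      Th K T (mk_mono [:: 9 + 2 * n; 1])
    & dd -> [/\ Th K T [:: 3], Th K T [:: 4] & Th K T [:: 3; 4]]].
Proof.
move=> KV n0; have Tg k : k \in monos (gamma_body n) -> Th K T k.
  by move=> ki; apply: Th_monos => //; apply/gamma_dbody_monos; left.
split; last by move=> d; split; apply: Th_monos => //; apply/gamma_dbody_monos; right.
- by apply: Tg; apply/gamma_monos => //; constructor 1.
- by apply: Tg; apply/gamma_monos => //; constructor 2.
- by move=> j jn; apply: Tg; apply/gamma_monos => //; constructor 3; exists j.
- by apply: Tg; apply/gamma_monos => //; constructor 4.
Qed.

Lemma gamma_path (K : set algebra) dd n (G := Th K (gamma_dbody dd n)) :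
  K `<=` V12 -> 0 < n -> ~ zer K (gamma_dbody dd n) -> good G /\
  [/\ marked G 9, marked G (9 + 2 * n), forall j, j <= 2 * n -> walk G j 9 (9 + j),
      adj G (9 + 2 * n) 1 & dd -> hasD G].
Proof.
move=> KV n0 nz; have Gg : good G := Th_good KV nz; split=> //.
have [|[m0 m2 wk a] hd] := @map_gamma_path G dd id n Gg n0.
  by move=> m mi; rewrite (map_mono_id mi); exact: Th_monos.
by split=> // /hd[m3 m4 a34]; exists 3, 4; split=> //; exists 1 => //; apply/walk1.
Qed.

Lemma Th_mu (K : set algebra) dd T a b c d : K `<=` V12 ->
  has_law K (identity_of (dlaw mu mu_D dd)) ->
  (dd -> [/\ Th K T [:: 3], Th K T [:: 4] & Th K T [:: 3; 4]]) ->
  Th K T [:: b] -> Th K T (mk_mono [:: a; b]) -> Th K T (mk_mono [:: b; c]) ->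
  Th K T (mk_mono [:: c; d]) -> Th K T (mk_mono [:: a; d]).
Proof.
move=> KV h hD hb ab bc cd.
rewrite -[mk_mono _]/(map_mono (nth 0 [:: 0; 0; 0; 3; 4; a; b; c; d]) [:: 5; 8]).
apply: (@Th_map _ KV (body (dlaw mu mu_D dd))).
  move=> k; case: dd hD {h} => [/(_ isT)[h3 h4 h34]|_]; rewrite !inE.
    by case/or4P=> [/eqP->|/eqP->|/eqP->|/or4P[/eqP->|/eqP->|/eqP->|/eqP->]].
  by case/or4P=> /eqP->.
by case: dd h {hD} => h; apply: (proj1 (Th_preceq KV _ _) h); exact: mem_head.
Qed.

(** The letters a, b, c, d of [mu] become y, x_2, x_1, x_0, with the required mark at x_2. *)
Lemma mu_gamma (K : set algebra) dd : K `<=` V12 ->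
  has_law K (identity_of (dlaw mu mu_D dd)) -> has_law K (gamma_dd dd 1).
Proof.
move=> KV h; apply/(law_gamma_dd _ _ KV).
have [_ T2 TE Ty TD] := gamma_dbody_Th dd KV (isT : 0 < 1).
exact: (Th_mu (a := 1) (b := 11) (c := 10) (d := 9) KV h TD T2 Ty (TE 1 isT) (TE 0 isT)).
Qed.

(* A closed graph [G] that contains [v] but misses a consequence [m] of [v] is
   contradictory: folding [G] onto the body of an identity, or of the first
   gamma beyond the threshold, makes that identity a law of [K]. *)
Section Reduction.
Variables (K : set algebra) (v : term) (m : mono) (G : set mono).
Hypothesis KV : K `<=` V12.
Hypothesis Ggood : good G.
Hypothesis vG : forall n, n \in monos v -> G n.
Hypothesis vm : Th K v m.
Hypothesis nGm : ~ G m.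
Hypothesis Gedge : exists x y, adj G x y.
Hypothesis law_closed : forall f, has_law K (identity_of f) -> closed1 G f.

Variables (dd : bool) (kk : threshold).
Hypothesis ddE : dd <-> hasD G.
Hypothesis gammaE : forall n, 0 < n -> has_law K (gamma_dd dd n) <-> nat_le_thr n kk.
Hypothesis rule2 : forall x x' y, marked G x -> marked G x' ->
  within_dist G kk x x' -> adj G x' y -> adj G x y.

Local Notation adj := (adj G).
Local Notation walk := (walk G).
Local Notation marked := (marked G).
Local Notation conn := (conn G).

(** Nothing is asked at isolated vertices, which [fold_gen] sends to monomials of degree two. *)
Definition fold_hom (T : term) (f : nat -> nat) :=
  (forall x y, adj x y -> Th K T (mk_mono [:: f x; f y])) /\
  (forall x, marked x -> Th K T [:: f x]).

(** A marked isolated variable may go to the image of any edge, which lies in [Th K T]. An unmarked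
    one does not occur in [v], so it may even go to a square. *)
Let fold_gen T f : fold_hom T f ->
  exists g, [/\ forall x, g x <> [::],
    forall n, n \in monos v -> Th K T (bsub g n),
    forall x, ~ isolated G x -> g x = [:: f x]
  & forall x, isolated G x -> ~ G [:: x] \/ 1 < size m -> 1 < size (g x) /\
      (G [:: x] \/ g x = [:: 0; 0])].
Proof.
move=> [h1 h2].
have [x0 [y0 xy0]] := Gedge.
pose g x : mono := if `[< isolated G x >] then
  (if `[< G [:: x] >] then mk_mono [:: f x0; f y0] else [:: 0; 0]) else [:: f x].
exists g; split.
- move=> x; rewrite /g; case: asboolP => // _; case: asboolP => // _.
  by move/(congr1 size); rewrite size_mk_mono.
- move=> n ni; have Gn := vG ni; have := good_size Ggood Gn.
  have := mono_neq0 ni; have := monos_sorted ni.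
  case: n Gn {ni} => [|x [|y [|? ?]]] //= Gn sn _ _.
    rewrite /bsub /= cats0 /g (asboolT Gn); case: asboolP => [_|nx].
      by rewrite mk_mono_id ?mk_mono_sorted //; exact: h1.
    by apply: h2; split=> //; apply: contrapT.
  have xy : adj x y by apply: (good_edge Ggood); rewrite mk_mono_id.
  rewrite /bsub /= /g !asboolF; first exact: h1.
    by apply; exists x; rewrite adj_sym.
  by apply; exists y.
- by move=> x nx; rewrite /g asboolF.
- move=> x ix _; rewrite /g (asboolT ix); case: asboolP => Gx.
    by rewrite size_mk_mono; split=> //; left.
  by split=> //; right.
Qed.

Let fold_Th T f : fold_hom T f -> (forall x, x \in m -> ~ isolated G x) ->
  Th K T (map_mono f m).
Proof.
move=> hf hm; have [g [g0 gT gE _]] := fold_gen hf.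
have -> : map_mono f m = bsub g m.
  rewrite /map_mono /bsub; congr mk_mono.
  elim: (m) hm => //= x n IH hn; rewrite gE ?IH //.
    by move=> y yn; apply: hn; rewrite inE yn orbT.
  by apply: hn; exact: mem_head.
exact: Th_bsub gT vm.
Qed.

(** An isolated variable of [m] turns its image into a square or a monomial of degree at least
    three. *)
Let fold_zer T f : fold_hom T f -> (exists2 x, x \in m & isolated G x) ->
  zer K T.
Proof.
move=> hf [x xm ix]; have [g [g0 gT _ gi]] := fold_gen hf.
have := Th_bsub KV g0 gT vm.
have [s1|s1] := leqP (size m) 1.
  have mx : m = [:: x].
    by case: (m) xm s1 => [|a [|b n]] //; rewrite inE => /eqP->.
  have nx : ~ G [:: x] by rewrite -mx.
  have [_ []//] := gi x ix (or_introl nx).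
  by rewrite mx /bsub /= cats0 => ->; apply: Th_square.
move=> /(Th_size KV); apply.
have [gx _] := gi x ix (or_intror s1).
have := size_flatten_mem g0 xm; rewrite size_mk_mono.
by move: s1 gx; move: (size m) (size (g x)) (size _) => a b c; lia.
Qed.

Let law_intro f q n : law_of f = Below q (body f) -> monos q = [:: n] ->
  Th K (body f) n -> has_law K (identity_of f).
Proof.
rewrite /identity_of => -> qn h; apply/(Th_preceq KV) => k.
by rewrite qn inE => /eqP->.
Qed.

Let law_zer f : law_of f = SquareEq (body f) -> zer K (body f) ->
  has_law K (identity_of f).
Proof. by rewrite /identity_of => -> /(zer_square KV). Qed.

Let TM T n : n \in monos T -> Th K T n.
Proof. exact: Th_monos. Qed.

Let hom_half T c f : coloring G c ->
  (forall x y, adj x y -> c x -> ~~ c y -> Th K T (mk_mono [:: f x; f y])) ->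
  (forall x, marked x -> Th K T [:: f x]) -> fold_hom T f.
Proof.
move=> pc he hm; split=> // x y xy; have [cx|cx] := boolP (c x).
  by apply: he; rewrite // (pc _ _ xy) cx.
by rewrite mk_monoC; apply: he; rewrite // 1?adj_sym // (pc _ _ xy).
Qed.

Let coloring_eq s b : coloring G s -> coloring G (fun x => s x == b).
Proof. by move=> ps x y /ps ->; case: (s x); case: b. Qed.

Let hom_color T s a b : coloring G s ->
  Th K T (mk_mono [:: a; b]) ->
  (forall x, marked x -> Th K T [:: if s x then a else b]) ->
  fold_hom T (fun x => if s x then a else b).
Proof.
move=> ps hab hm; split=> // x y xy; rewrite (ps _ _ xy).
by case: (s x) => //=; rewrite mk_monoC.
Qed.

(* If [m] folds to [0] under a two-colouring then [chi], [sq] or [xi] holds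
   in K, according to the marks of [G]. *)
Let zero_contra c : coloring G c -> (~ hasD G -> forall x, marked x -> c x) ->
  [\/ exists2 x, x \in m & isolated G x, 2 < size m
    | exists x y, m = mk_mono [:: x; y] /\ c x = c y] -> False.
Proof.
move=> pc mc hm.
have key T : fold_hom T (fun x => if c x then 0 else 1) -> zer K T.
  move=> hT; have [h|h] := pselect (exists2 x, x \in m & isolated G x).
    exact: fold_zer hT h.
  have {}h x : x \in m -> ~ isolated G x by move=> xm ix; apply: h; exists x.
  case: hm => [[x xm]|sm|[x [y [mE cxy]]]]; first by move/h.
    by have /(Th_size KV) := fold_Th hT h; apply; rewrite /map_mono size_mk_mono size_map.
  have := fold_Th hT h; rewrite mE map_mono2 cxy mk_mono2 leqnn.
  exact: Th_square.
have [hd|nd] := pselect (hasD G).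
  apply: (close_xi Ggood hd); apply: law_closed; apply: law_zer => //.
  apply/key/hom_color => //; first exact: TM.
  by move=> x _; case: ifP => _; exact: TM.
have [[x mx]|nm] := pselect (exists x, marked x).
  apply: (close_sq mx); apply: law_closed; apply: law_zer => //.
  apply/key/hom_color => //; first exact: TM.
  by move=> y my; rewrite mc //; exact: TM.
have [x [y xy]] := Gedge.
apply: (close_chi xy); apply: law_closed; apply: law_zer => //.
apply/key/hom_color => //; first exact: TM.
by move=> z mz; case: nm; exists z.
Qed.

(* With a D-component around, the components other than that of [x0] are sent to
   the summand D(t,u) of the body. *)
Let wrap (s : nat -> bool) x0 (f : nat -> nat) x :=
  if dd && ~~ `[< conn x0 x >] then (if s x then 3 else 4) else f x.

Let wrap_own s x0 f x : conn x0 x -> wrap s x0 f x = f x.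
Proof. by move=> c; rewrite /wrap (asboolT c) andbF. Qed.

Let hom_wrap T s x0 f : coloring G s ->
  (dd -> [/\ Th K T [:: 3], Th K T [:: 4] & Th K T [:: 3; 4]]) ->
  (forall x y, adj x y -> (dd -> conn x0 x /\ conn x0 y) -> s x -> ~~ s y ->
     Th K T (mk_mono [:: f x; f y])) ->
  (forall x, marked x -> (dd -> conn x0 x) -> Th K T [:: f x]) ->
  fold_hom T (wrap s x0 f).
Proof.
move=> ps hD he hm; split=> [x y xy|x mx]; last first.
  rewrite /wrap; case: ifP => [/andP[d _]|nd].
    by have [? ? _] := hD d; case: ifP.
  by apply: hm => // d; move: nd; rewrite d /= => /negbFE/asboolP.
wlog sx : x y xy / s x => [h|].
  have [sx|sx] := boolP (s x); first exact: h.
  by rewrite mk_monoC; apply: h; rewrite 1?adj_sym // (ps _ _ xy).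
have sy : ~~ s y by rewrite (ps _ _ xy) sx.
have E := asbool_conn x0 xy.
rewrite /wrap E; case: ifP => [/andP[d _]|nd].
  by have [_ _ ?] := hD d; rewrite sx (negPf sy).
apply: he => // d; move: nd; rewrite d /= => /negbFE/asboolP c; split=> //.
exact/(conn_adj x0 xy).
Qed.

Let hDdd : dd -> hasD G. Proof. by move/ddE. Qed.

(** A mark in a D-component makes [dd] true, and then it would lie in the component of [x0], which
    is not one. *)
Let own_marks s x0 : (forall x, marked x -> ~ Dcomp G x -> s x) ->
  ~ Dcomp G x0 -> forall x, marked x -> (dd -> conn x0 x) -> s x.
Proof.
move=> ms nD x mx c; apply: ms => // Dx.
have d : dd by apply/ddE; exact: Dcomp_hasD Dx.
by apply: nD; apply: Dcomp_conn (conn_sym (c d)) Dx.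
Qed.

(** The identity depends on the component of [z]: [lambda] for a D-component; [eta] or [omega], or
    their D-forms, if the marks are in the class of [z] or opposite to it; for an unmarked component
    [zeta_D], [zeta] or [rho], according as [G] has a D-component, has only other marks, or has
    none. *)
Let linear_contra z : m = [:: z] -> ~ isolated G z -> False.
Proof.
move=> mE nz; have nGz : ~ G [:: z] by rewrite -mE.
have nmz x : marked x -> (x == z) = false.
  by move=> mx; apply/eqP => xz; apply: nGz; rewrite -xz; exact: marked_mono.
have [s [ps ms]] := good_coloring Ggood.
have ft T f : fold_hom T f -> Th K T [:: f z].
  move=> hf; have := fold_Th hf; rewrite mE; apply.
  by move=> x; rewrite inE => /eqP->.
have [Dz|nDz] := pselect (Dcomp G z).
  apply: nGz; apply: lambda_full => //; apply: law_closed.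
  apply: law_intro => //=.
  pose f x := if x == z then 2 else if s x == s z then 1 else 0.
  have <- : f z = 2 by rewrite /f eqxx.
  apply: ft; apply: (hom_half (coloring_eq (s z) ps)) => [x y xy /eqP sx sy|x mx].
    rewrite /f sx eqxx (negPf sy); have -> : (y == z) = false.
      by apply/eqP => yz; rewrite yz eqxx in sy.
    by case: ifP => _; exact: TM.
  by rewrite /f nmz //; case: ifP => _; exact: TM.
have om := own_marks ms nDz.
have [[a [za ma]]|nma] := pselect (exists a, conn z a /\ marked a).
  have sa : s a by apply: om => // _.
  have [sz|sz] := boolP (s z).
    apply: nGz; apply: (@eta_full _ Ggood dd hDdd a); last first.
    - by apply/(coloring_same ps (conn_sym za)); rewrite sa sz.
    - exact: marked_mono ma.
    apply: law_closed; apply: (@law_intro _ (Var 2) [:: 2]) => //.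
      by case: (dd).
    pose f x := if x == z then 2 else if s x then 0 else 1.
    have <- : wrap s z f z = 2.
      by rewrite (wrap_own _ _ (conn_refl _ _)) /f eqxx.
    apply/ft/hom_wrap => //.
    - by case: (dd) => // _; split; exact: TM.
    - move=> x y xy _ sx sy; rewrite /f sx (negPf sy).
      have -> : (y == z) = false by apply/eqP => yz; rewrite yz sz in sy.
      by case: ifP => _; case: (dd); exact: TM.
    - by move=> x mx c; rewrite /f nmz // om //; case: (dd); exact: TM.
  apply: nGz; apply: (@omega_full _ Ggood dd hDdd a); last exact: conn_sym.
    apply: law_closed; apply: (@law_intro _ (Var 1) [:: 1]) => //.
      by case: (dd).
    pose f x := if s x then 0 else 1.
    have <- : wrap s z f z = 1.
      by rewrite (wrap_own _ _ (conn_refl _ _)) /f (negPf sz).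
    apply/ft/hom_wrap => //.
    - by case: (dd) => // _; split; exact: TM.
    - by move=> x y xy _ sx sy; rewrite /f sx (negPf sy); case: (dd); exact: TM.
    - by move=> x mx c; rewrite /f om //; case: (dd); exact: TM.
  exact: marked_mono ma.
have [t zt] : exists t, adj z t by apply: contrapT.
pose f x := if `[< conn z x >] then (if s x == s z then 2 else 3) else
  if s x then 0 else 1.
have fz : f z = 2 by rewrite /f (asboolT (conn_refl _ _)) eqxx.
have fhom T : Th K T [:: 2; 3] -> Th K T [:: 0; 1] ->
    (forall x, marked x -> Th K T [:: if s x then 0 else 1]) -> Th K T [:: 2].
  move=> h23 h01 hmk; rewrite -fz; apply: ft; split=> [x y xy|x mx]; last first.
    by rewrite /f asboolF; [exact: hmk|move=> zx; apply: nma; exists x].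
  have E := asbool_conn z xy.
  rewrite /f E (ps _ _ xy); case: ifP => _; last first.
    by case: (s x) => //=; rewrite mk_monoC.
  by case: (s x); case: (s z) => //=; rewrite mk_monoC.
have [hd|nd] := pselect (hasD G).
  apply: nGz; apply: (close_zeta_D Ggood hd) zt; apply: law_closed.
  apply: law_intro => //; apply: fhom; try exact: TM.
  by move=> x _; case: ifP => _; exact: TM.
have ms' x : marked x -> s x by move=> mx; apply: ms => // /Dcomp_hasD.
have [[a ma]|nm] := pselect (exists a, marked a).
  have [Ga [b ab]] := ma.
  apply: nGz; apply: close_zeta Ga ab zt; apply: law_closed.
  apply: law_intro => //; apply: fhom; try exact: TM.
  by move=> x mx; rewrite ms' //; exact: TM.
apply: nGz; apply: close_rho zt; apply: law_closed.
apply: (@law_intro _ (Var 0) [:: 0]) => //.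
have <- : (if s z == s z then 0 else 1) = 0 by rewrite eqxx.
apply: (ft _ (fun x => if s x == s z then 0 else 1)).
split=> [x y xy|x mx]; last by case: nm; exists x.
by rewrite (ps _ _ xy); case: (s x); case: (s z); exact: TM.
Qed.

(** The components can be recoloured independently. If a colouring compatible with the marks gives
    [x] and [z] the same colour, [zero_contra] applies. Otherwise there is no D-component and both
    components are marked; then [beta] is a law and would connect them. *)
Let cross_contra x z : m = mk_mono [:: x; z] -> ~ isolated G x ->
  ~ isolated G z -> ~ conn x z -> False.
Proof.
move=> mE nx nz nxz; have [s [ps ms]] := good_coloring Ggood.
pose t x y := if `[< conn x y >] then ~~ s y else s y.
have pt u : coloring G (t u) by apply: coloring_flip.
have tx : t x x = ~~ s x by rewrite /t (asboolT (conn_refl _ _)).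
have tz : t x z = s z by rewrite /t asboolF.
have [hd|nd] := pselect (hasD G).
  have [sxz|sxz] := eqVneq (s x) (s z).
    by apply: (zero_contra ps) => //; constructor 3; exists x, z.
  apply: (zero_contra (pt x)) => //; constructor 3; exists x, z; split=> //.
  by rewrite tx tz; move: sxz; case: (s x); case: (s z).
have {}ms u : marked u -> s u by move=> mu; apply: ms => // /Dcomp_hasD.
have [sxz|sxz] := eqVneq (s x) (s z).
  by apply: (zero_contra ps) => //; constructor 3; exists x, z.
have [[a [xa ma]]|nma] := pselect (exists a, conn x a /\ marked a); last first.
  apply: (zero_contra (pt x)) => [_ y my|].
    by rewrite /t asboolF ?ms // => xy; apply: nma; exists y.
  constructor 3; exists x, z; split=> //.
  by rewrite tx tz; move: sxz; case: (s x); case: (s z).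
have [[b [zb mb]]|nmb] := pselect (exists b, conn z b /\ marked b); last first.
  apply: (zero_contra (pt z)) => [_ y my|].
    by rewrite /t asboolF ?ms // => xy; apply: nmb; exists y.
  constructor 3; exists x, z; split=> //.
  rewrite /t (asboolT (conn_refl _ _)) asboolF => [|/conn_sym//].
  by move: sxz; case: (s x); case: (s z).
have bad : closed1 G beta -> False.
  move=> h; apply: nxz; have [Ga [c ac]] := ma; have [Gb [d bd]] := mb.
  apply: (conn_trans (conn_trans xa (adj_conn (close_beta Ggood h Ga Gb ac bd)))).
  by apply: conn_sym; apply: (conn_trans zb); exact: adj_conn.
apply: bad; apply: law_closed; apply: (@law_intro _ (Var 0 * Var 2)%term [:: 0; 2]) => //.
wlog sx : x z mE nx nz nxz sxz {t pt tx tz xa zb} / s x => [h|].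
  have [sx|sx] := boolP (s x); first exact: (h x z).
  apply: (h z x) => //; first by rewrite mE mk_monoC.
  - by move/conn_sym.
  - by rewrite eq_sym.
  - by move: sxz sx; case: (s x); case: (s z).
have sz : s z = false by move: sxz; rewrite sx; case: (s z).
pose f y := if `[< conn x y >] then (if s y then 0 else 1) else
  if s y then 3 else 2.
have fx : f x = 0 by rewrite /f (asboolT (conn_refl _ _)) sx.
have fz : f z = 2 by rewrite /f asboolF // sz.
have -> : [:: 0; 2] = map_mono f m by rewrite mE map_mono2 fx fz.
apply: fold_Th; last first.
  by move=> y; rewrite mE mem_sort !inE => /orP[/eqP->|/eqP->].
apply: (hom_half ps) => [u w uw su sw|u mu].
  have E := asbool_conn x uw.
  by rewrite /f E su (negPf sw); case: ifP => _; exact: TM.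
by rewrite /f ms //; case: ifP => _; exact: TM.
Qed.

(** * A missing edge between opposite classes of one component *)

Section Edge.
Variables (x z : nat) (s : nat -> bool).
Hypothesis mE : m = mk_mono [:: x; z].
Hypothesis ps : coloring G s.
Hypothesis ms : forall u, marked u -> ~ Dcomp G u -> s u.
Hypothesis xz : conn x z.
Hypothesis sx : s x.
Hypothesis sz : s z = false.

Let nadj : ~ adj x z.
Proof. by move/adj_mono; rewrite -mE. Qed.

Let nadjC : adj z x = false.
Proof. by rewrite adj_sym; exact/negbTE/negP. Qed.

Let x_n_z : (x == z) = false.
Proof. by apply/eqP => e; move: sz; rewrite -e sx. Qed.

Let nbr_x_neq u w : adj u w -> u = x -> (w == z) = false.
Proof. by move=> uw ux; apply/eqP => wz; apply: nadj; rewrite -ux -wz. Qed.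

Let nonisolated u : u \in m -> ~ isolated G u.
Proof.
have nx : ~ isolated G x.
  case: xz => -[/walk0 e|n /walkS[y xy _]]; last by apply; exists y.
  by move: x_n_z; rewrite e eqxx.
have nz : ~ isolated G z.
  case: (conn_sym xz) => -[/walk0 e|n /walkS[y zy _]]; last by apply; exists y.
  by move: x_n_z; rewrite e eqxx.
by rewrite mE mem_sort !inE => /orP[/eqP->|/eqP->].
Qed.

Let fold_edge T f a b : fold_hom T f -> f x = a -> f z = b ->
  Th K T (mk_mono [:: a; b]).
Proof.
by move=> hf <- <-; rewrite -map_mono2 -mE; apply: fold_Th => // u; exact: nonisolated.
Qed.

Let opp_xz : opposite_class G x z.
Proof. by apply/(coloring_opp ps xz); rewrite sx sz. Qed.

Let s_false u : ~~ s u -> (u == x) = false.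
Proof. by move=> su; apply/eqP => e; move: su; rewrite e sx. Qed.

Let s_true u : s u -> (u == z) = false.
Proof. by move=> su; apply/eqP => e; move: su; rewrite e sz. Qed.

(** The law is [delta], [nu] or [nu_D], according as [G] has no marks, marks but no D-component, or
    a D-component; each joins all opposite vertices of the component. *)
Let unmarked_contra : (forall a, conn x a -> ~ marked a) -> False.
Proof.
move=> nma.
(* The component folds onto the path a, b, c, d with [x] at a and [z] at d; no edge lands on ad
   because [x] and [z] are not adjacent. *)
pose g u := if u == x then 5 else if u == z then 8 else if s u then 7 else 6.
have gx : g x = 5 by rewrite /g eqxx.
have gz : g z = 8 by rewrite /g eq_sym x_n_z eqxx.
have ghom T u w : Th K T [:: 5; 6] -> Th K T [:: 6; 7] -> Th K T [:: 7; 8] ->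
    adj u w -> s u -> ~~ s w -> Th K T (mk_mono [:: g u; g w]).
  move=> h1 h2 h3 uw su sw; rewrite /g (s_false sw) (s_true su) su (negPf sw).
  have [ux|_] := eqVneq u x; last by case: ifP.
  by rewrite (nbr_x_neq uw ux).
have [[a ma]|nm] := pselect (exists a, marked a); last first.
  apply: nadj; apply: (shorten_all _ opp_xz) => a b c d; apply: (close_delta Ggood).
  apply: law_closed; apply: law_intro => //.
  apply: (@fold_edge _ g 5 8) => //; apply: (hom_half ps) => [u w uw su sw|u mu].
    by apply: ghom => //; exact: TM.
  by case: nm; exists u.
pose f u := if `[< conn x u >] then g u else if s u then 3 else 4.
have fx : f x = 5 by rewrite /f (asboolT (conn_refl _ _)).
have fz : f z = 8 by rewrite /f (asboolT xz).
have fhom T : Th K T [:: 5; 6] -> Th K T [:: 6; 7] -> Th K T [:: 7; 8] ->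
    Th K T [:: 3; 4] -> (forall u, marked u -> Th K T [:: if s u then 3 else 4]) ->
    fold_hom T f.
  move=> h1 h2 h3 h4 hmk; apply: (hom_half ps) => [u w uw su sw|u mu]; last first.
    by rewrite /f asboolF; [exact: hmk|move/nma; apply].
  have E := asbool_conn x uw.
  rewrite /f E; case: ifP => _; first exact: ghom.
  by rewrite su (negPf sw).
have [hd|nd] := pselect (hasD G).
  apply: nadj; apply: (shorten_all _ opp_xz) => b c d e; apply: (close_nu_D Ggood hd).
  apply: law_closed; apply: law_intro => //.
  apply: (fold_edge (fhom _ _ _ _ _ _)) => //; try exact: TM.
  by move=> u _; case: ifP => _; exact: TM.
have [Ga [b ab]] := ma.
apply: nadj; apply: (shorten_all _ opp_xz) => c d e f'; apply: (close_nu Ggood _ Ga ab).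
apply: law_closed; apply: law_intro => //.
apply: (fold_edge (fhom _ _ _ _ _ _)) => //; try exact: TM.
by move=> u mu; rewrite ms; [exact: TM|exact: mu|move/Dcomp_hasD].
Qed.

(** Put [y] at d, its neighbours at c and the rest at a and b. No mark lands on c or d, so [kappa]
    is a law; applied from a marked edge it gives [y] a marked neighbour. *)
Let kappa_contra y y' c : m = mk_mono [:: y; y'] -> coloring G c -> c y -> ~~ c y' ->
  Dcomp G y -> ~ marked y -> (forall w, adj y w -> ~ marked w) -> False.
Proof.
move=> mE' pc cy cy' Dy ny nw.
have nyy' : ~ adj y y' by move/adj_mono; rewrite -mE'.
have hk : closed1 G kappa.
  apply: law_closed; apply: (@law_intro _ (Var 5 * Var 8)%term [:: 5; 8]) => //.
  pose f u := if c u then (if u == y then 8 else 6) else (if adj y u then 7 else 5).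
  have -> : [:: 5; 8] = map_mono f m.
    by rewrite mE' map_mono2 /f cy eqxx (negPf cy'); case: ifP.
  apply: fold_Th; last exact: nonisolated.
  apply: (hom_half pc) => [u w uw cu cw|u mu].
    rewrite /f cu (negPf cw); have [uy|_] := eqVneq u y.
      by rewrite -uy uw; exact: TM.
    by case: ifP => _; exact: TM.
  have -> : [:: f u] = if c u then [:: 6] else [:: 5].
    rewrite /f; case: ifP => _.
      by have [uy|//] := eqVneq u y; case: ny; rewrite -uy.
    by case: ifP => // yu; case: (nw u).
  by case: ifP => _; exact: TM.
have [a [b [ya ma mb ab _]]] := Dcomp_adj Ggood pc Dy.
have := kappa_full Ggood hk pc (marked_mono ma) (marked_mono mb) ab (conn_sym ya).
by case: ifP => _ h; [apply: (nw b)|apply: (nw a)]; rewrite // adj_sym.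
Qed.

(** Folding with [y'] alone at d keeps the marks on a, b, c, so [epsilon] is a law. The environment
    rule yields a path y, b, k, y' whose first three vertices are marked. *)
Let epsilon_contra y y' c : m = mk_mono [:: y; y'] -> coloring G c -> c y ->
  ~~ c y' -> conn y y' -> Dcomp G y -> marked y -> ~ marked y' ->
  (exists2 k, adj y' k & marked k) -> False.
Proof.
move=> mE' pc cy cy' yy' Dy my ny' [k yk mk].
have ck : c k by rewrite (pc _ _ yk).
have nyy' : ~ adj y y' by move/adj_mono; rewrite -mE'.
have [a [b [ya _ mb ab [_ cb]]]] := Dcomp_adj Ggood pc Dy.
have yb := conn_trans ya (adj_conn ab); have yk' := conn_trans yy' (adj_conn yk).
have by_ : adj y b by apply: (good_env_coloring Ggood pc) => //; rewrite cy (negPf cb).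
have bk : adj b k.
  apply: (good_env_coloring Ggood pc) => //; last by rewrite ck (negPf cb).
  exact: conn_trans (conn_sym yb) yk'.
rewrite adj_sym in yk; apply/nyy'.
apply: close_epsilon (marked_mono my) (marked_mono mb) (marked_mono mk) by_ bk yk => //.
apply: law_closed; apply: (@law_intro _ (Var 5 * Var 8)%term [:: 5; 8]) => //.
pose f u := if c u then (if u == y then 5 else 7) else (if u == y' then 8 else 6).
have -> : [:: 5; 8] = map_mono f m.
  by rewrite mE' map_mono2 /f cy (negPf cy') !eqxx.
apply: fold_Th; last exact: nonisolated.
apply: (hom_half pc) => [u w uw cu cw|u mu]; rewrite /f.
  rewrite cu (negPf cw); have [uy|_] := eqVneq u y; last by case: ifP => _; exact: TM.
  have -> : (w == y') = false by apply/eqP => wy; apply: nyy'; rewrite -uy -wy.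
  exact: TM.
case: ifP => cu; case: ifP => [/eqP e|_]; try exact: TM.
by case: ny'; rewrite -e.
Qed.

(** An unmarked end has a marked neighbour by [kappa_contra]. Two marked ends are adjacent by the
    environment rule, one marked end is settled by [epsilon], and if neither is marked, their marked
    neighbours are adjacent and form the middle of a path for [mu2]. *)
Let D_contra : Dcomp G x -> False.
Proof.
move=> Dx; have Dz := Dcomp_conn xz Dx.
have mE' : m = mk_mono [:: z; x] by rewrite mE mk_monoC.
have nps : coloring G (fun u => ~~ s u) by move=> u w /ps ->.
have nbr y y' c : m = mk_mono [:: y; y'] -> coloring G c -> c y -> ~~ c y' ->
    Dcomp G y -> ~ marked y -> exists2 w, adj y w & marked w.
  move=> e pc cy cy' Dy ny; apply: contrapT => h.
  by apply: (kappa_contra e pc cy cy' Dy ny) => w yw mw; apply: h; exists w.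
have nbr_x := nbr x z s mE ps sx (negbT sz) Dx.
have nsx : ~~ ~~ s x by rewrite sx.
have nbr_z := nbr z x _ mE' nps (negbT sz) nsx Dz.
have [mx|nmx] := pselect (marked x); have [mz|nmz] := pselect (marked z).
- by apply: nadj; apply: (good_env_coloring Ggood ps) => //; rewrite sx sz.
- exact: (epsilon_contra mE ps sx (negbT sz) xz Dx mx nmz (nbr_z nmz)).
- exact: (epsilon_contra mE' nps (negbT sz) nsx (conn_sym xz) Dz mz nmx (nbr_x nmx)).
- have [b xb mb] := nbr_x nmx; have [c zc mc] := nbr_z nmz.
  have sb : ~~ s b by rewrite (ps xb) sx.
  have sc : s c by rewrite (ps zc) sz.
  have bc : adj b c.
    apply: (good_env_coloring Ggood ps) => //; last by rewrite sc (negPf sb).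
    exact: conn_trans (conn_sym (adj_conn xb)) (conn_trans xz (adj_conn zc)).
  rewrite adj_sym in zc; apply: nadj.
  apply: close_mu2 (marked_mono mb) (marked_mono mc) xb bc zc => //.
  apply: law_closed; apply: law_intro => //.
  pose f u := if s u then (if u == x then 5 else 7) else (if u == z then 8 else 6).
  apply: (@fold_edge _ f 5 8); [|by rewrite /f sx eqxx|by rewrite /f sz eqxx].
  apply: (hom_half ps) => [u w uw su sw|u mu]; rewrite /f.
    rewrite su (negPf sw); have [ux|_] := eqVneq u x; last by case: ifP => _; exact: TM.
    by rewrite (nbr_x_neq uw ux); exact: TM.
  case: ifP => su; case: ifP => [/eqP e|_]; try exact: TM.
    by case: nmx; rewrite -e.
  by case: nmz; rewrite -e.
Qed.

Let nonD_marks u : ~ Dcomp G x -> marked u -> (dd -> conn x u) -> s u.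
Proof. by move=> nD; exact: own_marks ms nD u. Qed.

Let fold_wrap T f a b : fold_hom T (wrap s x f) -> f x = a -> f z = b ->
  Th K T (mk_mono [:: a; b]).
Proof.
move=> hf fx fz; apply: (fold_edge hf); rewrite wrap_own //.
exact: conn_refl.
Qed.

(** All marks lie in the class of [x] and none is a neighbour of [z]. With N(z) at c they all fold
    to a, so [alpha] or [alpha_D] is a law and makes a mark adjacent to [z]. *)
Let alpha_contra : ~ Dcomp G x -> (exists2 a, conn x a & marked a) ->
  (forall a, adj z a -> ~ marked a) -> False.
Proof.
move=> nD [a0 xa0 ma0] na; apply: (na a0) => //; rewrite adj_sym.
have sa0 : s a0 by exact: nonD_marks.
apply: (@alpha_full _ Ggood dd hDdd); last first.
- apply/(coloring_opp ps (conn_trans (conn_sym xa0) xz)).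
  by rewrite sa0 sz.
- exact: marked_mono.
apply: law_closed; apply: (@law_intro _ (Var 5 * Var 8)%term [:: 5; 8]) => //.
  by case: (dd).
pose f u := if s u then (if adj z u then 7 else 5) else (if u == z then 8 else 6).
apply: (@fold_wrap _ f 5 8); [|by rewrite /f sx nadjC|by rewrite /f sz eqxx].
apply: hom_wrap => //.
- by case: (dd) => // _; split; exact: TM.
- move=> u w uw _ su sw; rewrite /f su (negPf sw); have [wz|_] := eqVneq w z.
    by rewrite -wz adj_sym uw; case: (dd); exact: TM.
  by case: ifP => _; case: (dd); exact: TM.
- move=> u mu cu; rewrite /f nonD_marks //; case: ifP => [/na//|_].
  by case: (dd); exact: TM.
Qed.

(** With [x] alone at d and [z] alone at a, the marks all fold to b. *)
Let mu_law : ~ Dcomp G x -> ~ marked x -> has_law K (identity_of (dlaw mu mu_D dd)).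
Proof.
move=> nD nmx; apply: (@law_intro _ (Var 5 * Var 8)%term [:: 5; 8]) => //.
  by case: (dd).
pose f u := if s u then (if u == x then 8 else 6) else (if u == z then 5 else 7).
apply: (@fold_wrap _ f 8 5); [|by rewrite /f sx eqxx|by rewrite /f sz eqxx].
apply: hom_wrap => //.
- by case: (dd) => // _; split; exact: TM.
- move=> u w uw _ su sw; rewrite /f su (negPf sw); have [ux|_] := eqVneq u x.
    rewrite (nbr_x_neq uw ux).
    by case: (dd); exact: TM.
  by case: ifP => _; case: (dd); exact: TM.
- move=> u mu cu; rewrite /f nonD_marks //; case: eqVneq => [ux|_].
    by case: nmx; rewrite -ux.
  by case: (dd); exact: TM.
Qed.

Let mu_apart a : ~ Dcomp G x -> marked a -> adj z a -> ~ marked x ->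
  ~ exists w, adj a w /\ adj w x.
Proof.
move=> nD ma za nmx [w [aw wx]]; apply: nadj; rewrite adj_sym.
apply: (@close_mu _ Ggood dd hDdd z a w x) => //; last exact: marked_mono.
by apply: law_closed; exact: mu_law.
Qed.

(** All marks are adjacent to [z], hence by [mu_apart] not at distance two from [x], so they fold to
    x_1. This gives [iota2] or its D-form, which joins [z] to the whole class of its marked
    neighbour. *)
Let iota_contra : ~ Dcomp G x -> ~ marked x -> (exists2 a, adj z a & marked a) ->
  (forall a, conn x a -> marked a -> adj z a) -> False.
Proof.
move=> nD nmx [a1 za1 ma1] hall; have xa1 : conn x a1 by apply: conn_trans xz (adj_conn za1).
have sa1 : s a1 by exact: nonD_marks.
apply: nadj; rewrite adj_sym; apply: (@iota_full _ Ggood dd hDdd z a1 x); last first.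
- by apply/(coloring_same ps (conn_sym xa1)); rewrite sx sa1.
- by rewrite adj_sym.
- exact: marked_mono.
apply: law_closed; apply: (@law_intro _ (xs 0 * xs 5)%term [:: 9; 14]) => //.
  by case: (dd).
set T := body _.
(* An edge from [z] to a vertex at distance two from [x] folds to x_0 x_3. This is not a summand of
   the body, but it follows from the body by the law [mu] or [mu_D]. *)
have T03 : Th K T (mk_mono [:: 12; 9]).
  rewrite mk_monoC; apply: (Th_mu (b := 10) (c := 11) KV (mu_law nD nmx));
    by rewrite /T; case: (dd) => // *; do ?[exact: TM|split].
pose NN u := `[< exists w, adj u w /\ adj w x >].
pose f u := if s u then (if u == x then 14 else if NN u then 12 else 10)
  else (if u == z then 9 else if adj x u then 13 else 11).
apply: (@fold_wrap _ f 14 9); [|by rewrite /f sx eqxx|by rewrite /f sz eqxx].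
apply: hom_wrap => //.
- by rewrite /T; case: (dd) => // _; split; exact: TM.
- move=> u w uw _ su sw; rewrite /f su (negPf sw).
  have Tin k : (forall b, k \in monos (body (dlaw iota2 iota2_D b))) -> Th K T k.
    by move=> h; exact: TM (h dd).
  have [ux|_] := eqVneq u x.
    rewrite (nbr_x_neq uw ux).
    by rewrite -ux uw; apply: Tin => -[].
  case: ifP => [_|/asboolP nn].
    by case: ifP => // _; case: ifP => _; apply: Tin => -[].
  have -> : adj x w = false.
    by apply/negP => xw; apply: nn; exists w; rewrite (adj_sym _ w).
  by case: ifP => _; apply: Tin => -[].
- move=> u mu cu; rewrite /f nonD_marks //; case: eqVneq => [ux|_].
    by case: nmx; rewrite -ux.
  have -> : NN u = false.
    apply/asboolP => -[w [uw wx]].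
    have xu : conn x u by apply: conn_sym; apply: conn_trans (adj_conn uw) (adj_conn wx).
    by apply: (mu_apart nD mu (hall u xu mu) nmx); exists w.
  by rewrite /T; case: (dd); exact: TM.
Qed.

(* The marks missing from N(z) are far from those in N(z), so folding G along
   the distance to the latter gives [gamma_(P+1)], where P is the threshold. *)
Let gamma_contra : ~ Dcomp G x -> (exists2 a, adj z a & marked a) ->
  (exists a, [/\ conn x a, marked a & ~ adj z a]) -> False.
Proof.
move=> nD [a1 za1 ma1] [a0 [xa0 ma0 nza0]].
have sM u : conn x u -> marked u -> s u by move=> xu mu; exact: nonD_marks.
have xa1 : conn x a1 by apply: conn_trans xz (adj_conn za1).
have twin u a : conn x u -> marked u -> adj z a -> marked a ->
    (if kk is Some P then exists2 d, d <= 2 * P & walk d u a else True) -> adj z u.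
  move=> xu mu za ma hk; rewrite adj_sym; apply: (rule2 mu ma); last by rewrite adj_sym.
  have xa : conn x a by apply: conn_trans xz (adj_conn za).
  split=> //; apply/(coloring_same ps (conn_trans (conn_sym xu) xa)).
  by rewrite !sM.
case Ek : kk => [P|]; last by apply: nza0; apply: (twin a0 a1); rewrite ?Ek.
have gle n : 0 < n -> has_law K (gamma_dd dd n) <-> n <= P.
  by move=> n0; rewrite gammaE // Ek.
have nmxP : ~ marked x -> 0 < P.
  by move=> nmx; apply/gle => //; apply/(mu_gamma KV)/mu_law.
(* Threshold 0: with N(z) at x_2, the rest of the class of [x] at x_0 and [z] at y, the missing edge
   lands on the query of gamma_1. *)
have [P0|P0] := posnP P.
  have mx : marked x by apply: contrapT => /nmxP; rewrite P0.
  have : has_law K (gamma_dd dd 1); last by rewrite gle // P0.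
  apply/(law_gamma_dd _ _ KV).
  pose f u := if s u then (if adj z u then 11 else 9) else (if u == z then 1 else 10).
  apply: (@fold_wrap _ f 9 1); [|by rewrite /f sx nadjC|by rewrite /f sz eqxx].
  apply: hom_wrap => //.
  - by rewrite /gamma_dbody; case: (dd) => // _; split; exact: TM.
  - move=> u w uw _ su sw; rewrite /f su (negPf sw); have [wz|_] := eqVneq w z.
      by rewrite -wz adj_sym uw /gamma_dbody; case: (dd); exact: TM.
    by case: ifP => _; rewrite /gamma_dbody; case: (dd); exact: TM.
  - move=> u mu cu; rewrite /f nonD_marks //.
    by case: ifP => _; rewrite /gamma_dbody; case: (dd); exact: TM.
have [d dP] := distance_to G (fun a => marked a /\ adj z a).
have M1 u : conn x u -> exists2 a, marked a /\ adj z a & conn a u.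
  by move=> xu; exists a1 => //; apply: conn_trans (conn_sym xa1) xu.
have dle u n a : conn x u -> adj z a -> marked a -> walk n a u -> d u <= n.
  by move=> /M1/dP[_ h] za ma; apply: h.
have dex u : conn x u -> exists a, [/\ marked a, adj z a & walk (d u) a u].
  by move=> /M1/dP[[a [ma za] wa] _]; exists a.
have dpar u : conn x u -> s u = ~~ odd (d u).
  move=> xu; have [a [ma za wa]] := dex u xu.
  rewrite (coloring_walk ps wa) sM ?addbT //.
  exact: conn_trans xz (adj_conn za).
have dstep u w : conn x u -> conn x w -> adj u w -> d w <= (d u).+1.
  by move=> xu xw uw; have [a [ma za wa]] := dex u xu; apply: (dle w _ a) => //; exact: walk_rcons wa uw.
pose n := P.+1.
(* A mark at distance at most 2P from a marked neighbour of [z] would be a neighbour of [z] by rule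
   2, and the distance is even. *)
have far u : conn x u -> marked u -> ~~ adj z u -> 2 * n <= d u.
  move=> xu mu /negP nzu; rewrite leqNgt; apply/negP => dn; apply: nzu.
  have [a [ma za wa]] := dex u xu; apply: (twin u a) => //; rewrite Ek.
  exists (d u); last exact: walk_sym.
  have := dpar u xu; rewrite sM // => /esym; rewrite -dvdn2 => /dvdnP[i di].
  by move: dn; rewrite di mulnC ltn_mul2l /= ltnS leq_mul2l.
have dz : d z = 1.
  have : d z <= 1 by apply: (dle z _ a1) => //; apply/walk1; rewrite adj_sym.
  have := dpar z xz; rewrite sz.
  by case: (d z) => [|[|]].
(* If [x] is marked, it is far. If not, distance 0 would make it marked, and [mu_apart] excludes
   distance 2. *)
have dx4 : 4 <= d x.
  have cx := conn_refl G x; have [mx|nmx] := pselect (marked x).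
    apply: leq_trans (far x cx mx _); last by rewrite nadjC.
    by rewrite (leq_mul2l 2 2) /= ltnS.
  have := dpar x cx; rewrite sx.
  have [a [ma za]] := dex x cx; case: (d x) => [|[|[|[|]]]] //.
    by move/walk0 => ax; case: nmx; rewrite -ax.
  move=> /walkS[w aw /walk1 wx] _; case: (mu_apart nD ma za nmx).
  by exists w.
(* Marked neighbours of [z] have distance 0 and go to x_2n, [z] goes to x_(2n-1), and the far marks
   go to x_0. *)
pose lev u := level n (d u).
pose f u := 9 + (if `[< conn x u >] then lev u else if s u then 2 * n else (2 * n).-1).
set T := gamma_dbody dd n.
have n0 : 0 < n by [].
have [T0 T2n TE _ TD] := gamma_dbody_Th dd KV n0.
have TEl : Th K T (mk_mono [:: 9 + (2 * n).-1; 9 + 2 * n]).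
  by have := TE (2 * n).-1; rewrite prednK ?muln_gt0 //; apply; exact: leqnn.
have E : Th K T (mk_mono [:: 9 + lev x; 9 + (2 * n).-1]).
  apply: (@fold_wrap _ f).
  - apply: hom_wrap => //.
    + move=> u w uw _ su sw; rewrite /f (asbool_conn x uw).
      case: asboolP => [xu|_]; last first.
        by rewrite su (negPf sw) mk_monoC.
      have xw : conn x w by apply/(conn_adj x uw).
      have := dpar u xu; have := dpar w xw; rewrite su (negPf sw).
      have := dstep u w xu xw uw; have := dstep w u xw xu; rewrite adj_sym => /(_ uw).
      move=> h1 h2 ow ou.
      have [[lt e]|[lt e]] : lev u < 2 * n /\ lev w = (lev u).+1 \/
          lev w < 2 * n /\ lev u = (lev w).+1.
      * apply: level_step => //.
        by apply: negbFE; rewrite -ow.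
      * by rewrite e; apply: TE.
      * by rewrite e mk_monoC; apply: TE.
    + move=> u mu cu; rewrite /f; case: asboolP => [xu|_]; last by rewrite nonD_marks.
      rewrite /lev /level; have [zu|zu] := boolP (adj z u).
        have -> : d u = 0.
          by apply/eqP; rewrite -leqn0; apply: (dle u _ u) => //; exact/walk0.
        by rewrite subn0.
      have := far u xu mu zu; have := dpar u xu; rewrite sM // => /esym ou h2.
      by rewrite (eqP (_ : 2 * n - d u == 0)) ?subn_eq0 // (negPf ou) if_same addn0.
  - by rewrite /f (asboolT (conn_refl _ _)).
  - by rewrite /f (asboolT xz) /lev dz /level muln_gt0 /= subn1.
have [i [iE iP]] : exists i, lev x = 2 * i /\ i.+1 <= P.
  have ox : ~~ odd (d x) by rewrite -(dpar x (conn_refl _ _)).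
  have [i iE hi] := level_even n0 dx4 ox; exists i; split=> //.
  by case: hi => [|->//]; rewrite /n addn2 ltnS.
have : has_law K (gamma_dd dd n); last by rewrite gle // /n ltnn.
apply/(law_gamma_dd _ _ KV); rewrite -/T.
have [zT|nzT] := pselect (zer K T); first exact: zer_Th.
have [Tgood [m0 m2n walk_path y1 hD]] := gamma_path KV n0 nzT.
have Tadj a b : Th K T (mk_mono [:: a; b]) -> Defs.adj (Th K T) a b.
  exact: good_edge.
(* The image of the missing edge is a shortcut: x_0, ..., x_2i, x_(2n-1), x_2n. Its length 2(i+1) is
   at most 2P, so the law gamma_(i+1) of [K] yields the query of gamma_(P+1). *)
have W : Defs.walk (Th K T) (2 * i.+1) 9 (9 + 2 * n).
  have -> : 2 * i.+1 = (lev x).+2 by rewrite iE mulnS.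
  apply: walk_rcons.
    by apply: walk_rcons (Tadj _ _ E); apply: walk_path; rewrite iE leq_mul2l /n ltnW ?leqW.
  exact: Tadj.
have gi : has_law K (gamma_dd dd i.+1) by apply/gle.
apply: (adj_mono (x := 9) (y := 1)).
exact: (Th_gamma_dd KV _ gi Tgood hD m0 m2n W y1).
Qed.

Lemma edge_contra : False.
Proof.
have [Dx|nD] := pselect (Dcomp G x); first exact: D_contra.
have [[a [xa ma]]|nma] := pselect (exists a, conn x a /\ marked a); last first.
  by apply: unmarked_contra => a xa ma; apply: nma; exists a.
have [[a1 za1 ma1]|na] := pselect (exists2 a, adj z a & marked a); last first.
  apply: alpha_contra => //; first by exists a.
  by move=> b zb mb; apply: na; exists b.
have [h|h] := pselect (exists a, [/\ conn x a, marked a & ~ adj z a]).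
  by apply: gamma_contra => //; exists a1.
have hall b : conn x b -> marked b -> adj z b.
  by move=> xb mb; apply: contrapT => nb; apply: h; exists b.
apply: iota_contra => //; last by exists a1.
by move=> mx; move: (hall x (conn_refl _ _) mx); rewrite nadjC.
Qed.

End Edge.

Lemma reduction_contra : False.
Proof.
have [m0 sm _] := vm; have [s [ps ms]] := good_coloring Ggood.
have ms' : ~ hasD G -> forall u, marked u -> s u.
  by move=> nd u mu; apply: ms => // /Dcomp_hasD.
have [iso|niso] := pselect (exists2 u, u \in m & isolated G u).
  by apply: (zero_contra ps ms'); exact: Or31.
have {}niso u : u \in m -> ~ isolated G u by move=> um iu; apply: niso; exists u.
have [m3|m3] := leqP (size m) 2; last first.
  by apply: (zero_contra ps ms'); exact: Or32.
have : (exists z, m = [:: z]) \/ exists x y, m = mk_mono [:: x; y].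
  case: (m) m0 sm m3 => [|x [|y [|]]] //= _ sm _; first by left; exists x.
  by right; exists x, y; rewrite mk_mono_id.
case=> [[z mE]|[x [y mE]]].
  by apply: (linear_contra mE); apply: niso; rewrite mE mem_head.
have nx : ~ isolated G x by apply: niso; rewrite mE mem_sort mem_head.
have ny : ~ isolated G y by apply: niso; rewrite mE mem_sort !inE eqxx orbT.
have [xy|nxy] := pselect (conn x y); last exact: cross_contra mE nx ny nxy.
have [sxy|sxy] := eqVneq (s x) (s y).
  by apply: (zero_contra ps ms'); constructor 3; exists x, y.
have [sx|sx] := boolP (s x).
  apply: (@edge_contra x y s) => //.
  by move: sxy; rewrite sx; case: (s y).
apply: (@edge_contra y x s) => //; first by rewrite mE mk_monoC.
- exact: conn_sym.
- by move: sxy sx; case: (s x); case: (s y).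
- exact: negbTE.
Qed.
End Reduction.

(** * Signatures of subvarieties *)

Section Monotone.
Variables v w : set mono.
Hypothesis vw : v `<=` w.

Lemma adj_mon x y : adj v x y -> adj w x y.
Proof. by move=> /adjP[xy vxy]; apply/adjP; split=> //; exact: vw. Qed.

Lemma walk_mon n x y : walk v n x y -> walk w n x y.
Proof.
elim: n x => [|n IH] x; first by move/walk0->; apply/walk0.
by move=> /walkS[z /adj_mon xz /IH zy]; apply/walkS; exists z.
Qed.

Lemma marked_mon x : marked v x -> marked w x.
Proof. by move=> [/vw wx [y /adj_mon xy]]; split=> //; exists y. Qed.

Lemma opposite_mon x y : opposite_class v x y -> opposite_class w x y.
Proof. by move=> [n on /walk_mon h]; exists n. Qed.

Lemma basic_zero_mon : basic_zero v -> basic_zero w.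
Proof.
case=> [[x /vw h]|[m /vw h sm]|[c [sc oc uc cc]]].
- by constructor 1; exists x.
- by constructor 2; exists m.
- constructor 3; exists c; split=> //; apply: sub_cycle cc => x y.
  exact: adj_mon.
Qed.
End Monotone.

(** A good set is already closed under the environment rule, which is monotone, so it absorbs the
    initial environment step. *)
Lemma environment_le t w : good w ->
  nform_le (environment (summands t)) (Some w) <->
  forall m, m \in monos t -> w m.
Proof.
move=> wg; have [nz env] := (proj1 (goodP w)) wg.
rewrite /environment; case: asboolP => bz /=.
  split=> // h; apply: nz; apply: basic_zero_mon bz => m; exact: h.
split=> [h m mi|h m]; first by apply: h; left.
have sw : summands t `<=` w by move=> k; exact: h.
case=> [|[x [y [mx my o ->]]]]; first exact: h.
by apply: env; [exact: marked_mon mx|exact: marked_mon my|exact: opposite_mon o].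
Qed.

Lemma nf_closedP (H : {set f25}) p q w : nf_closed H p q (Some w) <->
  [/\ good w, forall f, f \in H -> closed1 w f & rule2_closed p q w].
Proof.
split=> [[h1 h2 h3]|[h1 h2 h3]]; split=> //.
- by move=> f fH r; exact: h2.
- by move=> f r fH; exact: h2.
Qed.

(** Membership in the meet [Cl] is membership in every closed extension, and a square query holds
    exactly when there is no such extension. *)
Lemma derivesP (H : {set f25}) p q f : tau \notin H -> derives H p q f <->
  forall w, (forall m, m \in monos (body f) -> w m) ->
    nf_closed H p q (Some w) -> query_in id f w.
Proof.
move=> tH; rewrite /derives /Cl (negPf tH).
set ext := (X in `[< X = set0 >]).
have extE w : ext w <-> (forall m, m \in monos (body f) -> w m) /\
    nf_closed H p q (Some w).
  split=> -[h1 h2]; split=> //.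
    by apply/environment_le => //; case/nf_closedP: h2.
  by apply/environment_le => //; case/nf_closedP: h2.
case: asboolP => [e0|ne]; first split=> // _ w h1 h2.
  by have : ext w by [apply/extE]; rewrite e0.
rewrite /query_in; case: (query f) => [t|]; last first.
  split=> // h; apply: ne; apply/seteqP; split=> // w /extE[h1 h2].
  exact: h h1 h2.
split=> [h w h1 h2 m mi|h m mi w /extE[h1 h2]]; last exact: h.
by apply: (h m mi); apply/extE.
Qed.

Lemma even_walk_half G n x y : same_class G x y -> good G -> walk G n x y ->
  exists j, n = 2 * j.
Proof.
move=> [k ok wk] Gg w.
have := good_odd Gg (walk_cat w (walk_sym wk)); rewrite oddD (negPf ok) addbF => on.
by exists n./2; rewrite -[LHS]odd_double_half (negPf on) mul2n.
Qed.

Section Closed.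
Variables (K : set algebra) (H : {set f25}) (p q : threshold).
Hypothesis KV : K `<=` V12.
Hypothesis KH : forall f, f \in H -> has_law K (identity_of f).
Hypothesis Kp : forall n, 0 < n -> nat_le_thr n p -> has_law K (gamma n).
Hypothesis Kq : forall n, 0 < n -> nat_le_thr n q -> has_law K (gamma_D n).

Lemma Th_nf_closed t : ~ zer K t -> nf_closed H p q (Some (Th K t)).
Proof.
move=> nz; have Gg := Th_good KV nz; apply/nf_closedP; split=> //.
  by move=> f fH r hr; apply: (Th_rule1 KV (KH fH) nz hr).
rewrite /rule2_closed => x x' y mx mx' [sc hk] x'y; apply: (good_edge Gg).
have key j : walk (Th K t) (2 * j) x x' -> (0 < j -> nat_le_thr j
    (if `[< has_D_component (Th K t) >] then q else p)) -> Th K t (mk_mono [:: x; y]).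
  case: (posnP j) => [->|j0] w hj.
    by move/walk0: w => ->; exact: adj_mono.
  apply: adj_mono; move: (hj isT); case: asboolP => [D|nD] /= hj'.
    by apply: (@Th_gamma_dd _ true _ j) w x'y => //; exact: Kq.
  by apply: (@Th_gamma_dd _ false _ j) w x'y => //; exact: Kp.
move: hk key; case: (if _ then q else p) => [P [d dP w]|_] key.
  have [j jE] := even_walk_half sc Gg w; rewrite jE in dP w.
  by apply: (key j w) => _ /=; rewrite leq_mul2l in dP.
have [n on w] := sc; have [j jE] := even_walk_half sc Gg w; rewrite jE in w.
exact: key w _.
Qed.

End Closed.

Definition signature_of (K : set algebra) (s : signature) : Prop :=
  [/\ forall f, f \in s.1.1 <-> has_law K (identity_of f),
      forall n, 0 < n -> nat_le_thr n s.1.2 <-> has_law K (gamma n)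
    & forall n, 0 < n -> nat_le_thr n s.2 <-> has_law K (gamma_D n)].

Lemma tau_law K i : has_law K (identity_of tau) -> has_law K i.
Proof.
move=> h A KA e.
exact: (h A KA (fun n => if n is 0 then eval e i.1 else eval e i.2)).
Qed.

Lemma zer_var_tau K n : K `<=` V12 -> zer K (Var n) -> has_law K (identity_of tau).
Proof.
move=> KV z A KA e.
have h a : a = amul (e 0) (e 0) := z A KA (fun=> a) (e 0).
by rewrite /= [RHS]h; exact: h.
Qed.

Lemma preceq_antisym A l r : V12 A -> satisfies A (preceq l r) ->
  satisfies A (preceq r l) -> satisfies A (l, r).
Proof. by move=> VA h1 h2 e; apply: (le_anti VA (h1 e) (h2 e)). Qed.

Lemma law_preceq K l r : K `<=` V12 -> has_law K (l, r) -> has_law K (preceq l r).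
Proof. by move=> KV h A KA e; rewrite /= (h A KA e) /=; exact: (aaddxx (KV A KA)). Qed.

Lemma U_V12 s : U s `<=` V12.
Proof. by case: s => [[H p] q] A []. Qed.

Lemma U_law (s : signature) f : f \in s.1.1 -> has_law (U s) (identity_of f).
Proof.
by case: s => [[H p] q] /= fH A [_]; apply; constructor 1; exists f.
Qed.

Lemma U_gamma (s : signature) n : 0 < n -> nat_le_thr n s.1.2 -> has_law (U s) (gamma n).
Proof.
by case: s => [[H p] q] /= n0 np A [_]; apply; constructor 2; exists n.
Qed.

Lemma U_gamma_D (s : signature) n : 0 < n -> nat_le_thr n s.2 -> has_law (U s) (gamma_D n).
Proof.
by case: s => [[H p] q] /= n0 np A [_]; apply; constructor 3; exists n.
Qed.

Lemma variety_U s : variety (U s).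
Proof. by case: s => [[H p] q]; apply: variety_adjoin; exact: V12_variety. Qed.

Section Reflection.
Variables (K : set algebra) (s : signature).
Hypothesis KV : K `<=` V12.
Hypothesis Ks : signature_of K s.

(** Without edges there is nothing to fold onto, and [v] has only linear summands. Send its marks to
    one variable and everything else to the square: [m] becomes a square or has degree at least
    three, so that variable is zero. *)
Lemma Th_no_edge v m G : (forall n, n \in monos v -> G n) -> good G -> Th K v m ->
  ~ G m -> ~ (exists x y, adj G x y) -> has_law K (identity_of tau).
Proof.
move=> vG Gg vm nGm ne; apply: (@zer_var_tau _ 0 KV).
pose g x : mono := if `[< G [:: x] >] then [:: 0] else [:: 0; 0].
have g0 x : g x <> [::] by rewrite /g; case: asboolP.
have gv n : n \in monos v -> Th K (Var 0) (bsub g n).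
  move=> ni; have := vG n ni; have := good_size Gg (vG n ni).
  have := mono_neq0 ni; have := monos_sorted ni.
  case: n {ni} => [|x [|y [|]]] //= sn _ _ Gn.
    by rewrite /bsub /= cats0 /g (asboolT Gn); apply: Th_monos.
  by case: ne; exists x, y; apply: (good_edge Gg); rewrite mk_mono_id.
have := Th_bsub KV g0 gv vm; have [m0 _ _] := vm.
case: m vm nGm m0 => [|x [|y m]] // vm nGm _.
  by rewrite /bsub /= cats0 /g (asboolF nGm); apply: Th_square.
have [sz|sz] := leqP (size (bsub g [:: x, y & m])) 2; last by move/(Th_size KV); apply.
have h2 : exists a b, bsub g [:: x, y & m] = mk_mono [:: a; b] /\ a = 0 /\ b = 0.
  have all0 : forall k, all (pred1 0) (flatten (map g k)).
    elim=> //= a k IH; rewrite all_cat IH andbT /g.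
    by case: asboolP.
  have sge := size_flatten_ge [:: x, y & m] g0.
  move: sz; rewrite size_mk_mono => sz; exists 0, 0; split=> //; congr mk_mono.
  move: (all0 [:: x, y & m]) sz sge.
  by case: (flatten _) => [|a [|b [|]]] //= /andP[/eqP-> /andP[/eqP-> _]].
have [a [b [-> [-> ->]]]] := h2; exact: Th_square.
Qed.

Lemma U_reflects v m : tau \notin s.1.1 -> Th K v m -> Th (U s) v m.
Proof.
move=> tH vm; have [m0 sm _] := vm.
have [z|nz] := pselect (zer (U s) v).
  exact (zer_Th (@U_V12 s) z m0 sm).
apply: contrapT => nm; have Gg := Th_good (@U_V12 s) nz.
have [KH Kp Kq] := Ks.
have vG n : n \in monos v -> Th (U s) v n by apply: Th_monos; exact: U_V12.
have /nf_closedP[_ h1 h2] := Th_nf_closed (@U_V12 s) (@U_law s) (@U_gamma s) (@U_gamma_D s) nz.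
have [e|ne] := pselect (exists x y, adj (Th (U s) v) x y); last first.
  by move/negP: tH; apply; apply/KH; apply: Th_no_edge vG Gg vm nm ne.
pose D := has_D_component (Th (U s) v).
apply: (@reduction_contra K v m (Th (U s) v) KV Gg vG vm nm e _ `[< D >]
   (if `[< D >] then s.2 else s.1.2)) => //.
- by move=> f /KH; exact: h1.
- by split=> [/asboolP|/asboolP].
- move=> n n0; rewrite /gamma_dd; case: asboolP => _; [rewrite Kq|rewrite Kp] => //.
Qed.

Lemma signature_U : variety K -> K = U s.
Proof.
move=> Kv; apply/seteqP; split=> A.
  move=> KA; have [KH Kp Kq] := Ks; case Es : s KH Kp Kq => [[H p] q] /= KH Kp Kq.
  split; first exact: KV.
  move=> i [[f /KH h ->]|[n [n0 /(Kp _ n0) h ->]]|[n [n0 /(Kq _ n0) h ->]]];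
    exact: h.
move=> UA; apply: birkhoff => // -[l r] hi.
have [tH|tH] := boolP (tau \in s.1.1).
  exact: (tau_law (l, r) (U_law tH) UA).
have hU u w : has_law K (preceq u w) -> has_law (U s) (preceq u w).
  move=> h; apply/(Th_preceq (@U_V12 s)) => m mi; apply: U_reflects => //.
  by move: m mi; apply/(Th_preceq KV).
apply: (preceq_antisym (U_V12 UA)).
  by apply: (hU l r) UA; apply: law_preceq.
apply: (hU r l) UA; apply: law_preceq => // B KB e.
by rewrite /= (hi B KB e).
Qed.

End Reflection.

Ltac elim_mem tac :=
  first [case/orP=> [/eqP->|]; [tac|elim_mem tac]|move/eqP->; tac].

(** * The signature of a subvariety and its fixed-point property *)

Section Thresholds.
Variable K : set algebra.
Hypothesis KV : K `<=` V12.

(** The identity is tested on the consequences of its own body, where x_0 and x_2n are marked,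
    joined by a walk of length 2n, and y is adjacent to x_2n. *)
Lemma gamma_of_twins dd n : 0 < n ->
  (forall G, G = Th K (gamma_dbody dd n) -> good G -> (dd -> hasD G) ->
     ~ zer K (gamma_dbody dd n) -> forall x x' y, marked G x -> marked G x' ->
     same_class G x x' -> walk G (2 * n) x x' -> adj G x' y -> adj G x y) ->
  has_law K (gamma_dd dd n).
Proof.
move=> n0 h; apply/(law_gamma_dd _ _ KV).
have [z|nz] := pselect (zer K (gamma_dbody dd n)); first exact: zer_Th.
have [Gg [m0 m2 w a hD]] := gamma_path KV n0 nz; have {}w := w _ (leqnn _).
rewrite (_ : [:: 1; 9] = mk_mono [:: 9; 1]) //; apply: adj_mono.
apply: (h _ erefl Gg _ nz _ (9 + 2 * n)) => //.
by exists (2 * n) => //; rewrite mul2n odd_double.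
Qed.

(** A walk from x to x' is lengthened to 2n by going back and forth along the edge from x' to y. *)
Lemma gamma_le dd m n : 0 < m -> m <= n -> has_law K (gamma_dd dd n) ->
  has_law K (gamma_dd dd m).
Proof.
move=> m0 mn hn; apply: gamma_of_twins => // G GE Gg hD nz x x' y mx mx' _ w x'y.
have w' : walk G (2 * n) x x'.
  rewrite -(subnKC mn) mulnDr; elim: (n - m) => [|k IH]; first by rewrite muln0 addn0.
  rewrite mulnS addnCA addnC addn2; apply: walk_rcons (walk_rcons IH x'y) _.
  by rewrite adj_sym.
by move: Gg hD mx mx' w' x'y; rewrite GE; apply: Th_gamma_dd KV _ hn; exact: leq_trans mn.
Qed.

Lemma gamma_D_of_gamma n : 0 < n -> has_law K (gamma n) -> has_law K (gamma_D n).
Proof.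
move=> n0 hn; apply: (@gamma_of_twins true) => // G GE Gg _ _ x x' y mx mx' _ w x'y.
subst G; exact: (@Th_gamma_dd _ false _ n _ x' _ KV n0 hn Gg _ mx mx' w x'y).
Qed.

(** Each of these identities either marks [y], so that the environment rule joins it to [x], or
    itself joins [x] to [y] across an odd walk, or cannot hold in a good set with the given
    marks. *)
Lemma closed1_twins G (dd : bool) f : good G -> (dd -> hasD G) ->
  f \in (I_0 :|: (if dd then I_D else I_0))%SET -> closed1 G f ->
  forall x x' y, marked G x -> marked G x' -> same_class G x x' ->
  adj G x' y -> adj G x y.
Proof.
move=> Gg hD fI h x x' y mx mx' xx' x'y.
have xy : opposite_class G x y.
  by have [n on w] := xx'; exists n.+1; [|exact: walk_rcons w x'y].
have yx' : adj G y x' by rewrite adj_sym.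
have env : G [:: y] -> adj G x y.
  by move=> Gy; apply: (good_env Gg mx _ xy); exact: marked_adj yx'.
have [Gx [c xc]] := mx; have [Gx' _] := mx'.
have x'x : same_class G x' x.
  by have [n on w] := xx'; exists n => //; exact: walk_sym.
have noD b : closed1 G (dlaw omega omega_D b) -> (b -> hasD G) -> adj G x y.
  by move=> hb hDb; apply: env; apply: (close_omega Gg hDb hb Gx' x'y).
have noA b : closed1 G (dlaw alpha alpha_D b) -> (b -> hasD G) -> adj G x y.
  by move=> hb hDb; apply: (alpha_full Gg hDb hb Gx xy).
have noI b : closed1 G (dlaw iota2 iota2_D b) -> (b -> hasD G) -> adj G x y.
  by move=> hb hDb; rewrite adj_sym; apply: (iota_full Gg hDb hb Gx' x'y x'x).
have in_0 : f \in I_0 -> adj G x y.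
  move=> fI0; move: fI0 h; rewrite /I_0 !inE.
  elim_mem ltac:(move=> h'; first
   [ by apply: env; apply: close_rho h' yx'
   | by apply: (noD false)
   | by apply: env; apply: close_zeta h' Gx' x'y yx'
   | by apply: (shorten_all _ xy) => a b d e; apply: (close_delta Gg h')
   | by apply: (shorten_all _ xy) => a b d e; apply: (close_nu Gg h' Gx' x'y)
   | by apply: (noA false)
   | by apply: (close_beta Gg h' Gx Gx' xc x'y)
   | by case: (close_sq mx h')
   | by case: (close_chi xc h')
   | by apply: (noI false)
   | by apply: env; apply: (h' (fun n => if n is 0 then x else y) _ [:: 1]) => // m;
        rewrite inE => /eqP-> ]).
move: fI; rewrite !finset.in_setU; case/orP=> [/in_0//|].
case: dd hD => hD; last exact: in_0.
rewrite /I_D finset.in_setU => /orP[/in_0//|].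
have hd := hD isT => fID; move: fID h; rewrite !inE.
elim_mem ltac:(move=> h'; first
 [ by apply: (noD true)
 | by apply: env; apply: (close_zeta_D Gg hd h' yx')
 | by apply: (shorten_all _ xy) => a b d e; apply: (close_nu_D Gg hd h')
 | by apply: (noA true)
 | by case: (close_xi Gg hd h')
 | by apply: (noI true) ]).
Qed.

Lemma I_gamma (dd : bool) f n : 0 < n -> f \in (I_0 :|: (if dd then I_D else I_0))%SET ->
  has_law K (identity_of f) -> has_law K (gamma_dd dd n).
Proof.
move=> n0 fI hf; apply: gamma_of_twins => // G GE Gg hD nz x x' y mx mx' sc _ x'y.
apply: (closed1_twins Gg hD fI _ mx mx' sc x'y) => r hr.
by subst G; exact: (Th_rule1 KV hf nz hr).
Qed.

(** Every vertex at even distance from a mark is marked by [eta], so gamma_1 can be applied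
    repeatedly along the walk, two steps at a time. *)
Lemma eta_gamma dd n : 0 < n -> has_law K (identity_of (dlaw Defs.eta eta_D dd)) ->
  has_law K (gamma_dd dd 1) -> has_law K (gamma_dd dd n).
Proof.
move=> n0 hf h1; apply: gamma_of_twins => // G GE Gg hD nz x x' y mx mx' sc _ x'y.
have ce : closed1 G (dlaw Defs.eta eta_D dd).
  by move=> r hr; subst G; exact: (Th_rule1 KV hf nz hr).
have twin t t' u : marked G t -> marked G t' -> walk G 2 t t' -> adj G t' u -> adj G t u.
  by subst G; exact: (@Th_gamma_dd _ dd _ 1 _ _ _ KV isT h1 Gg hD).
have [k ok wk] := sc; move: (walk_sym wk) ok => {wk sc}.
elim/ltn_ind: k x mx => -[|[|k]] IH x mx //.
  by move/walk0 => <-.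
move=> /walkSr[u /walkSr[t wt tu] ux] /=; rewrite negbK => ok.
have mt : marked G t.
  split; last by exists u.
  by apply: (eta_full Gg hD ce (marked_mono mx')); exists k.
apply: (twin x t y mx mt); last exact: (IH k) wt ok.
by apply/walkS; exists u; [rewrite adj_sym|apply/walk1; rewrite adj_sym].
Qed.

Lemma threshold_exists (P : nat -> Prop) :
  (forall m n, 0 < m -> m <= n -> P n -> P m) ->
  exists p, forall n, 0 < n -> nat_le_thr n p <-> P n.
Proof.
move=> hP; have [h|h] := pselect (forall n, 0 < n -> P n).
  by exists None => n n0; split=> // _; exact: h.
have ex : exists n, (0 < n) && ~~ `[< P n >].
  apply: contrapT => ne; apply: h => n n0; apply: contrapT => nP; apply: ne.
  by exists n; rewrite n0; apply/asboolP.
case: (ex_minnP ex) => -[//|N] /= /asboolP nP Nmin.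
exists (Some N) => n n0 /=; split=> [nN|Pn].
  apply: contrapT => nPn; have : N < n by apply: Nmin; rewrite n0; exact/asboolP.
  by rewrite ltnNge nN.
by rewrite leqNgt; apply/negP => /(hP N.+1 n isT)/(_ Pn).
Qed.

Lemma signature_exists : exists s, signature_of K s.
Proof.
have [p hp] := @threshold_exists (fun n => has_law K (gamma n)) (@gamma_le false).
have [q hq] := @threshold_exists (fun n => has_law K (gamma_D n)) (@gamma_le true).
exists ([set f | `[< has_law K (identity_of f) >]]%SET, p, q); split=> //= f.
by rewrite inE; split=> /asboolP.
Qed.

Lemma thr_ext (p p' : threshold) :
  (forall n, 0 < n -> nat_le_thr n p <-> nat_le_thr n p') -> p = p'.
Proof.
case: p p' => [m|] [n|] h //.
- congr Some; apply/eqP; rewrite eqn_leq; apply/andP; split.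
    by case: m h => // m h; apply/(h m.+1) => //=.
  by case: n h => // n h; apply/(h n.+1) => //=.
- by have /= := proj2 (h m.+1 isT) isT; rewrite ltnn.
- by have /= := proj1 (h n.+1 isT) isT; rewrite ltnn.
Qed.

Lemma signature_uniq s s' : signature_of K s -> signature_of K s' -> s = s'.
Proof.
move: s s' => [[H p] q] [[H' p'] q'] [/= h1 h2 h3] [/= k1 k2 k3].
congr (_, _, _).
- apply/finset.setP => f; apply/idP/idP => fi.
    by apply/k1/h1.
  by apply/h1/k1.
- by apply: thr_ext => n n0; rewrite h2 // k2.
- by apply: thr_ext => n n0; rewrite h3 // k3.
Qed.

Lemma law_of_derived f : ~ zer K (body f) -> query_in id f (Th K (body f)) ->
  has_law K (identity_of f).
Proof.
move=> nz; rewrite /query_in /identity_of /query /body in nz *.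
case: (law_of f) nz => [u v|v|] nz // h.
  by apply/(Th_preceq KV) => m mi; rewrite -(map_mono_id mi); exact: h.
have h1 : has_law K (preceq (Var 1) (Var 0)).
  by apply/(Th_preceq KV) => m mi; rewrite -(map_mono_id mi); exact: h.
move=> A KA e; apply: (le_anti (KV KA)); last exact: h1 KA e.
exact: (h1 A KA (fun n => if n is 0 then e 1 else e 0)).
Qed.

Lemma law_of_zer f : zer K (body f) -> has_law K (identity_of f).
Proof.
rewrite /identity_of /body; case: (law_of f) => [u v|v|] z.
- by move=> A KA e; rewrite /= (z A KA e (eval e u)); exact: (asquare_max (KV KA)).
- by apply/(zer_square KV).
- exact: zer_var_tau KV z.
Qed.

Lemma law_weaken u v w : has_law K (preceq u v) -> has_law K (preceq u (v + w)).
Proof.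
move=> h A KA e; have VA := KV KA; apply: (le_trans VA (h A KA e)).
by have [] := proj1 (le_add VA (eval e v) (eval e w) _) (le_refl VA _).
Qed.

Lemma signature_fixed s : signature_of K s -> fixed_points s.
Proof.
move: s => [[H p] q] [/= hH hp hq]; split=> /=.
  suff : forall n, 0 < n -> nat_le_thr n p -> nat_le_thr n q.
    case: p q {hp hq} => [m|] [n|] //= h.
      by case: m h => // m h; apply: (h m.+1).
    by have := h n.+1 isT isT; rewrite ltnn.
  by move=> n n0; rewrite hp // hq //; exact: gamma_D_of_gamma.
have [tH|tH] := boolP (tau \in H).
  have th := proj1 (hH tau) tH; congr (_, _, _).
  - by apply/finset.setP => f; rewrite inE; symmetry; apply/hH; exact: tau_law.
  - by apply: thr_ext => n n0; split=> // _; apply/hp => //; exact: tau_law.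
  - by apply: thr_ext => n n0; split=> // _; apply/hq => //; exact: tau_law.
have pinf : (forall n, 0 < n -> has_law K (gamma n)) -> p = None.
  by move=> h; apply: thr_ext => n n0; split=> // _; apply/hp => //; exact: h.
have qinf : (forall n, 0 < n -> has_law K (gamma_D n)) -> q = None.
  by move=> h; apply: thr_ext => n n0; split=> // _; apply/hq => //; exact: h.
have pa : thr_max p (mu \in H) = p.
  case muH : (mu \in H); last by case: (p) => //= m; rewrite max0n.
  have /hp := @mu_gamma _ false KV (proj1 (hH mu) muH).
  by case: (p) => //= m /(_ isT) m1; congr Some; apply/maxn_idPr.
have qb : thr_max q ((mu \in H) || (mu_D \in H)) = q.
  case muH : (_ || _); last by case: (q) => //= m; rewrite max0n.
  have : has_law K (gamma_D 1).
    case/orP: muH => /hH h; last exact: (@mu_gamma _ true KV h).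
    exact: (@gamma_D_of_gamma 1 isT (@mu_gamma _ false KV h)).
  by move/hq => h; case: (q) h => //= m /(_ isT) m1; congr Some; apply/maxn_idPr.
rewrite pa qb; congr (_, _, _).
- apply/finset.setP => f; rewrite inE; apply/asboolP/idP => [/derivesP|fH]; last first.
    by apply/derivesP => // w hw /nf_closedP[_ h1 _]; exact: closed1_id (h1 f fH) hw.
  move=> /(_ tH) h; apply/hH.
  have [z|nz] := pselect (zer K (body f)); first exact: law_of_zer.
  apply: (law_of_derived nz); apply: h; first by move=> m; apply: Th_monos.
  apply: Th_nf_closed => //.
  + by move=> g /hH.
  + by move=> n n0 /hp; apply.
  + by move=> n n0 /hq; apply.
- case: ifP => // /orP[/finset.set0Pn[f]|/andP[eH p1]].
    rewrite finset.in_setI => /andP[/hH fH fI]; rewrite pinf // => n n0.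
    by apply: (@I_gamma false f) => //; rewrite finset.in_setU fI.
  rewrite pinf // => n n0; apply: (@eta_gamma false n n0); first exact/hH.
  exact/hp.
- case: ifP => // /orP[/finset.set0Pn[f]|/andP[eH q1]].
    rewrite finset.in_setI => /andP[/hH fH fI]; rewrite qinf // => n n0.
    by apply: (@I_gamma true f) => //; rewrite finset.in_setU fI orbT.
  rewrite qinf // => n n0; apply: (@eta_gamma true n n0); last exact/hq.
  by case/orP: eH => /hH // he; apply: law_weaken; exact: he.
Qed.
End Thresholds.

(** * Path models *)

Lemma closed_eta w b : good w ->
  (forall x y z, w [:: x] -> adj w x y -> adj w y z -> w [:: z]) ->
  closed1 w (dlaw Defs.eta eta_D b).
Proof.
move=> wg h r hr.
have [h0 h1 h2] : [/\ w [:: r 0], adj w (r 0) (r 1) & adj w (r 1) (r 2)].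
  by move: hr; case: b => hr; split; first [exact: (hr [:: 0] isT)
    |exact: (good_edge wg (hr [:: 0; 1] isT))|exact: (good_edge wg (hr [:: 1; 2] isT))].
have hz := h _ _ _ h0 h1 h2.
by case: b {hr}; rewrite /query_in /= => m; rewrite inE => /eqP->; exact: hz.
Qed.

Lemma closed_lambda w : good w ->
  (forall x y z, w [:: x] -> w [:: y] -> adj w x y -> adj w x z -> w [:: z]) ->
  closed1 w lambda.
Proof.
move=> wg h r hr; rewrite /query_in /= => m; rewrite inE => /eqP->.
apply: (h (r 0) (r 1)); [exact: (hr [:: 0] isT)|exact: (hr [:: 1] isT)
  |exact: (good_edge wg (hr [:: 0; 1] isT))|exact: (good_edge wg (hr [:: 0; 2] isT))].
Qed.

(** The bodies of [mu2], [epsilon] and [kappa] all mark b and one of its neighbours a, c; those of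
    [mu] and [mu_D] mark b. *)
Lemma closed_path w (b : bool) f : good w ->
  f \in (if b then [:: mu; mu_D] else [:: mu2; epsilon; kappa]) ->
  (forall x y z t, w [:: y] -> (~~ b -> w [:: x] \/ w [:: z]) ->
     adj w x y -> adj w y z -> adj w z t -> adj w x t) -> closed1 w f.
Proof.
move=> wg + h r; case: b h => h; rewrite !inE; elim_mem ltac:(move=> hr;
  rewrite /query_in /= => m; rewrite inE => /eqP->; rewrite map_mono2; apply: adj_mono;
  apply: (h (r 5) (r 6) (r 7)); first
  [exact: (hr [:: 6] isT)
  |exact: (good_edge wg (hr [:: 5; 6] isT))|exact: (good_edge wg (hr [:: 6; 7] isT))
  |exact: (good_edge wg (hr [:: 7; 8] isT))
  |by []|by left; exact: (hr [:: 5] isT)|by right; exact: (hr [:: 7] isT)]).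
Qed.

(** Two letters whose D-term is part of the body. Such an identity holds vacuously in a graph
    without a D-component. *)
Definition D_pair (f : f25) : option (nat * nat) :=
  match f with
  | lambda | xi | zeta_D => Some (0, 1)
  | eta_D | omega_D | mu_D | nu_D | alpha_D | iota2_D => Some (3, 4)
  | mu2 => Some (6, 7)
  | epsilon | kappa => Some (5, 6)
  | _ => None
  end.

Lemma closed_no_D w f : good w -> D_pair f <> None -> ~ hasD w -> closed1 w f.
Proof.
move=> wg; case E : (D_pair f) => [[i j]|//] _ nD r hr; case: nD.
have [mi mj mij] : [/\ [:: i] \in monos (body f), [:: j] \in monos (body f) &
    [:: i; j] \in monos (body f)].
  by move: E {hr}; case: f => //= -[<- <-]; split.
have a : adj w (r i) (r j) by exact: (good_edge wg (hr _ mij)).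
exists (r i), (r j); split; [exact: marked_adj (hr _ mi) a| |by exists 1 => //; apply/walk1].
by apply: (@marked_adj _ _ (r i)); [exact: (hr _ mj)|rewrite adj_sym].
Qed.

(* The closure of the body of [gamma_(P+1)] under [mu], together with a
   D-component if [dd]: the path x_0, ..., x_2n with ends marked and y joined to
   x_2n and, if n >= 2, to x_(2n-2). *)
Section PathModel.
Variables (dd : bool) (P : nat).
Let n := P.+1.

Definition path_edge (x y : nat) : Prop :=
  9 <= x /\ y = x.+1 /\ y <= 9 + 2 * n \/ x = 9 + 2 * n /\ y = 1 \/
  2 <= n /\ x = 7 + 2 * n /\ y = 1 \/ dd /\ x = 3 /\ y = 4.

Definition path_mark (x : nat) : Prop :=
  x = 9 \/ x = 9 + 2 * n \/ dd /\ (x = 3 \/ x = 4).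

Definition path_model : set mono := [set m |
  (exists x, path_mark x /\ m = [:: x]) \/
  (exists x y, path_edge x y /\ m = mk_mono [:: x; y])].

Local Notation w := path_model.

(** Position along the path; y lies beyond x_2 if P = 0, and otherwise between x_(2n-2) and x_2n.
    Every edge changes the level by one, so the parity is a colouring and level differences bound
    distances from below. *)
Definition path_level (x : nat) : nat :=
  if x == 3 then 0 else if x == 4 then 1 else
  if x == 1 then (if P == 0 then 3 else (2 * P).+1) else x - 9.

Definition path_D (x : nat) : bool := (x == 3) || (x == 4).

Lemma path_level_ge x : 9 <= x -> path_level x = x - 9.
Proof.
move=> x9; rewrite /path_level.
by case: eqP => [e|_]; [lia|]; case: eqP => [e|_]; [lia|]; case: eqP => [e|_]; [lia|].
Qed.

Lemma path_D_ge x : 9 <= x -> path_D x = false.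
Proof. by rewrite /path_D; lia. Qed.

Lemma path_level1 : path_level 1 = if P == 0 then 3 else (2 * P).+1.
Proof. by []. Qed.

Lemma path_edge_level x y : path_edge x y -> path_D x = path_D y /\
  (path_level y = (path_level x).+1 \/ path_level x = (path_level y).+1).
Proof.
case=> [[x9 [yE _]]|[[xE yE]|[[P1 [xE yE]]|[_ [-> ->]]]]]; last by split=> //; left.
- have y9 : 9 <= y by rewrite yE; exact: leqW.
  by rewrite !path_D_ge // !path_level_ge // yE; split=> //; left; rewrite subSn.
- have x9 : 9 <= x by rewrite xE leq_addr.
  rewrite (path_D_ge x9) (path_level_ge x9) yE path_level1 xE addKn; split=> //.
  by rewrite /n; case: eqP => ?; [left|right]; lia.
- have x9 : 9 <= x by rewrite xE /n; lia.
  rewrite (path_D_ge x9) (path_level_ge x9) yE path_level1 xE; split=> //.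
  by move: P1; rewrite /n; case: eqP => ?; left; lia.
Qed.

Lemma path_edge_neq x y : path_edge x y -> x <> y.
Proof. by move=> /path_edge_level[_ h] xy; rewrite xy in h; case: h; lia. Qed.

Lemma path_adj x y : adj w x y <-> path_edge x y \/ path_edge y x.
Proof.
split=> [/adjP[_]|h].
  case=> [[z [_ /(congr1 size)]]|[a [b [e]]]]; first by rewrite size_mk_mono.
  rewrite !mk_mono2; do 2 case: ifP => _; move=> -[-> ->]; auto.
apply/adjP; split; first by case: h => /path_edge_neq // nxy xy; apply: nxy.
by right; case: h => e; [exists x, y|exists y, x; rewrite mk_monoC].
Qed.

Lemma path_marks x : w [:: x] <-> path_mark x.
Proof.
split=> [[[z [mz [->]]]//|[a [b [_ /(congr1 size)]]]]|h]; first by rewrite size_mk_mono.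
by left; exists x.
Qed.

Lemma path_coloring : coloring w (fun x => odd (path_level x)).
Proof.
by move=> x y /path_adj[]/path_edge_level[_ [->|->]] /=; rewrite ?negbK.
Qed.

Lemma path_walk k x y : walk w k x y -> path_D x = path_D y /\
  path_level y <= path_level x + k.
Proof.
elim: k x => [|k IH] x; first by move/walk0->; rewrite addn0.
move=> /walkS[z /path_adj h /IH[<- lz]].
have [-> zx] : path_D x = path_D z /\ path_level z <= (path_level x).+1.
  by case: h => /path_edge_level[-> [->|->]]; split=> //; lia.
by split=> //; apply: leq_trans lz _; rewrite addnS -addSn leq_add2r.
Qed.

Lemma path_nbr9 x : adj w 9 x -> x = 10.
Proof. by move/path_adj; rewrite /path_edge /n; lia. Qed.

Lemma path_nbr_end x : adj w (9 + 2 * n) x -> x = 8 + 2 * n \/ x = 1.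
Proof. by move/path_adj; rewrite /path_edge /n; lia. Qed.

Lemma path_nbr_last x : adj w (8 + 2 * n) x -> x = 9 + 2 * n \/ x = 7 + 2 * n.
Proof. by move/path_adj; rewrite /path_edge /n; lia. Qed.

Lemma path_nbr1 x : adj w 1 x -> x = 9 + 2 * n \/ 2 <= n /\ x = 7 + 2 * n.
Proof. by move/path_adj; rewrite /path_edge /n; lia. Qed.

Lemma path_nbr3 x : adj w 3 x -> dd /\ x = 4.
Proof. by move/path_adj; rewrite /path_edge /n; lia. Qed.

Lemma path_nbr4 x : adj w 4 x -> dd /\ x = 3.
Proof. by move/path_adj; rewrite /path_edge /n; lia. Qed.

Lemma path_adj43 : dd -> adj w 4 3.
Proof. by move=> d; apply/path_adj; right; do 3 right. Qed.

Lemma path_marked_adj x y : w [:: x] -> w [:: y] -> adj w x y ->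
  dd /\ (x = 3 /\ y = 4 \/ x = 4 /\ y = 3).
Proof.
move=> /path_marks mx /path_marks my; case: mx => [->|[->|[d [->|->]]]].
- by move/path_nbr9 => yE; move: my; rewrite yE /path_mark /n; lia.
- by move/path_nbr_end => yE; move: my; rewrite /path_mark /n in yE *; lia.
- by move/path_nbr3 => [_ ->]; auto.
- by move/path_nbr4 => [_ ->]; auto.
Qed.

Lemma path_good : good w.
Proof.
apply/goodP; split=> [[[x [[y [_ ey]]|[a [b [e ab]]]]]|[m [[y [_ ->]]|[a [b [_ ->]]]]]|]|].
- by [].
- have := path_edge_neq e; move: ab; rewrite mk_mono2.
  by case: ifP => _ [-> ->].
- by [].
- by rewrite size_mk_mono.
- exact: coloring_no_odd path_coloring.
- move=> x y [mx _] [my _] [k ok wk].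
  have par := coloring_walk path_coloring wk; rewrite ok in par.
  have [Dxy _] := path_walk wk.
  have lev2n : odd (path_level (9 + 2 * n)) = false.
    by rewrite path_level_ge ?leq_addr // addKn mul2n odd_double.
  have D2n : path_D (9 + 2 * n) = false by rewrite path_D_ge ?leq_addr.
  case: (proj1 (path_marks x) mx) => [ex|[ex|[d [ex|ex]]]];
  case: (proj1 (path_marks y) my) => [ey|[ey|[d' [ey|ey]]]];
  rewrite ex ey in Dxy par *; rewrite ?lev2n ?D2n // in Dxy par;
    first [by [] | by rewrite mk_monoC; apply: adj_mono; apply: path_adj43
          | by apply: adj_mono; apply: path_adj43].
Qed.

(** The two ends differ by 2n = 2P + 2 levels, beyond the threshold, and 3 and 4 lie in opposite
    classes. Hence x and x' coincide. *)
Lemma path_twin x x' y : marked w x -> marked w x' -> within_dist w (Some P) x x' ->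
  adj w x' y -> adj w x y.
Proof.
move=> [/path_marks mx _] [/path_marks mx' _] [[k ok wk] [d dP wd]].
have [Dxx' le1] := path_walk wd; have [_ le2] := path_walk (walk_sym wd).
have := coloring_walk path_coloring wk; rewrite (negPf ok) addFb.
have lev2n : path_level (9 + 2 * n) = 2 * n.
  by rewrite path_level_ge ?leq_addr // addKn.
have D2n : path_D (9 + 2 * n) = false by rewrite path_D_ge ?leq_addr.
case: mx => [ex|[ex|[_ [ex|ex]]]]; case: mx' => [ex'|[ex'|[_ [ex'|ex']]]];
  rewrite ex ex' in Dxx' le1 le2 *; rewrite ?lev2n ?D2n in Dxx' le1 le2 *; rewrite //;
  move: le1 le2; rewrite /path_level /= /n; lia.
Qed.

Lemma path_hasD : hasD w <-> dd.
Proof.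
split=> [/(hasD_adj path_good)[a [b [[ma _] [mb _] ab]]]|d].
  by have [] := path_marked_adj ma mb ab.
have a := path_adj43 d; exists 4, 3; split; last by exists 1 => //; apply/walk1.
- by apply: marked_adj a; apply/path_marks; right; right; split=> //; right.
- rewrite adj_sym in a; apply: marked_adj a.
  by apply/path_marks; right; right; split=> //; left.
Qed.

Lemma path_body m : m \in monos (gamma_dbody dd n) -> w m.
Proof.
have g k : k \in monos (gamma_body n) -> w k.
  case/gamma_monos => // [->|->|[j jn ->]|->].
  - by apply/path_marks; left.
  - by apply/path_marks; right; left.
  - apply: adj_mono; apply/path_adj; left; left; rewrite addnS.
    by split; [exact: leq_addr|split=> //; rewrite -addnS leq_add2l].
  - by apply: adj_mono; apply/path_adj; left; right; left.
move=> /gamma_dbody_monos[/g//|[d]]; rewrite !inE => /or3P[] /eqP->.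
- by left; exists 3; split=> //; right; right; split=> //; left.
- by left; exists 4; split=> //; right; right; split=> //; right.
- by right; exists 3, 4; split=> //; do 3 right.
Qed.

Lemma path_not_query : ~ w (mk_mono [:: 9; 1]).
Proof. by move/(good_edge path_good)/path_nbr9. Qed.

(** For n = 1 the vertex y is adjacent to x_2 alone, so two steps from a mark always lead to a
    mark. *)
Lemma path_eta b : P = 0 -> closed1 w (dlaw Defs.eta eta_D b).
Proof.
move=> P0; apply: closed_eta path_good _ => x y z /path_marks mx xy yz.
apply/path_marks; case: mx xy => [->|[->|[d [->|->]]]].
- move/path_nbr9 => yE; move: yz; rewrite yE => /path_adj.
  by rewrite /path_edge /path_mark /n P0; lia.
- move/path_nbr_end => [] yE; move: yz; rewrite yE.
    by move/path_nbr_last; rewrite /path_mark /n P0; lia.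
  by move/path_nbr1; rewrite /path_mark /n P0; lia.
- by case/path_nbr3 => _ yE; move: yz; rewrite yE => /path_nbr4[_ ->]; right; right; split=> //; left.
- by case/path_nbr4 => _ yE; move: yz; rewrite yE => /path_nbr3[_ ->]; right; right; split=> //; right.
Qed.

(** The extra edge from y to x_(2n-2) gives y and x_(2n-1) the same neighbours. Every other mark has
    only one neighbour. *)
Lemma path_mu b : 0 < P -> closed1 w (dlaw mu mu_D b).
Proof.
move=> P0; apply: (@closed_path w true) path_good _ _; first by case: b; rewrite !inE eqxx ?orbT.
move=> x y z t /path_marks my _ xy yz zt.
rewrite adj_sym in xy; case: my xy yz => [->|[->|[d [->|->]]]].
- by move=> /path_nbr9-> /path_nbr9 zE; rewrite -zE.
- move=> xE zE; have tE : t = 9 + 2 * n \/ t = 7 + 2 * n.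
    case: (path_nbr_end zE) zt => -> .
      by move/path_nbr_last.
    by move/path_nbr1 => [|[]]; auto.
  apply/path_adj; case: (path_nbr_end xE) tE => -> [] ->; rewrite /path_edge /n; lia.
- move=> /path_nbr3[_ xE] /path_nbr3[_ zE]; move: zt; rewrite xE zE => /path_nbr4[d' ->].
  exact: path_adj43.
- move=> /path_nbr4[_ xE] /path_nbr4[_ zE]; move: zt; rewrite xE zE => /path_nbr3[d' ->].
  by rewrite adj_sym; exact: path_adj43.
Qed.

Lemma path_lambda : closed1 w lambda.
Proof.
apply: closed_lambda path_good _ => x y z mx my xy xz.
have [d [[xE _]|[xE _]]] := path_marked_adj mx my xy; move: xz; rewrite xE.
  by move=> /path_nbr3[_ ->]; apply/path_marks; right; right; split=> //; right.
by move=> /path_nbr4[_ ->]; apply/path_marks; right; right; split=> //; left.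
Qed.

Lemma path_D_path f : f \in [:: mu2; epsilon; kappa] -> closed1 w f.
Proof.
move=> fi; apply: (@closed_path w false) path_good fi _ => x y z t my h xy yz zt.
have [d yE] : dd /\ (y = 3 \/ y = 4).
  case: (h isT) => m1; [have := path_marked_adj m1 my xy|have := path_marked_adj my m1 yz];
    by case=> d [] []; auto.
rewrite adj_sym in xy; case: yE xy yz => ->.
  move=> /path_nbr3[_ ->] /path_nbr3[_ zE]; move: zt; rewrite zE => /path_nbr4[_ ->].
  exact: path_adj43.
move=> /path_nbr4[_ ->] /path_nbr4[_ zE]; move: zt; rewrite zE => /path_nbr3[_ ->].
by rewrite adj_sym; exact: path_adj43.
Qed.

End PathModel.

(** * Recovering a fixed point from its subvariety *)

Section FixedSignature.
Variables (H : {set f25}) (p q : threshold).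
Hypothesis fixed : fixed_points (H, p, q).
Hypothesis tH : tau \notin H.

Let pq : thr_le p q. Proof. by case: fixed. Qed.

Let derivesH f : f \in H <-> derives H p q f.
Proof.
case: fixed => _ /=; rewrite (negPf tH) => -[E _ _].
by rewrite -{1}E inE; split=> /asboolP.
Qed.

Let nat_thr n : nat_le_thr n p -> nat_le_thr n q.
Proof. by case: p q pq => [i|] [j|] //= ij h; apply: leq_trans h ij. Qed.

Lemma model_in_U w : nf_closed H p q (Some w) -> U (H, p, q) (syntactic w).
Proof.
move=> /nf_closedP[wg h1 h2]; split; first exact: V12_syntactic.
have key n (k := if `[< has_D_component w >] then q else p) : nat_le_thr n k ->
    forall x x' y, marked w x -> marked w x' -> walk w (2 * n) x x' ->
    adj w x' y -> adj w x y.
  move=> nk x x' y mx mx' wk; apply: h2 => //; split.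
    by exists (2 * n) => //; rewrite mul2n odd_double.
  rewrite -/k; case: k nk => //= P nP; exists (2 * n) => //.
  by rewrite leq_mul2l.
move=> i [[f fH ->]|[n [n0 np ->]]|[n [n0 nq ->]]].
- apply: syntactic_law => //; first by move=> ft; move: tH; rewrite -ft fH.
  exact: h1.
- by apply: (@syntactic_gamma _ wg false) => // _; apply: key; case: asboolP => // _; exact: nat_thr.
- by apply: (@syntactic_gamma _ wg true) => // D; apply: key; rewrite asboolT //; exact: D.
Qed.

Let law_in f : has_law (U (H, p, q)) (identity_of f) -> f \in H.
Proof.
move=> hf; apply: contrapT => /derivesH nd; apply: nd.
apply/derivesP => // w bw cw; apply: contrapT => nq.
have [wg _ _] := proj1 (nf_closedP _ _ _ _) cw.
exact: (syntactic_not_law wg bw nq) (hf _ (model_in_U cw)).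
Qed.

(** A finite threshold stays fixed only if nothing sends it to infinity: no member of [I] is
    present, [mu] forces it to be positive, and [eta] forces it to be zero. *)
Let thr_fix r (I : {set f25}) (m e : bool) P (a := thr_max r m) :
  (if (H :&: I != finset.set0)%SET || e && nat_le_thr 1 a then None else a) = r ->
  r = Some P -> [/\ (H :&: I)%SET = finset.set0, m -> 0 < P & e -> P = 0].
Proof.
rewrite /a => + rP; rewrite rP /=; case: ifP => //= /negbT.
rewrite negb_or negbK => /andP[/eqP I0 he] [mP]; split=> //.
  by move=> mt; rewrite mt in mP; rewrite -mP leq_max.
by move=> et; move: he; rewrite et mP; case: (P).
Qed.

Let notin_I (I : {set f25}) f : (H :&: I)%SET = finset.set0 -> f \in H -> f \notin I.
Proof.
by move=> e fH; apply/negP => fI; have := finset.in_set0 f; rewrite -e finset.in_setI fH fI.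
Qed.

(** Outside [I_0] only [eta] and [mu] have bodies without a D-pair; all other identities are vacuous
    in this model. *)
Let path_closed P : p = Some P -> nf_closed H p q (Some (path_model false P)).
Proof.
move=> pP; case: fixed => _ /=; rewrite (negPf tH) => -[_ E _].
have [I0 hmu heta] := thr_fix E pP.
have wg := path_good false P; have nD : ~ hasD (path_model false P) by move/path_hasD.
apply/nf_closedP; split=> //.
  move=> f fH; have := notin_I I0 fH.
  case Ef : f fH => fH; rewrite ?inE ?eqxx ?orbT //= => _; try exact: closed_no_D.
  + exact: (@path_eta false P false (heta fH)).
  + exact: (@path_mu false P false (hmu fH)).
rewrite /rule2_closed asboolF // pP; exact: path_twin.
Qed.

Let path_closed_D Q : q = Some Q -> nf_closed H p q (Some (path_model true Q)).
Proof.
move=> qQ; case: fixed => _ /=; rewrite (negPf tH) => -[_ _ E].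
have [ID hmu heta] := thr_fix E qQ.
have wg := path_good true Q; have D : hasD (path_model true Q) by apply/path_hasD.
apply/nf_closedP; split=> //.
  move=> f fH; have := notin_I ID fH; rewrite /I_D.
  case Ef : f fH => fH; rewrite ?inE ?eqxx ?orbT //= => _;
    try (by apply: path_D_path; rewrite !inE eqxx ?orbT).
  + by apply: (@path_eta true Q false); apply: heta; rewrite fH.
  + exact: path_lambda.
  + by apply: (@path_eta true Q true); apply: heta; rewrite fH orbT.
  + by apply: (@path_mu true Q false); apply: hmu; rewrite fH.
  + by apply: (@path_mu true Q true); apply: hmu; rewrite fH orbT.
rewrite /rule2_closed asboolT // qQ; exact: path_twin.
Qed.

Let gamma_thr (dd : bool) n : 0 < n -> has_law (U (H, p, q)) (gamma_dd dd n) ->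
  nat_le_thr n (if dd then q else p).
Proof.
move=> n0 hn; apply: contrapT; case E : (if dd then q else p) => [P|] /= /negP //.
rewrite -ltnNge => Pn; apply: (@syntactic_not_gamma _ dd P.+1 _ (@path_not_query dd P)).
  exact: path_body.
apply: (gamma_le (@U_V12 _) _ Pn hn) => //; apply: model_in_U.
by case: dd E {hn} => E; [exact: path_closed_D|exact: path_closed].
Qed.

Lemma fixed_signature_of : signature_of (U (H, p, q)) (H, p, q).
Proof.
split=> /= [f|n n0|n n0].
- by split=> [fH|/law_in//]; exact: (@U_law (H, p, q)).
- by split=> [np|/(@gamma_thr false _ n0)//]; exact: (@U_gamma (H, p, q)).
- by split=> [nq|/(@gamma_thr true _ n0)//]; exact: (@U_gamma_D (H, p, q)).
Qed.

End FixedSignature.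

Lemma fixed_signature s : fixed_points s -> signature_of (U s) s.
Proof.
move: s => [[H p] q] fix_s; have [tH|tH] := boolP (tau \in H); last exact: fixed_signature_of.
have E : (H, p, q) = ([set: f25]%SET, None, None).
  by case: fix_s => _ /= ; rewrite tH => ->.
have th : has_law (U (H, p, q)) (identity_of tau) by exact: (@U_law (H, p, q)).
case: E th => -> -> -> th.
by split=> /= [f|n n0|n n0]; split=> _ //; try exact: tau_law; rewrite inE.
Qed.

Lemma U_inj s s' : fixed_points s -> fixed_points s' -> U s = U s' -> s = s'.
Proof.
move=> fs fs' e; apply: (signature_uniq (fixed_signature fs)).
by rewrite e; exact: fixed_signature.
Qed.

Theorem U_bij : set_bij fixed_points (subvarieties V12) U.
Proof.
split.
- by move=> s _; split; [exact: variety_U|exact: U_V12].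
- by move=> s s' /set_mem fs /set_mem fs'; exact: U_inj.
- move=> K [Kv KV]; have [s hs] := signature_exists KV.
  exists s; first exact: signature_fixed hs.
  by rewrite -(signature_U KV hs).
Qed.

(** * Computation of closures *)

(* [f25_code] cannot be evaluated, because [inord] is opaque. *)
Definition f25_index (f : f25) : nat :=
  match f with
  | rho => 0 | Defs.eta => 1 | omega => 2 | zeta => 3 | lambda => 4
  | eta_D => 5 | omega_D => 6 | zeta_D => 7 | mu => 8 | nu => 9 | mu2 => 10
  | mu_D => 11 | nu_D => 12 | delta => 13 | xi => 14 | beta => 15 | sq => 16
  | chi => 17 | tau => 18 | alpha => 19 | alpha_D => 20 | epsilon => 21
  | kappa => 22 | iota2 => 23 | iota2_D => 24
  end.

Definition has_bit (b : seq bool) (f : f25) : bool := nth false b (f25_index f).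

Definition lookup (e : seq (nat * nat)) (x : nat) : option nat :=
  ohead [seq i.2 | i <- e & i.1 == x].

Definition assign (e : seq (nat * nat)) (x a : nat) : seq (seq (nat * nat)) :=
  if lookup e x is Some b then (if b == a then [:: e] else [::])
  else [:: (x, a) :: e].

Definition matches (w : seq mono) (m : mono) (e : seq (nat * nat)) :
    seq (seq (nat * nat)) :=
  match m with
  | [:: x] => flatten [seq if n is [:: a] then assign e x a else [::] | n <- w]
  | [:: x; y] => flatten [seq if n is [:: a; b] then
        flatten [seq assign e' y b | e' <- assign e x a] ++
        flatten [seq assign e' y a | e' <- assign e x b] else [::] | n <- w]
  | _ => [::]
  end.

Fixpoint homs (w : seq mono) (l : seq mono) (es : seq (seq (nat * nat))) :
    seq (seq (nat * nat)) :=
  if l is m :: l' then homs w l' (flatten [seq matches w m e | e <- es]) else es.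

Definition apply_hom (e : seq (nat * nat)) (x : nat) : nat := odflt 0 (lookup e x).

Definition query_monos (f : f25) : seq mono :=
  if query f is Some t then monos t else [::].

(** The filter makes every listed assignment correct by construction, so only the completeness of
    [homs] has to be proved. *)
Definition triggers (w : seq mono) (f : f25) : seq (seq (nat * nat)) :=
  [seq e <- homs w (monos (body f)) [:: [::]] |
    all (fun m => map_mono (apply_hom e) m \in w) (monos (body f))].

Definition closed1b (w : seq mono) (f : f25) : bool :=
  all (fun e => if query f is Some t then
      all (fun m => map_mono (apply_hom e) m \in w) (monos t) else false)
    (triggers w f).

Definition mark_list (w : seq mono) : seq nat :=
  flatten [seq if n is [:: a] then [:: a] else [::] | n <- w].

Definition edge_list (w : seq mono) : seq (nat * nat) :=
  flatten [seq if n is [:: a; b] then [:: (a, b); (b, a)] else [::] | n <- w].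

(* A label is a component, named by its least vertex, and a class. The labels
   need no correctness proof, since [closedb] checks them against the edges. *)
Definition label := (nat * bool)%type.

Definition label_of (l : seq (nat * label)) (x : nat) : label :=
  odflt (x, false) (ohead [seq i.2 | i <- l & i.1 == x]).

Definition relabel (E : seq (nat * nat)) (l : seq (nat * label)) :=
  foldl (fun l e => let: (a, b) := e in
    let: (c, s) := label_of l a in
    if c < (label_of l b).1 then (b, (c, ~~ s)) :: l else l) l E.

Definition labels (w : seq mono) : seq (nat * label) :=
  let E := edge_list w in iter (size w) (relabel E) [::].

Definition opp_label (l : seq (nat * label)) (x y : nat) : bool :=
  let: (c, s) := label_of l x in let: (d, t) := label_of l y in
  (c == d) && (s != t).

Definition eq_label (l : seq (nat * label)) (x y : nat) : bool :=
  label_of l x == label_of l y.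

Definition neighbours (E : seq (nat * nat)) (x : nat) : seq nat :=
  [seq e.2 | e <- E & e.1 == x].

(** Sound but not exhaustive: the environment rule is tried on walks of length 3, and rule 2 on
    pairs at distance 2, which every positive threshold permits. *)
Definition derive_step (P Q : bool) (A : seq f25) (w : seq mono) : seq mono :=
  let E := edge_list w in let M := mark_list w in
  let k := P || Q && has (fun e => (e.1 \in M) && (e.2 \in M)) E in
  let two := flatten [seq [seq (x, b) | b <- flatten [seq neighbours E a |
    a <- neighbours E x]] | x <- M] in
  undup (w ++
    flatten [seq [seq mk_mono [:: i.1; y] | y <- neighbours E i.2 & y \in M] | i <- two] ++
    (if k then flatten [seq [seq mk_mono [:: i.1; y] | y <- neighbours E i.2] |
      i <- two & i.2 \in M] else [::]) ++
    flatten [seq [seq map_mono (apply_hom e) m | e <- triggers w f, m <- query_monos f] |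
      f <- A]).

Fixpoint saturate (fuel : nat) (P Q : bool) (H : seq f25) (w : seq mono) : seq mono :=
  if fuel is k.+1 then
    let w' := derive_step P Q H w in
    if size w' == size w then w else saturate k P Q H w'
  else w.

(** Rule 2 is tested at every distance inside a class, so that one set serves all positive
    thresholds. *)
Definition closedb (P Q : bool) (H : seq f25) (w : seq mono) : bool :=
  let l := labels w in let E := edge_list w in let M := mark_list w in
  let pairs := [seq (x, y) | x <- M, y <- M] in
  [&& all (fun n => match n with [:: _] => true | [:: a; b] => a < b | _ => false end) w,
      all (fun e => opp_label l e.1 e.2) E,
      all (fun i => opp_label l i.1 i.2 ==> (mk_mono [:: i.1; i.2] \in w)) pairs,
      P || Q && has (fun i => opp_label l i.1 i.2) pairs ==>
        all (fun i => eq_label l i.1 i.2 ==>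
          all (fun e => (e.1 == i.2) ==> (mk_mono [:: i.1; e.2] \in w)) E) pairs
    & all (closed1b w) H].

Definition refutes (P Q : bool) (H : seq f25) (f : f25) : bool :=
  (* The fuel needs no justification: a result that is not closed fails [closedb]. *)
  let w := saturate 20 P Q H (monos (body f)) in
  [&& closedb P Q H w, all (fun m => m \in w) (monos (body f))
    & if query f is Some t then ~~ all (fun m => m \in w) (monos t) else true].

Definition condition := (bool * bool)%type.
Definition IfP : condition := (true, false).
Definition IfQ : condition := (false, true).

(* Generators of the implications between the identities; [IfQ] (resp. [IfP])
   marks those which need gamma_1^D (resp. gamma_1). *)
Definition implications : seq (seq f25 * f25 * condition) := [::
  ([::], epsilon, IfQ); ([:: eta_D], mu_D, IfQ); ([:: eta_D], alpha_D, IfQ);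
  ([:: Defs.eta], mu, IfP); ([:: Defs.eta], alpha, IfP)] ++
  [seq (i, (false, false)) | i <- [::
  ([:: rho], zeta); ([:: rho], delta); ([:: Defs.eta], eta_D);
  ([:: omega], Defs.eta); ([:: omega], omega_D); ([:: omega], mu);
  ([:: zeta], omega); ([:: zeta], zeta_D); ([:: lambda], mu2);
  ([:: lambda], kappa); ([:: eta_D], lambda); ([:: omega_D], eta_D);
  ([:: omega_D], mu_D); ([:: zeta_D], omega_D); ([:: zeta_D], nu_D);
  ([:: mu], mu_D); ([:: nu], mu); ([:: nu], nu_D); ([:: nu], alpha);
  ([:: mu2], epsilon); ([:: mu_D], mu2); ([:: mu_D], kappa); ([:: nu_D], mu_D);
  ([:: nu_D], alpha_D); ([:: delta], nu); ([:: xi], zeta_D); ([:: beta], xi);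
  ([:: sq], omega); ([:: sq], beta); ([:: chi], rho); ([:: chi], xi);
  ([:: alpha], alpha_D); ([:: alpha_D], kappa); ([:: kappa], epsilon);
  ([:: iota2], mu); ([:: iota2], iota2_D); ([:: iota2_D], mu_D);
  ([:: rho; xi], chi); ([:: Defs.eta; mu], alpha); ([:: beta; Defs.eta], mu);
  ([:: alpha; Defs.eta], mu); ([:: omega; zeta_D], zeta);
  ([:: nu_D; omega], nu); ([:: omega; xi], sq); ([:: eta_D; mu_D], alpha_D);
  ([:: alpha_D; eta_D], mu_D); ([:: alpha; mu], iota2);
  ([:: alpha_D; mu_D], iota2_D)]].

Definition active (P Q : bool) (c : condition) : bool :=
  (c.1 ==> P) && (c.2 ==> Q).

(** Meant for prefixes: an implication counts as violated only once the bit of its conclusion is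
    decided, so [closed_bits] can prune early. The sets containing [tau] are treated separately. *)
Definition respects (P Q : bool) (b : seq bool) : bool :=
  ~~ has_bit b tau &&
  all (fun i => let: (A, f, c) := i in
    ~~ [&& active P Q c, all (has_bit b) A, f25_index f < size b & ~~ has_bit b f])
  implications.

Fixpoint closed_bits (P Q : bool) (n : nat) : seq (seq bool) :=
  if n is k.+1 then
    [seq b <- flatten [seq [:: rcons b true; rcons b false] | b <- closed_bits P Q k]
      | respects P Q b]
  else [:: [::]].

Arguments closed_bits : simpl never.

Definition members (b : seq bool) : seq f25 := [seq f <- f25_enum | has_bit b f].

Definition sub_bits (b c : seq bool) : bool := all (has_bit c) (members b).

(* It is enough to refute [f] over the maximal closed sets that avoid it. *)
Definition refutes_all (B : seq (seq bool)) (P Q : bool) : bool :=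
  all (fun f => let s := [seq b <- B | ~~ has_bit b f] in
    let t := [seq b <- s | ~~ has (fun c => sub_bits b c && ~~ sub_bits c b) s] in
    all (fun b => refutes P Q (members b) f) t && all (fun b => has (sub_bits b) t) s)
  f25_enum.

(** The last two alternatives detect that the closure is 0, through a square or through an identity
    with a square query. *)
Definition derivesb (P Q : bool) (A : seq f25) (f : f25) : bool :=
  let w := saturate 20 P Q A (monos (body f)) in
  [|| if query f is Some t then all (fun m => m \in w) (monos t) else false,
      has (fun n => if n is [:: a; b] then a == b else false) w
    | has (fun g => if query g is None then ~~ nilp (triggers w g) else false) A].

Definition implications_derivable : bool :=
  all (fun i => let: (A, f, c) := i in derivesb c.1 c.2 A f) implications.

Lemma lookup_cons x a e y :
  lookup ((x, a) :: e) y = if x == y then Some a else lookup e y.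
Proof. by rewrite /lookup /=; case: eqP. Qed.

Definition is_restriction (r : nat -> nat) (e : seq (nat * nat)) (D : pred nat) :=
  forall y, lookup e y = if D y then Some (r y) else None.

Lemma assign_complete r e D x : is_restriction r e D ->
  exists2 e', e' \in assign e x (r x) & is_restriction r e' (predU1 x D).
Proof.
move=> h; rewrite /assign h; case Dx : (D x).
  rewrite eqxx; exists e; first by rewrite inE.
  by move=> y; rewrite h /=; case: eqP => // ->; rewrite Dx.
exists ((x, r x) :: e); first by rewrite inE.
by move=> y; rewrite lookup_cons h /= [y == x]eq_sym; case: eqP => [->|].
Qed.

Lemma matches_complete r w m e D : is_restriction r e D -> 0 < size m <= 2 ->
  map_mono r m \in w ->
  exists2 e', e' \in matches w m e & is_restriction r e' [predU (mem m) & D].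
Proof.
move=> h; case: m => [|x [|y [|z m]]] // _ mw.
  have [e' e'i he'] := assign_complete x h.
  exists e'; last by move=> y; rewrite he' /= inE.
  by apply/flatten_mapP; exists [:: r x].
have [e1 e1i h1] := assign_complete x h; have [e2 e2i h2] := assign_complete y h1.
exists e2; last by move=> z; rewrite h2 /= !inE orbCA orbA.
apply/flatten_mapP; exists (map_mono r [:: x; y]) => //.
rewrite /map_mono /= mk_mono2; case: ifP => _; rewrite mem_cat; apply/orP; [left|right];
  by apply/flatten_mapP; exists e1.
Qed.

Lemma homs_complete r w l es e D : is_restriction r e D -> e \in es ->
  (forall m, m \in l -> 0 < size m <= 2 /\ map_mono r m \in w) ->
  exists2 e', e' \in homs w l es & is_restriction r e' [predU (mem (flatten l)) & D].
Proof.
elim: l es e D => [|m l IH] es e D h ei hl; first by exists e.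
have [sm mw] := hl m (mem_head _ _).
have [e1 e1i h1] := matches_complete h sm mw.
have [|m' m'l|e' e'i he'] := IH (flatten [seq matches w m e | e <- es]) _ _ h1.
- by apply/flatten_mapP; exists e.
- by apply: hl; rewrite inE m'l orbT.
by exists e' => // y; rewrite he' /= !inE mem_cat orbCA orbA.
Qed.

Lemma body_sizes f m : f <> tau -> m \in monos (body f) -> 0 < size m <= 2.
Proof.
move=> ft; have : all (fun m : mono => 0 < size m <= 2) (monos (body f)).
  by case: f ft => ft; vm_compute.
by move/allP; apply.
Qed.

Lemma query_vars f y : f <> tau -> y \in flatten (query_monos f) ->
  y \in flatten (monos (body f)).
Proof.
move=> ft; have : all (fun y => y \in flatten (monos (body f))) (flatten (query_monos f)).
  by case: f ft => ft; vm_compute.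
by move/allP; apply.
Qed.

Definition mono_set (w : seq mono) : set mono := [set m | m \in w].

Lemma closed1bP w f : f <> tau -> closed1b w f -> closed1 (mono_set w) f.
Proof.
move=> ft /allP cb r hr.
have [|m mi|e ei he] := @homs_complete r w (monos (body f)) [:: [::]] [::] pred0 _ (mem_head _ _).
- by move=> y.
- by split; [exact: body_sizes mi|exact: hr].
have heq m : {subset m <= flatten (monos (body f))} ->
    map_mono (apply_hom e) m = map_mono r m.
  move=> hm; congr mk_mono; apply/eq_in_map => y /hm yb.
  by rewrite /apply_hom he /= yb.
have /cb : e \in triggers w f.
  rewrite mem_filter ei andbT; apply/allP => m mi; rewrite heq; first exact: hr.
  by move=> y ym; apply/flattenP; exists m.
rewrite /query_in; case E : (query f) => [t|//] /allP h m mi.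
rewrite -heq; first exact: h.
by move=> y ym; apply: query_vars ft _; rewrite /query_monos E; apply/flattenP; exists m.
Qed.

Lemma mem_mark_list w x : (x \in mark_list w) = ([:: x] \in w).
Proof.
apply/flatten_mapP/idP => [[[|a [|? ?]] // ni]|h]; first by rewrite inE => /eqP->.
by exists [:: x] => //; rewrite inE.
Qed.

Lemma mem_edge_list w x y :
  reflect ([:: x; y] \in w \/ [:: y; x] \in w) ((x, y) \in edge_list w).
Proof.
apply: (iffP idP) => [/flatten_mapP[[|a [|b [|? ?]]] // ni]|h].
  by rewrite !inE => /orP[] /eqP[-> ->]; auto.
apply/flatten_mapP; case: h => h; [exists [:: x; y] => //|exists [:: y; x] => //];
  by rewrite !inE eqxx ?orbT.
Qed.

Section Closedb.
Variables (P Q : bool) (Hl : seq f25) (w : seq mono) (H : {set f25}) (p q : threshold).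
Hypothesis cb : closedb P Q Hl w.
Hypothesis tH : tau \notin H.
Hypothesis HHl : forall f, f \in H -> f \in Hl.
Hypothesis pP : p != Some 0 -> P.
Hypothesis qQ : q != Some 0 -> Q.

Let lab := label_of (labels w).
Let W := mono_set w.

Let edge_opp x y : adj W x y -> opp_label (labels w) x y.
Proof.
move: cb => /and5P[_ /allP h _ _ _] /adj_mono xy.
have : (x, y) \in edge_list w.
  by apply/mem_edge_list; move: xy; rewrite mk_mono2; case: ifP; auto.
by move/h.
Qed.

Let edge_lab x y : adj W x y -> (lab x).1 = (lab y).1 /\ (lab y).2 = ~~ (lab x).2.
Proof.
move/edge_opp; rewrite /opp_label /lab.
case: (label_of _ x) (label_of _ y) => [a s] [b t] /andP[/eqP-> st]; split=> //=.
by move: st; case: s; case: t.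
Qed.

Let lab_coloring : coloring W (fun x => (lab x).2).
Proof. by move=> x y /edge_lab[]. Qed.

Let lab_walk n x y : walk W n x y -> (lab x).1 = (lab y).1.
Proof.
elim: n x => [|n IH] x; first by move/walk0->.
by move=> /walkS[z /edge_lab[-> _] /IH].
Qed.

Let opp_class x y : opposite_class W x y -> opp_label (labels w) x y.
Proof.
case=> n on wk; rewrite /opp_label -/(lab x) -/(lab y).
have := coloring_walk lab_coloring wk; have := lab_walk wk; rewrite on.
by case: (lab x) (lab y) => [a s] [b t] /= -> ->; rewrite eqxx; case: s.
Qed.

Let same_classl x y : same_class W x y -> eq_label (labels w) x y.
Proof.
case=> n on wk; rewrite /eq_label -/(lab x) -/(lab y).
have := coloring_walk lab_coloring wk; have := lab_walk wk; rewrite (negPf on) addFb.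
by case: (lab x) (lab y) => [a s] [b t] /= -> ->.
Qed.

Let pair_in x y : marked W x -> marked W y ->
  (x, y) \in [seq (x, y) | x <- mark_list w, y <- mark_list w].
Proof.
move=> [mx _] [my _]; apply/allpairsP; exists (x, y).
by rewrite !mem_mark_list.
Qed.

Lemma closedb_good : good W.
Proof.
move: cb => /and5P[/allP hs _ /allP he _ _]; apply/goodP; split.
  case=> [[x /hs]|[m /hs]|]; first by rewrite ltnn.
    by case: m => [|? [|? []]].
  exact: coloring_no_odd lab_coloring.
move=> x y mx my /opp_class o.
by have := he _ (pair_in mx my); rewrite o.
Qed.

Lemma closedb_nf : nf_closed H p q (Some W).
Proof.
have Wg := closedb_good; apply/nf_closedP; split=> //.
  move=> f fH; apply: closed1bP; first by move=> ft; move: tH; rewrite -ft fH.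
  by move: cb => /and5P[_ _ _ _ /allP]; apply; exact: HHl.
rewrite /rule2_closed => x x' y mx mx' [sc hk] x'y.
have [k0|k0] := eqVneq (if `[< has_D_component W >] then q else p) (Some 0).
  move: hk; rewrite k0 => -[d]; rewrite muln0 leqn0 => /eqP-> /walk0->.
  exact: x'y.
have act : P || Q && has (fun i => opp_label (labels w) i.1 i.2)
    [seq (x, y) | x <- mark_list w, y <- mark_list w].
  move: k0; case: asboolP => [[a [b [ma mb o]]] /qQ->|_ /pP->//].
  by apply/orP; right; apply/hasP; exists (a, b); [exact: pair_in|exact: opp_class].
move: cb => /and5P[_ _ _]; rewrite act => /allP h _.
have := h _ (pair_in mx mx'); rewrite /= (same_classl sc) => /allP/(_ (x', y)).
rewrite /= eqxx => g; apply: (good_edge Wg); apply: g.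
by apply/mem_edge_list; move/adj_mono: x'y; rewrite mk_mono2; case: ifP; auto.
Qed.

End Closedb.

Lemma refutesP P Q Hl (H : {set f25}) f p q : refutes P Q Hl f -> tau \notin H ->
  (forall f, f \in H -> f \in Hl) -> (p != Some 0 -> P) -> (q != Some 0 -> Q) ->
  ~ derives H p q f.
Proof.
move=> /and3P[cb hb hq] tH HHl pP qQ /derivesP-/(_ tH) h.
have {}h := h (mono_set _) _ (closedb_nf cb tH HHl pP qQ).
move: h; rewrite /query_in; case: (query f) hq => [t|] hq h; last first.
  by apply: h => m mi; exact: (allP hb).
move/negP: hq; apply; apply/allP => m mi.
have := h (fun m mi => allP hb m mi) m mi.
by rewrite (map_mono_id mi).
Qed.

(** * Correctness of the computed derivations *)

Section Derivesb.
Variables (P Q : bool) (A : seq f25) (G : set mono).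
Hypothesis Gg : good G.
Hypothesis hA : forall g, g \in A -> closed1 G g.
Hypothesis hP : P -> forall x x' y, marked G x -> marked G x' -> walk G 2 x x' ->
  adj G x' y -> adj G x y.
Hypothesis hQ : Q -> hasD G -> forall x x' y, marked G x -> marked G x' ->
  walk G 2 x x' -> adj G x' y -> adj G x y.

Let ok (w : seq mono) := forall m, m \in w -> G m /\ sorted leq m.

Let edge_ok w x y : ok w -> (x, y) \in edge_list w -> adj G x y.
Proof.
move=> h /mem_edge_list[] /h[Gm sm]; first by apply: (good_edge Gg); rewrite mk_mono_id.
by apply: (good_edge Gg); rewrite mk_monoC mk_mono_id.
Qed.

Let nbr_ok w x y : ok w -> y \in neighbours (edge_list w) x -> adj G x y.
Proof.
move=> h /mapP[[a b]]; rewrite mem_filter => /andP[/= /eqP-> ab] ->.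
exact: edge_ok h ab.
Qed.

Let trigger_ok w f e : ok w -> e \in triggers w f ->
  forall m, m \in monos (body f) -> G (map_mono (apply_hom e) m).
Proof.
move=> h; rewrite mem_filter => /andP[/allP he _] m /he/h[]//.
Qed.

Let step_ok w : ok w -> ok (derive_step P Q A w).
Proof.
move=> h m; rewrite mem_undup !mem_cat => /or4P[/h//| | |].
- move=> /flatten_mapP[[x b] /flatten_mapP[a aM /mapP[b' /flatten_mapP[c ac cb'] [-> ->]]]].
  move=> /mapP[y]; rewrite mem_filter => /andP[yM yb] ->; split; last exact: mk_mono_sorted.
  have xa := nbr_ok h ac; have ab := nbr_ok h cb'; have by_ := nbr_ok h yb.
  have Ga : G [:: a] by rewrite mem_mark_list in aM; case: (h _ aM).
  have Gy : G [:: y] by rewrite mem_mark_list in yM; case: (h _ yM).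
  case/goodP: Gg => _; apply; first exact: marked_adj xa.
    by apply: marked_adj Gy _; rewrite adj_sym; exact: by_.
  exists 3 => //; apply/walkS; exists c => //; apply/walkS; exists b' => //.
  exact/walk1.
- case: ifP => // act.
  move=> /flatten_mapP[[x b]]; rewrite mem_filter => /andP[/= bM].
  move=> /flatten_mapP[a aM /mapP[b' /flatten_mapP[c ac cb'] [-> bE]]]; rewrite bE in bM *.
  move=> /mapP[y yb ->]; split; last exact: mk_mono_sorted.
  have xa := nbr_ok h ac; have ab := nbr_ok h cb'; have by_ := nbr_ok h yb.
  have Ga : G [:: a] by rewrite mem_mark_list in aM; case: (h _ aM).
  have Gb : G [:: b'] by rewrite mem_mark_list in bM; case: (h _ bM).
  have ma := marked_adj Ga xa; have mb := marked_adj Gb by_.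
  have wk : walk G 2 a b' by apply/walkS; exists c => //; exact/walk1.
  apply: adj_mono; case/orP: act => [Pt|/andP[Qt /hasP[[s t] st /= /andP[sM tM]]]].
    exact: (hP Pt ma mb wk by_).
  apply: (hQ Qt _ ma mb wk by_); have ast := edge_ok h st.
  exists s, t; split; last by exists 1 => //; exact/walk1.
    by apply: marked_adj ast; rewrite mem_mark_list in sM; case: (h _ sM).
  rewrite adj_sym in ast.
  by apply: marked_adj ast; rewrite mem_mark_list in tM; case: (h _ tM).
- move=> /flatten_mapP[f fA /allpairsP[[e n] /= [ei ni ->]]].
  split; last exact: mk_mono_sorted.
  have := hA fA (trigger_ok h ei); rewrite /query_in; move: ni; rewrite /query_monos.
  by case: (query f) => [t|] // ni; apply.
Qed.

Let saturate_ok k w : ok w -> ok (saturate k P Q A w).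
Proof.
elim: k w => //= k IH w h; case: ifP => // _; apply: IH; exact: step_ok.
Qed.

Lemma derivesbP f : ok (monos (body f)) -> derivesb P Q A f -> query_in id f G.
Proof.
move=> /(@saturate_ok 20); rewrite /derivesb; move: (saturate _ _ _ _ _) => w h.
case/or3P=> [|/hasP[[|a [|b []]] // ni /eqP ab]|/hasP[g gA]].
- rewrite /query_in; case: (query f) => // t /allP hq m mi.
  by rewrite (map_mono_id mi); case: (h m (hq m mi)).
- by exfalso; apply: (@good_nsquare _ Gg a); rewrite -ab in ni; case: (h _ ni).
- case Eq : (query g) => [//|]; case: (triggers w g) (@trigger_ok w g) => // e es te _.
  by have := hA gA (te e h (mem_head _ _)); rewrite /query_in Eq.
Qed.

End Derivesb.

(** * Enumeration of the legal sets *)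

Lemma implications_derivable_true : implications_derivable.
Proof. by vm_compute. Qed.

Lemma f25_index_nth f : nth rho f25_enum (f25_index f) = f.
Proof. by case: f. Qed.

Lemma f25_index_lt f : f25_index f < 25.
Proof. by case: f. Qed.

Lemma f25_enum_mem f : f \in f25_enum.
Proof. by rewrite -(f25_index_nth f); apply: mem_nth; exact: f25_index_lt. Qed.

Lemma mem_members b f : (f \in members b) = has_bit b f.
Proof. by rewrite mem_filter f25_enum_mem andbT. Qed.

Lemma sub_bitsP b c : sub_bits b c -> {subset members b <= members c}.
Proof.
rewrite /sub_bits => /allP h f fb; rewrite [f \in members c]mem_members; exact: h fb.
Qed.

Lemma refutes_allP B P Q b f : refutes_all B P Q -> b \in B -> ~~ has_bit b f ->
  exists2 c, {subset members b <= members c} & refutes P Q (members c) f.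
Proof.
move=> /allP/(_ f (f25_enum_mem f))/andP[/allP hr /allP hc] bB nf.
have /hc/hasP[c ci /sub_bitsP bc] : b \in [seq b <- B | ~~ has_bit b f].
  by rewrite mem_filter nf.
by exists c => //; exact: hr.
Qed.

(** Certifies that [implications] is complete: a set closed under it derives no identity outside
    itself. *)
Lemma closed_bits_refutes P Q : P ==> Q -> refutes_all (closed_bits P Q 25) P Q.
Proof.
case: P; case: Q; move=> PQ; first [case: (notF PQ)|vm_compute; reflexivity].
Qed.

Definition bits (H : {set f25}) : seq bool := [seq f \in H | f <- f25_enum].

Definition set_of_bits (b : seq bool) : {set f25} := [set f | has_bit b f]%SET.

Lemma size_bits H : size (bits H) = 25. Proof. by rewrite size_map. Qed.

Lemma has_bits H f : has_bit (bits H) f = (f \in H).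
Proof.
by rewrite /has_bit (nth_map rho) ?f25_index_lt // f25_index_nth.
Qed.

Lemma bitsK : cancel bits set_of_bits.
Proof. by move=> H; apply/finset.setP => f; rewrite inE has_bits. Qed.

Lemma set_of_bitsK b : size b = 25 -> bits (set_of_bits b) = b.
Proof.
move=> sb; apply: (@eq_from_nth _ false); rewrite ?size_bits // => i i25.
have iE : f25_index (nth rho f25_enum i) = i.
  by do 25 (case: i i25 => [//|i i25]).
by rewrite -{1 2}iE -/(has_bit _ _) has_bits inE /has_bit iE.
Qed.

Lemma respects_take P Q b n : respects P Q b -> respects P Q (take n b).
Proof.
have ht f : has_bit (take n b) f -> has_bit b f.
  rewrite /has_bit; have [i|i] := ltnP (f25_index f) (size (take n b)).
    by rewrite nth_take //; apply: leq_trans i _; rewrite size_take; case: ltnP => // /ltnW.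
  by rewrite nth_default.
move=> /andP[tb /allP hb]; apply/andP; split; first by apply: contra tb; exact: ht.
apply/allP => -[[A f] c] ii; apply: contra (hb _ ii) => /and4P[ac /allP hA sf nf].
apply/and4P; split=> //; first by apply/allP => g /hA/ht.
  by apply: leq_trans sf _; rewrite size_take; case: ltnP => // /ltnW.
apply: contra nf; rewrite /has_bit nth_take //.
by apply: leq_trans sf _; rewrite size_take; case: ltnP.
Qed.

Lemma closed_bits_complete P Q b n : respects P Q b -> n <= size b ->
  take n b \in closed_bits P Q n.
Proof.
move=> rb; elim: n => [|n IH] nb; first by rewrite take0 inE.
rewrite mem_filter respects_take //=; apply/flatten_mapP.
exists (take n b); first exact: IH (ltnW nb).
by rewrite (take_nth false nb) !inE; case: nth; rewrite eqxx ?orbT.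
Qed.

Lemma closed_bits_sound P Q n b : b \in closed_bits P Q n.+1 ->
  respects P Q b /\ size b = n.+1.
Proof.
have sz k c : c \in closed_bits P Q k -> size c = k.
  elim: k c => [|k IH] c; first by rewrite inE => /eqP->.
  rewrite mem_filter => /andP[_ /flatten_mapP[d /IH sd]].
  by rewrite !inE => /orP[] /eqP->; rewrite size_rcons sd.
by move=> bi; split; [move: bi; rewrite mem_filter => /andP[]|exact: sz].
Qed.

(** A set that equals its own consequences respects the implications because these are derivable;
    conversely, each identity outside a respecting set is refuted over some larger set that still
    avoids it. *)
Lemma derives_respects (H : {set f25}) p q : thr_le p q -> tau \notin H ->
  (H = [set f | `[< derives H p q f >]]%SET) <->
  bits H \in closed_bits (p != Some 0) (q != Some 0) 25.
Proof.
move=> pq tH; have dH f : derives H p q f <-> (f \in H) \/ derives H p q f.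
  split; first by right.
  case=> // fH; apply/derivesP => // w hw /nf_closedP[_ h1 _].
  exact: closed1_id (h1 f fH) hw.
have pos (r : threshold) : r != Some 0 -> nat_le_thr 1 r by case: r => [[|n]|].
have pq0 : (p != Some 0) ==> (q != Some 0).
  by apply/implyP; move: pq; clear; case: p => [[|m]|]; case: q => [[|n]|].
split=> [HE|bi].
- rewrite -[bits H](take_size) size_bits; apply: closed_bits_complete; last by rewrite size_bits.
  apply/andP; split; first by rewrite has_bits.
  apply/allP => -[[A f] c] ii; apply/negP => /and4P[ac /allP hA _].
  rewrite has_bits HE inE => /negP; apply; apply/asboolP/derivesP => // w hw.
  move=> /nf_closedP[wg h1 h2].
  have := allP implications_derivable_true _ ii.
  have twin k : (if `[< has_D_component w >] then q else p) = k -> nat_le_thr 1 k ->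
      forall x x' y, marked w x -> marked w x' -> walk w 2 x x' -> adj w x' y -> adj w x y.
    move=> kE k1 x x' y mx mx' wk; apply: h2 => //; rewrite kE; split; first by exists 2.
    by case: (k) k1 => // m m1; exists 2 => //; rewrite (leq_mul2l 2 1).
  apply: (derivesbP wg).
  + by move=> g /hA; rewrite has_bits => /h1.
  + move=> c1; move: ac => /andP[/implyP/(_ c1) p0 _]; apply: (twin _ erefl).
    by case: asboolP => _; apply: pos => //; exact: (implyP pq0).
  + move=> c2 D; move: ac => /andP[_ /implyP/(_ c2) q0]; apply: (twin _ erefl).
    by rewrite asboolT //; exact: pos.
  + by move=> m mi; split; [exact: hw|exact: monos_sorted mi].
- apply/finset.setP => f; rewrite inE; apply/idP/asboolP => [fH|/[dup] df]; first by apply/dH; left.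
  apply: contraPT => nf.
  have nfb : ~~ has_bit (bits H) f by rewrite has_bits.
  have [c bc rc] := refutes_allP (closed_bits_refutes pq0) bi nfb.
  have Hc g : g \in H -> g \in members c.
    by move=> gH; apply: bc; rewrite mem_members has_bits.
  exact: (refutesP rc tH Hc).
Qed.

(** An infinite threshold is always fixed, and a finite one enters only through its positivity. This
    is what leaves six regions. *)
Definition threshold_fits (b : seq bool) (finite positive : bool) (I : seq f25)
    (etas mus : seq f25) : bool :=
  finite ==> [&& ~~ has (has_bit b) I,
    ~~ (has (has_bit b) etas && (positive || has (has_bit b) mus)) &
    has (has_bit b) mus ==> positive].

Definition I_0_list := [:: rho; omega; zeta; delta; nu; alpha; beta; sq; chi; tau; iota2].
Definition I_D_list := I_0_list ++ [:: omega_D; zeta_D; nu_D; alpha_D; xi; iota2_D].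

(** The added list is the signature of the trivial variety, which satisfies [tau] and has both
    thresholds infinite. *)
Definition legal_bits (P Q finP finQ : bool) : seq (seq bool) :=
  [seq b <- closed_bits P Q 25 |
    threshold_fits b finP P I_0_list [:: Defs.eta] [:: mu] &&
    threshold_fits b finQ Q I_D_list [:: Defs.eta; eta_D] [:: mu; mu_D]] ++
  (if finP || finQ then [::] else [:: nseq 25 true]).

Lemma threshold_fitsP (H I : {set f25}) (r : threshold) Il etas mus :
  (forall f, (f \in I) = (f \in Il)) ->
  let a := thr_max r (has (has_bit (bits H)) mus) in
  (if (H :&: I != finset.set0)%SET || has (has_bit (bits H)) etas && nat_le_thr 1 a
   then None else a) = r <->
  threshold_fits (bits H) (r != None) (r != Some 0) Il etas mus.
Proof.
move=> hI a; rewrite /threshold_fits.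
have -> : has (has_bit (bits H)) Il = (H :&: I != finset.set0)%SET.
  apply/hasP/finset.set0Pn => [[f fI]|[f]].
    by rewrite has_bits => fH; exists f; rewrite finset.in_setI fH hI.
  by rewrite finset.in_setI => /andP[fH fI]; exists f; rewrite ?has_bits // -hI.
case: r @a => [k|] /=; last by rewrite if_same.
case: (_ != finset.set0) => //=; case: (has _ etas); case: (has _ mus) => //=;
  case: k => [|k]; rewrite ?max0n ?maxn0 ?(maxn_idPr _) //=; split=> // -[].
Qed.

Lemma I_0_listE f : (f \in I_0) = (f \in I_0_list).
Proof. by rewrite inE. Qed.

Lemma I_D_listE f : (f \in I_D) = (f \in I_D_list).
Proof. by rewrite /I_D finset.in_setU I_0_listE mem_cat; congr (_ || _); rewrite inE. Qed.

Lemma bits_setT : bits [set: f25]%SET = nseq 25 true.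
Proof.
by rewrite /bits (@eq_map _ _ _ (fun=> true)) // => f; exact: finset.in_setT.
Qed.

Lemma fixed_points_bits (H : {set f25}) p q : fixed_points (H, p, q) <->
  thr_le p q /\
  bits H \in legal_bits (p != Some 0) (q != Some 0) (p != None) (q != None).
Proof.
rewrite /legal_bits mem_cat mem_filter.
have htau : bits H \in closed_bits (p != Some 0) (q != Some 0) 25 -> tau \notin H.
  by move/closed_bits_sound => [/andP[+ _] _]; rewrite has_bits.
split=> -[pq /= hC]; split=> //.
- move: hC; case: (boolP (tau \in H)) => [tH [<- <- <-]|tH [HE pE qE]].
    by apply/orP; right; rewrite bits_setT; exact: mem_head.
  apply/orP; left; apply/andP; split; last by apply/derives_respects.
  apply/andP; split.
    apply/(threshold_fitsP _ _ _ _ I_0_listE); rewrite /= !orbF !has_bits.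
    exact: pE.
  apply/(threshold_fitsP _ _ _ _ I_D_listE); rewrite /= !orbF !has_bits.
  exact: qE.
- case/orP: hC => [/andP[/andP[hp hq] hb]|].
    have tH := htau hb; rewrite /= (negPf tH); congr (_, _, _).
    + by apply/esym/derives_respects.
    + move/(threshold_fitsP _ _ _ _ I_0_listE): hp; rewrite /= !orbF !has_bits.
      exact.
    + move/(threshold_fitsP _ _ _ _ I_D_listE): hq; rewrite /= !orbF !has_bits.
      exact.
  case: p q pq {htau} => [m|] [n|] //= _; rewrite inE => /eqP hb.
  have -> : H = [set: f25]%SET by rewrite -(bitsK H) -(bitsK [set: f25]%SET) hb bits_setT.
  by rewrite /= finset.in_setT.
Qed.

Lemma legal_bits_size P Q fP fQ b : b \in legal_bits P Q fP fQ -> size b = 25.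
Proof.
rewrite mem_cat mem_filter => /orP[/andP[_ /closed_bits_sound[]]//|].
by case: ifP => // _; rewrite inE => /eqP->.
Qed.

Definition legal_family (P Q fP fQ : bool) : {set {set f25}} :=
  [set H | bits H \in legal_bits P Q fP fQ]%SET.

Lemma card_legal_family P Q fP fQ : uniq (legal_bits P Q fP fQ) ->
  #|legal_family P Q fP fQ| = size (legal_bits P Q fP fQ).
Proof.
move=> ub; rewrite -(size_map set_of_bits); rewrite -(card_uniqP _).
  apply: eq_card => H; rewrite inE; apply/idP/mapP => [h|[b bi ->]].
    by exists (bits H); rewrite ?bitsK.
  by rewrite set_of_bitsK //; exact: legal_bits_size bi.
rewrite map_inj_in_uniq // => b c /legal_bits_size sb /legal_bits_size sc e.
by rewrite -(set_of_bitsK sb) e set_of_bitsK.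
Qed.

Lemma legal_setsE p q : thr_le p q ->
  legal_sets p q = legal_family (p != Some 0) (q != Some 0) (p != None) (q != None).
Proof.
move=> pq; apply/finset.setP => H; rewrite !inE.
by apply/asboolP/idP => [/fixed_points_bits[]|h]; last by apply/fixed_points_bits.
Qed.

(** The flags say whether p and q are nonzero, and then whether they are finite. *)
Definition region_counts : seq (bool * bool * bool * bool * nat) :=
  [:: (false, false, true, true, 8); (false, true, true, true, 7);
      (false, true, true, false, 28); (true, true, true, true, 9);
      (true, true, true, false, 36); (true, true, false, false, 117)].

Lemma legal_bits_counts : all (fun i => let: (P, Q, fP, fQ, n) := i in
  uniq (legal_bits P Q fP fQ) && (size (legal_bits P Q fP fQ) == n)) region_counts.
Proof. by vm_compute. Qed.

Lemma card_legal P Q fP fQ n : (P, Q, fP, fQ, n) \in region_counts ->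
  #|legal_family P Q fP fQ| = n.
Proof. by move=> /(allP legal_bits_counts)/andP[/card_legal_family-> /eqP]. Qed.

(* Otherwise [done] would evaluate the enumeration. *)
Opaque legal_bits.

Lemma card_image_seq (T : eqType) (X : Type) (s : seq T) (F : T -> X) n :
  uniq s -> size s = n -> (forall x y, x \in s -> y \in s -> F x = F y -> x = y) ->
  [set z | exists2 x, x \in s & z = F x] #= `I_n.
Proof.
move=> us <- Finj; case: s us Finj => [|x0 s'] us Finj.
  suff -> : [set z | exists2 x, x \in [::] & z = F x] = set0 by rewrite II0.
  by apply/seteqP; split=> // z [].
set s := x0 :: s' in us Finj *.
have -> : [set z | exists2 x, x \in s & z = F x] = (F \o nth x0 s) @` `I_(size s).
  apply/seteqP; split=> z /=.
    by case=> x xs ->; exists (index x s); [move: xs; rewrite -index_mem|rewrite /= nth_index].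
  by case=> i /= si <-; exists (nth x0 s i) => //; exact: mem_nth.
apply: inj_card_eq => i j /set_mem si /set_mem sj e.
have {si}si : i < size s by []. have {sj}sj : j < size s by [].
have /eqP := Finj _ _ (mem_nth x0 si) (mem_nth x0 sj) e.
by rewrite nth_uniq // => /eqP.
Qed.

Lemma census_legal (region : threshold -> threshold -> Prop) P Q fP fQ n :
  (P, Q, fP, fQ, n) \in region_counts ->
  (forall p q, region p q -> thr_le p q /\
     (p != Some 0, q != Some 0, p != None, q != None) = (P, Q, fP, fQ)) ->
  census region n.
Proof.
move=> /card_legal cn h; exists (legal_family P Q fP fQ); split=> // p q.
by move=> /h[pq [<- <- <- <-]]; exact: legal_setsE.
Qed.

Lemma fixed_legal (H : {set f25}) p q : fixed_points (H, p, q) <-> thr_le p q /\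
  H \in legal_family (p != Some 0) (q != Some 0) (p != None) (q != None).
Proof. by rewrite inE fixed_points_bits. Qed.

Opaque legal_family.

Lemma legal_enum P Q fP fQ n : (P, Q, fP, fQ, n) \in region_counts ->
  exists l, [/\ uniq l, size l = n & forall H, (H \in l) = (H \in legal_family P Q fP fQ)].
Proof.
move=> /card_legal <-; exists (enum (legal_family P Q fP fQ)).
by split=> [||H]; [exact: enum_uniq|rewrite -cardE|rewrite mem_enum].
Qed.

Lemma card_fixed_nodes : fixed_nodes #= `I_153.
Proof.
have [//|A [uA sA mA]] := @legal_enum false false true true 8.
have [//|B [uB sB mB]] := @legal_enum false true true false 28.
have [//|C [uC sC mC]] := @legal_enum true true false false 117.
pose fA (H : {set f25}) : signature := (H, Some 0, Some 0).
pose fB (H : {set f25}) : signature := (H, Some 0, None).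
pose fC (H : {set f25}) : signature := (H, None, None).
pose s := map fA A ++ map fB B ++ map fC C.
have sP x : x \in s -> fixed_points x.
  rewrite !mem_cat => /or3P[] /mapP[H hH ->]; apply/fixed_legal.
  - by split; [|rewrite -mA].
  - by split; [|rewrite -mB].
  - by split; [|rewrite -mC].
have -> : fixed_nodes = [set z | exists2 x, x \in s & z = U x].
  apply/seteqP; split=> z /=; last first.
    move=> [x xs ->]; exists x; have fx := sP _ xs; move: xs fx.
    by rewrite !mem_cat => /or3P[] /mapP[H _ ->] fx; split=> //; by [left|right].
  move=> [[[H p] q] [fx hp hq ->]]; exists (H, p, q) => //.
  move: hp hq fx => /= [->|->] [->|->] /fixed_legal[//= _ hH]; rewrite !mem_cat.
  - by apply/orP; left; apply: map_f; rewrite mA.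
  - by apply/orP; right; apply/orP; left; apply: map_f; rewrite mB.
  - by apply/orP; right; apply/orP; right; apply: map_f; rewrite mC.
apply: card_image_seq.
- have iA : injective fA by move=> H H' [].
  have iB : injective fB by move=> H H' [].
  have iC : injective fC by move=> H H' [].
  rewrite !cat_uniq !map_inj_uniq // uA uB uC /= andbT; apply/andP; split.
    by apply/hasPn => x; rewrite mem_cat => /orP[] /mapP[H _ ->]; apply/mapP => -[].
  by apply/hasPn => x /mapP[H _ ->]; apply/mapP => -[].
- by rewrite !size_cat !size_map sA sB sC.
- by move=> x y /sP fx /sP fy; exact: U_inj.
Qed.

Lemma card_one_parameter : one_parameter_families #= `I_43.
Proof.
have [//|A [uA sA mA]] := @legal_enum true true true false 36.
have [//|B [uB sB mB]] := @legal_enum false true true true 7.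
pose F (x : {set f25} * bool) (n : posint) : signature :=
  if x.2 then (x.1, Some (val n), None) else (x.1, Some 0, Some (val n)).
pose s := [seq (H, true) | H <- A] ++ [seq (H, false) | H <- B].
have nz (n : posint) : (Some (val n) != Some 0) = true.
  by case: n => -[|n].
have sP x n : x \in s -> fixed_points (F x n).
  rewrite mem_cat => /orP[] /mapP[H hH ->]; apply/fixed_legal.
    by split=> //; rewrite nz -mA.
  by split=> //; rewrite nz -mB.
have one : posint by exists 1.
have -> : one_parameter_families = [set z | exists2 x, x \in s & z = fun n => U (F x n)].
  apply/seteqP; split=> z /=; last first.
    move=> [x xs ->]; move: (xs); rewrite mem_cat => /orP[] /mapP[H _ xE].
      exists H, None; split; first by right.
      by left=> n; have := sP _ n xs; rewrite xE.
    exists H, (Some 0); split; first by left.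
    by right=> n; have := sP _ n xs; rewrite xE.
  move=> [H [c [hc [hz|hz]]]].
  (* A positive p excludes q = 0. *)
  - case: hc hz => -> hz.
      have [/fixed_legal[/= + _] _] := hz one.
      by case: (one) => -[|k].
    exists (H, true); last by apply/funext => n; have [_ ->] := hz n.
    have [/fixed_legal[_ hH] _] := hz one; rewrite nz in hH.
    by rewrite mem_cat map_f // mA.
  (* An infinite p excludes a finite q. *)
  - case: hc hz => -> hz; last first.
      by have [/fixed_legal[/= + _] _] := hz one.
    exists (H, false); last by apply/funext => n; have [_ ->] := hz n.
    have [/fixed_legal[_ hH] _] := hz one; rewrite nz in hH.
    by rewrite mem_cat; apply/orP; right; rewrite map_f // mB.
apply: card_image_seq.
- rewrite cat_uniq !map_inj_uniq; [|by move=> ? ? []|by move=> ? ? []].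
  rewrite uA uB andbT /=; apply/hasPn => x /mapP[H _ ->]; by apply/mapP => -[].
- by rewrite size_cat !size_map sA sB.
(* A single value of the parameter already separates the families, by injectivity of [U] on the
   fixed points. *)
- move=> x y xs ys e; have := congr1 (fun f => f one) e.
  move/(U_inj (sP _ _ xs) (sP _ _ ys)); rewrite /F.
  have n0 : val one <> 0 by case: (one) => -[|k].
  by case: (x) (y) => [H []] [H' []] //= [-> // _]; case: n0.
Qed.

Lemma card_two_parameter : two_parameter_families #= `I_9.
Proof.
have [//|A [uA sA mA]] := @legal_enum true true true true 9.
pose F (H : {set f25}) (n : pospair) : signature :=
  (H, Some (val n).1, Some (val n).2).
have nz (n : pospair) : ((Some (val n).1 != Some 0) = true) * ((Some (val n).2 != Some 0) = true).
  by case: n => -[[|m] [|n]].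
have sP H n : H \in A -> fixed_points (F H n).
  move=> hH; apply/fixed_legal; rewrite !nz; split; last by rewrite -mA.
  by case: n => -[m n] /= /andP[].
have one : pospair by exists (1, 1).
have -> : two_parameter_families = [set z | exists2 H, H \in A & z = fun n => U (F H n)].
  apply/seteqP; split=> z /=; last first.
    move=> [H hH ->]; exists H => n; have := sP H n hH; rewrite /F.
    by case: n => -[m k] i fx; split.
  move=> [H hz]; exists H.
    have := hz one; have := nz one; case: (one) => -[m k] i [/= nm nk] [].
    by move=> /fixed_legal[_]; rewrite nm nk -mA.
  by apply/funext => n; have := hz n; rewrite /F; case: n => -[m k] i [].
apply: card_image_seq uA sA _.
move=> x y xs ys e; have := congr1 (fun f => f one) e.
  by move/(U_inj (sP _ _ xs) (sP _ _ ys)) => -[].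
Qed.

Theorem theorem7p4 :
  (* the legal fixed sets in the six threshold regions *)
  [/\ [/\ census (fun p q => p = Some 0 /\ q = Some 0) 8,
          census (fun p q => p = Some 0 /\
                    exists2 n, 1 <= n & q = Some n) 7
        & census (fun p q => p = Some 0 /\ q = None) 28],
      [/\ census (fun p q => exists m n,
                    [/\ 1 <= m, m <= n, p = Some m & q = Some n]) 9,
          census (fun p q => (exists2 m, 1 <= m & p = Some m) /\ q = None) 36
        & census (fun p q => p = None /\ q = None) 117],
      (* Sub(V) corresponds bijectively to the fixed points of Can *)
      set_bij fixed_points (subvarieties V12) U
    & [/\ fixed_nodes #= `I_153,
          one_parameter_families #= `I_43
        & two_parameter_families #= `I_9]].
Proof.
split; last 2 first.
- exact: U_bij.
- by split; [exact: card_fixed_nodes|exact: card_one_parameter|exact: card_two_parameter].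
- split; [apply: (@census_legal _ false false true true)
         |apply: (@census_legal _ false true true true)
         |apply: (@census_legal _ false true true false)] => // p q.
  + by case=> -> ->.
  + by case=> -> [[|n] // _ ->].
  + by case=> -> ->.
- split; [apply: (@census_legal _ true true true true)
         |apply: (@census_legal _ true true true false)
         |apply: (@census_legal _ true true false false)] => // p q.
  + by case=> -[|m] [[|n]] [] // _ mn -> ->.
  + by case=> -[[|m] // _ ->] ->.
  + by case=> -> ->.
Qed.
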